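(* Let $X\subseteq\mathbb{A}^n_{\overline{\mathbb{Q}}}$ be an arithmetically hyperbolic affine variety over $\overline{\mathbb{Q}}$, let $K$ be a number field, let $S$ be a finite set of places of $K$, and let $\mathcal{X}\subseteq\mathbb{A}^n_{\mathcal{O}_{K,S}}$ be a model for $X$ over $\mathcal{O}_{K,S}$. Assume that for every $\mathbb{Z}$-finitely generated integral domain $A\supseteq\mathcal{O}_{K,S}$ with quotient field $L$ and every finite set of function fields $\{F_1,\dots,F_t\}$ with $F_i\supseteq L$, there is a subset $R'\subseteq\mathcal{X}(A)$ with the same Zariski closure $\overline{R'}=\overline{\mathcal{X}(A)}$ such that, for every $i\in\{1,\dots,t\}$, $h^{\mathrm{aff}}_{F_i}$ is bounded on $R'\subseteq X_{F_i}(F_i)$. Then $X$ is absolutely arithmetically hyperbolic.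
   Context: A variety over a field is an integral separated scheme of finite type over it. $\mathcal{O}_{K,S}$ denotes the ring of $S$-integers of $K$. A model for a variety $X$ over a ring $A_0$ contained in an algebraically closed field $k$ of characteristic zero is a finite type separated $A_0$-scheme $\mathcal{X}$ with $\mathcal{X}_k\cong X$ over $k$; here $\mathcal{X}$ is a closed subscheme of $\mathbb{A}^n_{\mathcal{O}_{K,S}}$ compatible with $X\subseteq\mathbb{A}^n_{\overline{\mathbb{Q}}}$. A variety $X$ over $k$ is arithmetically hyperbolic over $k$ if there are a $\mathbb{Z}$-finitely generated subring $A\subset k$ and a model $\mathcal{X}$ for $X$ over $A$ such that, for all $\mathbb{Z}$-finitely generated subrings $A'\subset k$ containing $A$, the set $\mathcal{X}(A')$ is finite. It is absolutely arithmetically hyperbolic if $X_{M}$ is arithmetically hyperbolic over $M$ for every algebraically closed field extension $M\supseteq k$. A function field $F$ means an algebraic function field over some algebraically closed field $k$ of characteristic zero, i.e. the function field of a smooth projective curve $C$ over $k$ (equivalently, a finite extension of $k(t)$); $F\supseteq L$ means that an embedding of $L$ in $F$ is given. Its set of places is $M_F=C(k)$, with valuations $v_p=\mathrm{ord}_p$. For $(x_1,\dots,x_n)\in F^n$, $h_F^{\mathrm{aff}}(x_1,\dots,x_n)=\sum_{p\in M_F}\max\{0,-v_p(x_1),\dots,-v_p(x_n)\}$. Through $A\subseteq L\subseteq F$, one has $\mathcal{X}(A)\subseteq \mathcal{X}(F)=X_F(F)\subseteq F^n$. Zariski closures of subsets of $\mathcal{X}(A)$ are taken in $\mathcal{X}_L$.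 *)

(* Defs.v *)
(* Schemes over a ring A are represented by their functors of points on
   commutative A-algebras (Demazure-Gabriel): a separated scheme of finite type
   is a Zariski sheaf with closed diagonal that is covered by finitely many open
   subfunctors of the form Spec A[x_1, ..., x_n]/J.  Algebras are allowed to be
   zero (comPzRingType), as a localization of a nonzero ring may be.
   A subring of a field k is a ring with an injective morphism to k. *)
From HB Require Import structures.
From mathcomp Require Import all_boot all_order all_algebra all_field.
From mathcomp Require Import boolp classical_sets functions cardinality fsbigop.
From mathcomp Require Import reals constructive_ereal ereal esum.
(* The notations of mpoly clash with those of the files above. *)
From mathcomp Require Import -(notations) mpoly.

Set Implicit Arguments.
Unset Strict Implicit.
Unset Printing Implicit Defensive.

Import Order.TTheory GRing.Theory Num.Theory.
Local Open Scope classical_set_scope.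
Local Open Scope ring_scope.

Notation "{ 'mpoly' T [ n ] }" := (mpoly.mpoly n T)
  (at level 0, T at level 2, format "{ 'mpoly'  T [ n ] }") : type_scope.

Definition ideal_gen (R : comPzRingType) (B : set R) : set R :=
  [set x | exists (m : nat) (c g : 'I_m -> R),
     (forall i, B (g i)) /\ x = \sum_(i < m) c i * g i].

Definition fg_ring (A : comNzRingType) : Prop :=
  exists (m : nat) (a : 'I_m -> A), forall x : A,
    exists p : {mpoly int[m]}, x = mmap intr a p.

Record algebra (A : comPzRingType) := Algebra {
  alg_sort :> comPzRingType;
  alg_map : {rmorphism A -> alg_sort} }.

Record alg_hom (A : comPzRingType) (R S : algebra A) := AlgHom {
  hom_fun :> {rmorphism R -> S};
  hom_struct : forall a, hom_fun (alg_map R a) = alg_map S a }.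

Record alg_functor (A : comPzRingType) := AlgFunctor {
  fobj :> algebra A -> Type;
  fmap : forall R S : algebra A, alg_hom R S -> fobj R -> fobj S;
  fmap_id : forall (R : algebra A) (f : alg_hom R R),
    f =1 id -> forall x, fmap f x = x;
  fmap_comp : forall (R S T : algebra A)
      (f : alg_hom R S) (g : alg_hom S T) (h : alg_hom R T),
    h =1 g \o f -> forall x, fmap h x = fmap g (fmap f x) }.
Arguments fmap {A} X {R S} f x : rename.

Definition restrict_scalars (A B : comPzRingType) (phi : {rmorphism A -> B})
  (R : algebra B) : algebra A := @Algebra A R (alg_map R \o phi).

Definition restrict_hom (A B : comPzRingType) (phi : {rmorphism A -> B})
    (R S : algebra B) (f : alg_hom R S) :
    alg_hom (restrict_scalars phi R) (restrict_scalars phi S) :=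
  @AlgHom A (restrict_scalars phi R) (restrict_scalars phi S) (hom_fun f)
    (fun a => hom_struct f (phi a)).

Definition base_change (A B : comPzRingType) (phi : {rmorphism A -> B})
    (X : alg_functor A) : alg_functor B :=
  @AlgFunctor B (fun R => X (restrict_scalars phi R))
    (fun R S f => fmap X (restrict_hom phi f))
    (fun R f fid => @fmap_id A X _ (restrict_hom phi f) fid)
    (fun R S T f g h hgf => @fmap_comp A X _ _ _
       (restrict_hom phi f) (restrict_hom phi g) (restrict_hom phi h) hgf).

Definition natural (A : comPzRingType) (Y X : alg_functor A)
    (e : forall R, Y R -> X R) : Prop :=
  forall (R S : algebra A) (f : alg_hom R S) (y : Y R),
    e S (fmap Y f y) = fmap X f (e R y).

Definition functor_iso (A : comPzRingType) (Y X : alg_functor A) : Prop :=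
  exists e : forall R, Y R -> X R, natural e /\ forall R, bijective (e R).

(* This is mmap, whose target is required to be a nonzero ring. *)
Definition aeval (A : comNzRingType) (R : algebra A) (n : nat) (x : 'I_n -> R)
    (p : {mpoly A[n]}) : R :=
  \sum_(m <- msupp p)
    alg_map R (mcoeff m p) * \prod_(i < n) x i ^+ m i.

Lemma aeval_hom (A : comNzRingType) (R S : algebra A) (f : alg_hom R S)
    (n : nat) (x : 'I_n -> R) (p : {mpoly A[n]}) :
  f (aeval x p) = aeval (f \o x) p.
Proof.
rewrite /aeval rmorph_sum; apply: eq_bigr => m _.
rewrite rmorphM hom_struct rmorph_prod; congr (_ * _).
by apply: eq_bigr => i _; rewrite rmorphXn.
Qed.

Definition zeros (A : comNzRingType) (n : nat) (J : set {mpoly A[n]})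
    (R : algebra A) : Type :=
  {x : 'I_n -> R | forall p, J p -> aeval x p = 0}.

Lemma zeros_map_subproof (A : comNzRingType) (n : nat) (J : set {mpoly A[n]})
    (R S : algebra A) (f : alg_hom R S) (x : zeros J R) :
  forall p, J p -> aeval (f \o sval x) p = 0.
Proof. by move=> p Jp; rewrite -aeval_hom (svalP x p Jp) rmorph0. Qed.

Definition zeros_map (A : comNzRingType) (n : nat) (J : set {mpoly A[n]})
    (R S : algebra A) (f : alg_hom R S) (x : zeros J R) : zeros J S :=
  exist _ (f \o sval x) (zeros_map_subproof f x).

Lemma zeros_map_id (A : comNzRingType) (n : nat) (J : set {mpoly A[n]})
    (R : algebra A) (f : alg_hom R R) :
  f =1 id -> forall x : zeros J R, zeros_map f x = x.
Proof.
by move=> fid [x xJ]; apply: eq_exist; apply: funext => i /=; rewrite fid.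
Qed.

Lemma zeros_map_comp (A : comNzRingType) (n : nat) (J : set {mpoly A[n]})
    (R S T : algebra A) (f : alg_hom R S) (g : alg_hom S T) (h : alg_hom R T) :
  h =1 g \o f -> forall x : zeros J R, zeros_map h x = zeros_map g (zeros_map f x).
Proof.
by move=> hgf [x xJ]; apply: eq_exist; apply: funext => i /=; rewrite hgf.
Qed.

(* V(J) = Spec A[x_1, ..., x_n]/(J) *)
Definition closed_subscheme (A : comNzRingType) (n : nat)
    (J : set {mpoly A[n]}) : alg_functor A :=
  @AlgFunctor A (zeros J) (@zeros_map A n J) (@zeros_map_id A n J)
    (@zeros_map_comp A n J).

Definition is_localization (R S : comPzRingType) (f : R) (phi : R -> S) : Prop :=
  [/\ exists s, phi f * s = 1,
      forall y, exists (a : R) (m : nat), y * phi f ^+ m = phi a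
    & forall a, phi a = 0 -> exists m : nat, f ^+ m * a = 0].

Definition zariski_sheaf (A : comPzRingType) (X : alg_functor A) : Prop :=
  forall (R : algebra A) (m : nat) (f : 'I_m -> R),
    ideal_gen (range f) 1 ->
  forall (S : 'I_m -> algebra A) (phi : forall i, alg_hom R (S i))
         (T : 'I_m -> 'I_m -> algebra A)
         (l : forall i j, alg_hom (S i) (T i j))
         (r : forall i j, alg_hom (S j) (T i j)),
    (forall i, is_localization (f i) (phi i)) ->
    (forall i j, is_localization (f i * f j) (l i j \o phi i)) ->
    (forall i j, l i j \o phi i =1 r i j \o phi j) ->
  forall x : forall i, X (S i),
    (forall i j, fmap X (l i j) (x i) = fmap X (r i j) (x j)) ->
    exists! y : X R, forall i, fmap X (phi i) y = x i.

Definition separated_functor (A : comPzRingType) (X : alg_functor A) : Prop :=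
  forall (R : algebra A) (x y : X R), exists a : set R,
    forall (S : algebra A) (phi : alg_hom R S),
      fmap X phi x = fmap X phi y <-> forall r, a r -> phi r = 0.

Definition open_immersion (A : comPzRingType) (Y X : alg_functor A)
    (e : forall R, Y R -> X R) : Prop :=
  [/\ natural e,
      forall R, injective (e R)
    & forall (R : algebra A) (x : X R), exists a : set R,
        forall (S : algebra A) (phi : alg_hom R S),
          range (e S) (fmap X phi x) <-> ideal_gen (phi @` a) 1].

(* Open subfunctors cover a scheme as soon as they do so on points in fields. *)
Definition finite_type_atlas (A : comNzRingType) (X : alg_functor A) : Prop :=
  exists (m : nat) (n : 'I_m -> nat) (J : forall i, set {mpoly A[n i]})
         (e : forall i R, closed_subscheme (J i) R -> X R),
    (forall i, open_immersion (e i)) /\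
    (forall (K : fieldType) (s : {rmorphism A -> K}) (x : X (Algebra s)),
       exists i, range (e i (Algebra s)) x).

Definition finite_type_separated_scheme (A : comNzRingType)
    (X : alg_functor A) : Prop :=
  [/\ zariski_sheaf X, finite_type_atlas X & separated_functor X].

Definition is_model (A : comNzRingType) (k : fieldType)
    (iota : {rmorphism A -> k}) (XX : alg_functor A) (X : alg_functor k) : Prop :=
  finite_type_separated_scheme XX /\ functor_iso (base_change iota XX) X.

Definition arithmetically_hyperbolic (k : closedFieldType)
    (X : alg_functor k) : Prop :=
  exists (A : comNzRingType) (iota : {rmorphism A -> k}) (XX : alg_functor A),
    [/\ injective iota, fg_ring A, is_model iota XX X
      & forall (A' : comNzRingType) (iota' : {rmorphism A' -> k})
               (j : {rmorphism A -> A'}),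
          injective iota' -> fg_ring A' -> iota' \o j =1 iota ->
          finite_set [set: XX (Algebra j)]].

Definition absolutely_arithmetically_hyperbolic (k : closedFieldType)
    (X : alg_functor k) : Prop :=
  forall (M : closedFieldType) (s : {rmorphism k -> M}),
    arithmetically_hyperbolic (base_change s X).

Record discrete_valuation (F : fieldType) (v : F -> \bar int) : Prop :=
  DiscreteValuation {
    dv_neqNy : forall x, v x <> -oo%E;
    dv_eqy : forall x, v x = +oo%E <-> x = 0;
    dv_mul : forall x y, v (x * y) = (v x + v y)%E;
    dv_add : forall x y, (mine (v x) (v y) <= v (x + y)%R)%E;
    dv_norm : exists x, v x = 1%:E }.

(* A non-archimedean place of a number field is given by its normalized
   valuation and an archimedean one by a complex embedding.  Conjugate
   embeddings, which give the same place, are not identified: archimedean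
   places impose no condition on S-integers. *)
Variant place (K : fieldType) : Type :=
  | NonarchimedeanPlace (v : K -> \bar int) of discrete_valuation v
  | ArchimedeanPlace of {rmorphism K -> algC}.

Section SIntegers.
Variables (K : fieldType) (S : set (place K)).

Definition S_integer : {pred K} := fun x =>
  `[< forall (v : K -> \bar int) (hv : discrete_valuation v),
        ~ S (NonarchimedeanPlace hv) -> (0 <= v x)%E >].

Lemma dv1 (v : K -> \bar int) : discrete_valuation v -> v 1 = 0%E.
Proof.
move=> hv; have := dv_mul hv 1 1; rewrite mulr1.
case E: (v 1) => [a||] //.
- by move=> [/eqP]; rewrite -subr_eq0 opprD addNKr oppr_eq0 => /eqP ->.
- by move/(dv_eqy hv): E => /eqP; rewrite oner_eq0.
- by move/(dv_neqNy hv): E.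
Qed.

Lemma dvN1 (v : K -> \bar int) : discrete_valuation v -> v (-1) = 0%E.
Proof.
move=> hv; have := dv_mul hv (-1) (-1); rewrite mulrNN mulr1 dv1 //.
case E: (v (-1)) => [a||] //.
by move=> [/esym/eqP]; rewrite -mulr2n mulrn_eq0 /= => /eqP ->.
Qed.

Fact S_integer_subring : subring_closed S_integer.
Proof.
split=> [|x y|x y].
- by apply/asboolP => v hv _; rewrite dv1.
- move=> /asboolP hx /asboolP hy; apply/asboolP => v hv Sv.
  apply: (le_trans _ (dv_add hv x (- y))); rewrite le_min (hx v hv Sv) /=.
  by rewrite -mulN1r (dv_mul hv) dvN1 // add0e (hy v hv Sv).
- move=> /asboolP hx /asboolP hy; apply/asboolP => v hv Sv.
  by rewrite (dv_mul hv) adde_ge0 ?(hx v hv Sv) ?(hy v hv Sv).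
Qed.

HB.instance Definition _ :=
  GRing.isSubringClosed.Build K S_integer S_integer_subring.

Record S_integers : Type :=
  SInteger { S_val :> K; _ : S_val \in S_integer }.

HB.instance Definition _ := [isSub for S_val].
HB.instance Definition _ := [Choice of S_integers by <:].
HB.instance Definition _ := [SubChoice_isSubComNzRing of S_integers by <:].

End SIntegers.

(* A finite extension of k(t); t is part of the data, but neither the places
   nor the height depend on it. *)
Record function_field := FunctionField {
  ff_const : closedFieldType;
  ff_char0 : [pchar ff_const] =i pred0;
  ff_sort :> fieldExtType {fraction {poly ff_const}} }.

Definition ff_embed (F : function_field) (c : ff_const F) : F :=
  (tofrac c%:P)%:A.

(* The points of the smooth projective curve over k with function field F
   correspond to the normalized discrete valuations of F that are trivial on
   k. *)
Definition ff_places (F : function_field) : set (F -> \bar int) :=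
  [set v | discrete_valuation v /\ forall c, c != 0 -> v (ff_embed c) = 0%E].

Definition aff_height (R : realType) (F : function_field) (n : nat)
    (x : 'I_n -> F) : \bar R :=
  \esum_(v in ff_places (F := F))
    er_map intr (\big[maxe/0%E]_(i < n) (- v (x i))%E).

(* The closure, in the subscheme V(J) of affine n-space over L, of a set T of
   L-points: a point is a prime ideal of L[x_1, ..., x_n], and the closure of T
   is the intersection of the closed sets V(E) containing T, where an L-point x
   lies in V(E) when all elements of E vanish at x. *)
Definition zariski_closure (L : fieldType) (n : nat) (J : set {mpoly L[n]})
    (T : set ('I_n -> L)) : set ({mpoly L[n]} -> bool) :=
  [set q : {mpoly L[n]} -> bool | [/\ idealr_closed q, prime_idealr_closed q,
     forall p, J p -> q p
   & forall E : set {mpoly L[n]},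
       (forall x, T x -> forall p, E p -> meval x p = 0) ->
       forall p, E p -> q p]].

(* Main.v *)
(* Let Fin(k) say that X has finitely many points over every finitely generated
   subring of the algebraically closed field k.  Arithmetic hyperbolicity gives
   Fin(Q-bar) by spreading out: an isomorphism from X to the generic fibre of an
   abstract model involves finitely many constants.  To reach an algebraically
   closed field M one adjoins the generators of the ring A one at a time, so it
   is enough to pass from k to the algebraic closure of k(t), that is, to bound
   the points of X over a finitely generated subring A of a function field F
   over k.  The hypothesis is used for F alone.  If x and y in R' have the same
   residues at all places above sufficiently many points of the line, then each
   x_l - y_l vanishes at more places than its bounded height permits, so x = y.
   By Fin(k) each of the finitely many residue maps A -> k concerned takes only
   finitely many values on the points.  Hence R' is finite, therefore closed,
   and it contains all points over A.

   The hypothesis is about rings A containing the S-integers, so one also needs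
   that these lie in a finitely generated ring; this rests, like the properties
   of places of F, on the existence of valuation rings avoiding a given
   non-integral element. *)
Require Import Defs.
From HB Require Import structures.
From mathcomp Require Import all_boot all_order all_algebra all_field.
From mathcomp Require Import boolp classical_sets functions cardinality fsbigop.
From mathcomp Require Import reals constructive_ereal ereal esum.
From mathcomp Require Import -(notations) mpoly.
From mathcomp Require Import ring_quotient generic_quotient.
From mathcomp Require Import zify ring.

Set Implicit Arguments.
Unset Strict Implicit.
Unset Printing Implicit Defensive.

Import Order.TTheory GRing.Theory Num.Theory.
Local Open Scope classical_set_scope.
Local Open Scope ring_scope.

(** * Subrings and fractions *)

(** There is no curve and no product formula to work with: places are just discrete valuations. The
    degree of a divisor is replaced by the fact that a nonconstant element has a pole, applied to an
    auxiliary element that has no poles but vanishes at infinity. Poles come from Chevalley's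
    theorem, which yields only a valuation ring. It is discrete because a bounded power of each
    element is, up to a unit, a power of one fixed element; a Newton polygon argument shows this for
    finite extensions of k(t) and of Q alike.

    Arithmetic hyperbolicity speaks of one model, possibly given abstractly. To compare it with
    equations, one finite list of constants must serve all subrings and all points at once; it is
    read off the universal point.

    The S-integers are only shown to lie in a finitely generated subring of K, so the model of X
    over M has the subring generated by the images of those generators as its base. All constant
    fields of the induction stay inside M, where their points can be compared. *)

Section Subrings.
Variable E : idomainType.

Record subring (G : subringClosed E) : Type :=
  Subring { subring_val :> E; _ : subring_val \in G }.

Variable G : subringClosed E.
HB.instance Definition _ := [isSub for @subring_val G].
HB.instance Definition _ := [Choice of subring G by <:].
HB.instance Definition _ := [SubChoice_isSubComNzRing of subring G by <:].

(** Fraction fields are formed over domains with a unit structure. Inverses within [G] are chosen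
    classically, since [G] need not be stable under the inversion of [E]. *)
Definition subring_unit : {pred subring G} :=
  fun x => `[< exists y : subring G, y * x = 1 >].
Definition subring_inv (x : subring G) : subring G :=
  if pselect (exists y : subring G, y * x = 1) is left h then xget x [set y | y * x = 1]
  else x.

Lemma subring_mulVr : {in subring_unit, left_inverse 1 subring_inv *%R}.
Proof.
move=> x /asboolP hx; rewrite /subring_inv; case: pselect => // h.
by case: xgetP => [y _ //|/(_ _) hn]; case: h => y hy; case: (hn y).
Qed.

Lemma subring_unitPl (x y : subring G) : y * x = 1 -> x \in subring_unit.
Proof. by move=> h; apply/asboolP; exists y. Qed.

Lemma subring_invr_out : {in [predC subring_unit], subring_inv =1 id}.
Proof.
by move=> x hx; rewrite /subring_inv; case: pselect => // h; case/asboolP: hx.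
Qed.

HB.instance Definition _ := GRing.ComNzRing_hasMulInverse.Build (subring G)
  subring_mulVr subring_unitPl subring_invr_out.

Lemma subring_integral (x y : subring G) : x * y = 0 -> (x == 0) || (y == 0).
Proof.
move=> /(congr1 val); rewrite rmorphM rmorph0 => /eqP.
by rewrite mulf_eq0 -!(rmorph0 (val : subring G -> E)) !(inj_eq val_inj).
Qed.
HB.instance Definition _ := GRing.ComUnitRing_isIntegral.Build (subring G) subring_integral.

End Subrings.

Section SubringMorphisms.
Variables (E : idomainType) (G : subringClosed E).

Definition subring_incl (H : subringClosed E) (GH : {subset G <= H})
  (x : subring G) : subring H := @Subring E H (val x) (GH _ (valP x)).

Lemma subring_incl_zmod H GH : zmod_morphism (@subring_incl H GH).
Proof. by move=> x y; apply: val_inj. Qed.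
Lemma subring_incl_monoid H GH : monoid_morphism (@subring_incl H GH).
Proof. by split=> [|x y]; apply: val_inj. Qed.
HB.instance Definition _ (H : subringClosed E) (GH : {subset G <= H}) :=
  GRing.isZmodMorphism.Build (subring G) (subring H) (@subring_incl H GH) (@subring_incl_zmod H GH).
HB.instance Definition _ (H : subringClosed E) (GH : {subset G <= H}) :=
  GRing.isMonoidMorphism.Build (subring G) (subring H) (@subring_incl H GH) (@subring_incl_monoid H GH).

Section Corestriction.
Variables (R : pzRingType) (f : {rmorphism R -> E}) (fG : forall x, f x \in G).
Definition to_subring (x : R) : subring G := @Subring E G (f x) (fG x).
Lemma to_subring_zmod : zmod_morphism to_subring.
Proof. by move=> x y; apply: val_inj; rewrite /= rmorphB. Qed.
Lemma to_subring_monoid : monoid_morphism to_subring.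
Proof. by split=> [|x y]; apply: val_inj; rewrite /= ?rmorph1 ?rmorphM. Qed.
HB.instance Definition _ := GRing.isZmodMorphism.Build _ _ to_subring to_subring_zmod.
HB.instance Definition _ := GRing.isMonoidMorphism.Build _ _ to_subring to_subring_monoid.
End Corestriction.

End SubringMorphisms.

Section Generated.
Variables (E : comNzRingType) (m : nat) (a : 'I_m -> E).

Definition gen_ring : {pred E} :=
  fun x => `[< exists p : {mpoly int[m]}, x = mmap intr a p >].

Lemma gen_ring_subring : subring_closed gen_ring.
Proof.
split=> [|x y /asboolP[p ->] /asboolP[q ->]|x y /asboolP[p ->] /asboolP[q ->]].
- by apply/asboolP; exists 1; rewrite rmorph1.
- by apply/asboolP; exists (p - q); rewrite rmorphB.
- by apply/asboolP; exists (p * q); rewrite rmorphM.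
Qed.
HB.instance Definition _ := GRing.isSubringClosed.Build E gen_ring gen_ring_subring.

Lemma gen_ringX i : a i \in gen_ring.
Proof. by apply/asboolP; exists (mpolyX _ (mnm1 i)); rewrite mmapX mmap1U. Qed.

End Generated.

Lemma mmap_in (E : comNzRingType) (G : subringClosed E) (R : nzRingType) m
    (f : {rmorphism R -> E}) (a : 'I_m -> E) (p : {mpoly R[m]}) :
  (forall c, f c \in G) -> (forall i, a i \in G) -> mmap f a p \in G.
Proof.
move=> fG aG; rewrite /mmap rpred_sum // => i _; rewrite rpredM //.
by rewrite /mmap1 rpred_prod // => j _; rewrite rpredX.
Qed.

Lemma gen_ring_min (E : comNzRingType) (G : subringClosed E) m (a : 'I_m -> E) :
  (forall i, a i \in G) -> {subset gen_ring a <= G}.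
Proof.
by move=> aG x /asboolP[p ->]; apply: mmap_in => // c; exact: rpred_int.
Qed.

Lemma rmorph_mmap (R S T : comNzRingType) m (f : {rmorphism R -> S})
    (g : {rmorphism S -> T}) (a : 'I_m -> S) p :
  g (mmap f a p) = mmap (g \o f) (g \o a) p.
Proof.
rewrite /mmap rmorph_sum; apply: eq_bigr => i _; rewrite rmorphM; congr (_ * _).
by rewrite /mmap1 rmorph_prod; apply: eq_bigr => j _; rewrite rmorphXn.
Qed.

Lemma eq_mmap (R S : nzRingType) m (f g : R -> S) (a b : 'I_m -> S) p :
  f =1 g -> a =1 b -> mmap f a p = mmap g b p.
Proof.
move=> fg ab; apply: eq_bigr => i _; rewrite fg; congr (_ * _).
by apply: eq_bigr => j _; rewrite ab.
Qed.

Lemma fg_gen_ring (E : idomainType) m (a : 'I_m -> E) :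
  fg_ring (subring (gen_ring a)).
Proof.
exists m, (fun i => Subring (gen_ringX a i)) => -[x xG] /=.
have /asboolP[p xE] := xG; exists p; apply: val_inj => /=.
rewrite [RHS](rmorph_mmap _ (val : subring (gen_ring a) -> E)) xE.
apply: eq_mmap => // c; rewrite [RHS](rmorph_int (val : subring (gen_ring a) -> E)) //.
Qed.

Lemma fractionP (A : idomainType) (x : {fraction A}) :
  exists n d : A, d != 0 /\ x = tofrac n / tofrac d.
Proof.
elim/quotW: x => r; exists (frac r).1, (frac r).2; split; first exact: denom_ratioP.
have -> : @FracField.tofrac A = fun x => \pi_(FracField.type A)%qT (Ratio x 1) by unlock FracField.tofrac.
rewrite -[X in _ * X]FracField.pi_inv -[RHS]FracField.pi_mul; congr (\pi_ _ _)%qT.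
have dr : (frac r).2 != 0 := denom_ratioP r.
rewrite /FracField.mulf /FracField.invf !numden_Ratio ?oner_eq0 // mul1r mulr1.
by rewrite FracField.Ratio_numden.
Qed.

Section FractionLift.
Variables (A : idomainType) (F : fieldType) (f : {rmorphism A -> F}).
Hypothesis f_inj : injective f.

Lemma frac_lift_exists (x : {fraction A}) :
  exists y : F, forall n d, d != 0 -> x = tofrac n / tofrac d -> y = f n / f d.
Proof.
have f0 d : d != 0 -> f d != 0 by rewrite -(rmorph0 f) (inj_eq f_inj).
have t0 (d : A) : d != 0 -> tofrac d != 0 by rewrite tofrac_eq0.
have [n [d [d0 ->]]] := fractionP x; exists (f n / f d) => n' d' d'0 /eqP.
rewrite (eqr_div _ _ (t0 _ d0) (t0 _ d'0)) -!rmorphM tofrac_eq => /eqP h.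
by apply/eqP; rewrite eqr_div ?f0 // -!rmorphM h.
Qed.

(** Injectivity is an argument so that the morphism structure can attach to [frac_lift f_inj]. *)
Definition frac_lift of injective f := fun x : {fraction A} => xget (0 : F)
  [set y | forall n d, d != 0 -> x = tofrac n / tofrac d -> y = f n / f d].

Lemma frac_liftE n d : d != 0 -> frac_lift f_inj (tofrac n / tofrac d) = f n / f d.
Proof.
move=> d0; rewrite /frac_lift; case: xgetP => [y _ /(_ n d d0 erefl) //|hn].
by have [y hy] := frac_lift_exists (tofrac n / tofrac d); case: (hn y).
Qed.

Lemma frac_lift_tofrac n : frac_lift f_inj (tofrac n) = f n.
Proof.
by have := frac_liftE n (oner_neq0 A); rewrite !rmorph1 !divr1.
Qed.

Lemma frac_lift_zmod : zmod_morphism (frac_lift f_inj).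
Proof.
have f0 d : d != 0 -> f d != 0 by rewrite -(rmorph0 f) (inj_eq f_inj).
have t0 (d : A) : d != 0 -> tofrac d != 0 by rewrite tofrac_eq0.
move=> x y; have [n [d [d0 ->]]] := fractionP x; have [n' [d' [d'0 ->]]] := fractionP y.
have sub_div (K : fieldType) (a b c e : K) : b != 0 -> e != 0 ->
    a / b - c / e = (a * e - c * b) / (b * e).
  by move=> b0 e0; rewrite -mulNr addf_div // mulNr.
rewrite sub_div ?t0 // -!rmorphM -rmorphB !frac_liftE ?mulf_neq0 //.
by rewrite sub_div ?f0 // rmorphB !rmorphM.
Qed.

Lemma frac_lift_monoid : monoid_morphism (frac_lift f_inj).
Proof.
split=> [|x y]; first by rewrite -tofrac1 frac_lift_tofrac rmorph1.
have [n [d [d0 ->]]] := fractionP x; have [n' [d' [d'0 ->]]] := fractionP y.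
by rewrite mulf_div -!rmorphM !frac_liftE ?mulf_neq0 // mulf_div -!rmorphM.
Qed.
HB.instance Definition _ :=
  GRing.isZmodMorphism.Build {fraction A} F (frac_lift f_inj) frac_lift_zmod.
HB.instance Definition _ :=
  GRing.isMonoidMorphism.Build {fraction A} F (frac_lift f_inj) frac_lift_monoid.

End FractionLift.

(** * Existence of valuation rings *)

Record is_subring (K : fieldType) (V : set K) : Prop := IsSubring {
  sr1 : V 1;
  srB : forall x y, V x -> V y -> V (x - y);
  srM : forall x y, V x -> V y -> V (x * y) }.

Record is_val_ring (K : fieldType) (V : set K) : Prop := IsValRing {
  vr_sub : is_subring V;
  vr_tot : forall x, V x \/ V x^-1 }.

Section IsSubring.
Variables (K : fieldType) (V : set K).
Hypothesis hV : is_subring V.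

Lemma sr0 : V 0. Proof. by rewrite -(subrr 1); apply: srB => //; exact: sr1. Qed.
Lemma srN x : V x -> V (- x).
Proof. by move=> Vx; rewrite -sub0r; apply: srB => //; exact: sr0. Qed.
Lemma srD x y : V x -> V y -> V (x + y).
Proof. by move=> Vx Vy; rewrite -[y]opprK; apply: srB => //; exact: srN. Qed.
Lemma sr_sum (I : Type) (r : seq I) (P : pred I) (F : I -> K) :
  (forall i, P i -> V (F i)) -> V (\sum_(i <- r | P i) F i).
Proof. by move=> h; apply: (big_ind V) => //; [exact: sr0|exact: srD]. Qed.
Lemma srX x n : V x -> V (x ^+ n).
Proof.
by move=> Vx; elim: n => [|n ih]; rewrite ?expr0 ?exprS; [exact: sr1|exact: srM].
Qed.
Lemma sr_nat n : V n%:R.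
Proof. by elim: n => [|n ih]; [exact: sr0|rewrite -natr1; apply: srD => //; exact: sr1]. Qed.
Lemma sr_int (n : int) : V n%:~R.
Proof. by case: n => n; [exact: sr_nat|rewrite NegzE mulrNz; apply: srN; exact: sr_nat]. Qed.
Lemma sr_horner (p : {poly K}) y : (forall i, V p`_i) -> V y -> V p.[y].
Proof. by move=> hp Vy; rewrite horner_coef; apply: sr_sum => i _; apply: srM => //; exact: srX. Qed.

Lemma is_subring_poly (y : K) :
  is_subring [set z | exists2 p : {poly K}, (forall i, V p`_i) & z = p.[y]].
Proof.
split=> [|_ _ [p hp ->] [q hq ->]|_ _ [p hp ->] [q hq ->]].
- exists 1; last by rewrite hornerE.
  by move=> i; rewrite coef1; case: (i == 0%N); [exact: sr1|exact: sr0].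
- by exists (p - q); [move=> i; rewrite coefB; apply: srB|rewrite !hornerE].
- exists (p * q); last by rewrite hornerM.
  by move=> i; rewrite coefM; apply: sr_sum => j _; apply: srM.
Qed.
End IsSubring.

Section Chevalley.
Variables (K : fieldType) (D : set K) (a : K).
Hypotheses (hD : is_subring D) (Da : D a) (Da' : ~ D a^-1).

Lemma maximal_avoiding_subring : exists V : set K,
  [/\ is_subring V, D `<=` V, ~ V a^-1
    & forall B, is_subring B -> V `<=` B -> ~ B a^-1 -> B `<=` V].
Proof.
(* The conditions are put on the union with [D], so that the empty chain, whose union is empty, is
   covered as well. *)
pose P (B : set K) := is_subring (B `|` D) /\ ~ (B `|` D) a^-1.
have [F FP Ftot|A [[A1 A2] Amax]] := @Zorn_bigcup K P.
  have two x y : (\bigcup_(X in F) X `|` D) x -> (\bigcup_(X in F) X `|` D) y ->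
     exists B, [/\ is_subring (B `|` D), B `<=` \bigcup_(X in F) X, (B `|` D) x & (B `|` D) y].
    move=> [[X FX Xx]|Dx] [[Y FY Yy]|Dy].
    - have [[hX _] [hY _]] := (FP _ FX, FP _ FY).
      have [XY|YX] := Ftot _ _ FX FY; [exists Y|exists X]; split=> //.
      + by move=> z Yz; exists Y.
      + by left; exact: XY.
      + by left.
      + by move=> z Xz; exists X.
      + by left.
      + by left; exact: YX.
    - have [hX _] := FP _ FX; exists X.
      by split=> //; [move=> z Xz; exists X|left|right].
    - have [hY _] := FP _ FY; exists Y.
      by split=> //; [move=> z Yz; exists Y|right|left].
    - by exists set0; split; [rewrite set0U|exact: sub0set|right|right].
  split.
    split=> [|x y hx hy|x y hx hy]; first by right; exact: sr1.
      have [B [hB BF Bx By]] := two _ _ hx hy.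
      by have [/BF|] := srB hB Bx By; [left|right].
    have [B [hB BF Bx By]] := two _ _ hx hy.
    by have [/BF|] := srM hB Bx By; [left|right].
  by move=> [[X FX Xa]|//]; have [_ []] := FP _ FX; left.
exists (A `|` D); split=> //.
move=> B hB VB Ba z Bz; apply: contrapT => nz.
have DB : B `|` D = B by apply/seteqP; split=> [w [//|Dw]|w]; [apply: VB; right|left].
apply: (Amax B); last by rewrite /P DB.
by split=> [w Aw|h]; [apply: VB; left|apply: nz; left; exact: h].
Qed.

Variable V : set K.
Hypotheses (hV : is_subring V) (Va : V a) (Va' : ~ V a^-1).
Hypothesis Vmax : forall B, is_subring B -> V `<=` B -> ~ B a^-1 -> B `<=` V.

(** With c = 1 - ab, the ring V[1/c] still avoids 1/a: from 1/a = b'/c^m and c^m = 1 - ad one gets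
    1/a = b' + d in [V]. Maximality then puts 1/c in [V]. *)
Lemma avoiding_unit b : V b -> V (1 - a * b)^-1.
Proof.
move=> Vb; set c := 1 - a * b.
have Vc : V c by apply: srB (sr1 hV) (srM hV Va Vb).
have a0 : a != 0 by apply: contra_notN Va' => /eqP ->; rewrite invr0; exact: sr0.
have c0 : c != 0.
  apply: contra_notN Va'; rewrite subr_eq0 eq_sym => /eqP ab1.
  by rewrite -[a^-1]mulr1 -ab1 mulKf.
have cm m : exists2 d, V d & c ^+ m = 1 - a * d.
  elim: m => [|m [d Vd cE]]; first by exists 0; [exact: sr0|rewrite mulr0 subr0].
  exists (d + c ^+ m * b); first by apply: srD => //; apply: srM => //; exact: srX.
  by rewrite exprSr {2}/c mulrBr mulr1 {1}cE; ring.
pose C := [set z | exists b' m, V b' /\ z = b' / c ^+ m].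
have CV : C `<=` V.
  apply: Vmax.
  - split=> [|_ _ [x [m [Vx ->]]] [y [k [Vy ->]]]|_ _ [x [m [Vx ->]]] [y [k [Vy ->]]]].
    + by exists 1, 0; split; [exact: sr1|rewrite divr1].
    + exists (x * c ^+ k - y * c ^+ m), (m + k)%N; split.
        by apply: srB => //; apply: srM => //; exact: srX.
      have [cm0 ck0] : c ^+ m != 0 /\ c ^+ k != 0 by rewrite !expf_neq0.
      by rewrite exprD -!mulNr addf_div // mulNr.
    + exists (x * y), (m + k)%N; split; first exact: srM.
      by rewrite exprD mulf_div.
  - by move=> z Vz; exists z, 0; rewrite divr1.
  - move=> [b' [m [Vb' aE]]]; apply: Va'.
    have [d Vd dE] := cm m.
    suff -> : a^-1 = b' + d by exact: srD.
    apply: (mulfI a0); rewrite divff // mulrDr.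
    have -> : a * b' = c ^+ m by rewrite -[b'](divfK (expf_neq0 m c0)) -aE mulVKf.
    by rewrite dE subrK.
by apply: CV; exists 1, 1; split; [exact: sr1|rewrite mul1r].
Qed.

(** As 1 - a q_0 is a unit, the relation a q(1/y) = 1 writes 1 as a combination of negative powers
    of y with coefficients in [V]. Multiplying the leading term of [p] by this combination lowers
    its degree. *)
Lemma avoiding_reduce (y : K) (p q : {poly K}) : y != 0 ->
  (forall i, V p`_i) -> (forall i, V q`_i) -> (size q <= size p)%N ->
  a * q.[y^-1] = 1 ->
  exists p' : {poly K}, [/\ (size p' < size p)%N, forall i, V p'`_i & p'.[y] = p.[y]].
Proof.
move=> y0 Vp Vq qp aq.
have a0 : a != 0 by apply: contra_notN Va' => /eqP ->; rewrite invr0; exact: sr0.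
have Vc := avoiding_unit (Vq 0%N); set c := _^-1 in Vc.
case: (ltnP 1 (size q)) => sq; last first.
  case: Va'; have -> : a^-1 = q`_0; last exact: Vq.
  by apply: (mulfI a0); rewrite divff // -aq (size1_polyC sq) hornerC coefC.
have qE : q.[y^-1] = q`_0 + \sum_(i < (size q).-1) q`_i.+1 * y^-1 ^+ i.+1.
  rewrite horner_coef; case: (size q) sq => // k _.
  by rewrite big_ord_recl expr0 mulr1.
set s := \sum_(i < _) _ in qE.
have c0 : 1 - a * q`_0 != 0.
  apply: contra_notN Va'; rewrite subr_eq0 eq_sym => /eqP ab1.
  by rewrite -[a^-1]mulr1 -ab1 mulKf.
have sE : a * (c * s) = 1.
  rewrite mulrCA; apply: (mulfI c0); rewrite mulVKf // mulr1.
  by rewrite -[X in _ = X - _]aq qE; ring.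
set n := (size p).-1; have np : size p = n.+1 by rewrite prednK //; lia.
pose r := \sum_(i < (size q).-1) (a * c * q`_i.+1 * p`_n) *: 'X^(n - i.+1).
have rE : r.[y] = p`_n * y ^+ n.
  rewrite -[RHS]mulr1 -sE /r horner_sum !mulr_sumr.
  apply: eq_bigr => i _; rewrite hornerZ hornerXn.
  have -> : y ^+ n = y ^+ (n - i.+1) * y ^+ i.+1.
    by rewrite -exprD subnK //; have := ltn_ord i; lia.
  have := expf_neq0 i.+1 y0; rewrite exprVn; set z := y ^+ i.+1 => z0.
  by field.
pose pn := \poly_(i < n) p`_i.
exists (pn + r); split.
- rewrite np ltnS; apply: leq_trans (size_polyD _ _) _; rewrite geq_max size_poly /=.
  apply: leq_trans (size_sum _ _ _) _; apply/bigmax_leqP => i _.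
  apply: leq_trans (size_scale_leq _ _) _; rewrite size_polyXn; have := ltn_ord i; lia.
- move=> i; rewrite coefD; apply: srD => //.
    by rewrite coef_poly; case: ifP => _ //; exact: sr0.
  rewrite coef_sum; apply: sr_sum => // j _; rewrite coefZ coefXn.
  apply: srM => //; last by case: (_ == _); [exact: sr1|exact: sr0].
  by apply: srM => //; apply: srM => //; exact: srM.
- rewrite hornerD rE horner_poly [in RHS]horner_coef np big_ord_recr /=.
  by congr (_ + _).
Qed.

(** If [V] contained neither x nor 1/x, maximality would put 1/a in both V[x] and V[1/x]. Of the two
    expressions the longer can always be shortened by means of the other: an infinite descent on the
    sum of the sizes. *)
Lemma avoiding_tot x : V x \/ V x^-1.
Proof.
apply: contrapT => /not_orP[nx nx'].
have x0 : x != 0 by apply: contra_notN nx => /eqP ->; exact: sr0.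
have adjoin z : ~ V z -> exists2 p : {poly K}, (forall i, V p`_i) & a * p.[z] = 1.
  move=> nz; apply: contrapT => nex; apply: nz.
  apply: (Vmax (is_subring_poly hV z)) => [w Vw|[p Vp pE]|].
  - exists w%:P; last by rewrite hornerC.
    by move=> i; rewrite coefC; case: ifP => _ //; exact: sr0.
  - apply: nex; exists p => //; rewrite -pE divff //.
    by apply: contra_notN Va' => /eqP ->; rewrite invr0; exact: sr0.
  - exists 'X; last by rewrite hornerX.
    by move=> i; rewrite coefX; case: (_ == _); [exact: sr1|exact: sr0].
have [p Vp pE] := adjoin _ nx; have [q Vq qE] := adjoin _ nx'.
clear nx nx'; have [N] := ubnP (size p + size q).
elim: N x x0 p q Vp pE Vq qE => // N ih x x0 p q Vp pE Vq qE sN.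
have [qp|pq] := leqP (size q) (size p).
  have [p' [sp' Vp' p'E]] := avoiding_reduce x0 Vp Vq qp qE.
  by apply: (ih x x0 p' q Vp' _ Vq qE); [rewrite p'E|lia].
have xV0 : x^-1 != 0 by rewrite invr_eq0.
have pE' : a * p.[x^-1^-1] = 1 by rewrite invrK.
have [q' [sq' Vq' q'E]] := avoiding_reduce xV0 Vq Vp (ltnW pq) pE'.
by apply: (ih x x0 p q' Vp pE Vq' _); [rewrite q'E|lia].
Qed.

End Chevalley.

(* A subring containing [a] that is maximal among those avoiding [a^-1] is a
   valuation ring. *)
Lemma val_ring_exists (K : fieldType) (D : set K) (a : K) :
  is_subring D -> D a -> ~ D a^-1 ->
  exists V : set K, [/\ is_val_ring V, D `<=` V & ~ V a^-1].
Proof.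
move=> hD Da Da'.
have [V [hV DV Va' Vmax]] := maximal_avoiding_subring hD Da'.
exists V; split=> //; split=> //.
exact: (avoiding_tot hV (DV _ Da) Va' Vmax).
Qed.

(** * Discrete valuation rings *)

Section ValRing.
Variables (K : fieldType) (V : set K).
Hypothesis hV : is_val_ring V.
Let sV := vr_sub hV.

Lemma vr_root x n : (0 < n)%N -> V (x ^+ n) -> V x.
Proof.
move=> n0 Vxn; have [//|Vx'] := vr_tot hV x.
have [->|x0] := eqVneq x 0; first exact: sr0.
have -> : x = x ^+ n * x^-1 ^+ n.-1.
  by rewrite -{1}(prednK n0) exprS -mulrA -exprMn mulfV // expr1n mulr1.
by apply: srM => //; exact: srX.
Qed.

(** The maximal ideal of [V]. Zero is listed apart because its inverse is 0 by convention. *)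
Definition vr_max (x : K) := x = 0 \/ ~ V x^-1.

Lemma vr_maxW x : vr_max x -> V x.
Proof. by move=> [->|nx]; [exact: sr0|have [] := vr_tot hV x]. Qed.

Lemma vr_max1 : ~ vr_max 1.
Proof. by move=> [/eqP|]; [rewrite oner_eq0|rewrite invr1; apply; exact: sr1]. Qed.

Lemma vr_maxN x : vr_max x -> vr_max (- x).
Proof.
move=> [->|nx]; [by left; rewrite oppr0|right].
by rewrite invrN => /(srN sV); rewrite opprK.
Qed.

Lemma vr_maxD x y : vr_max x -> vr_max y -> vr_max (x + y).
Proof.
wlog Vyx : x y / V (y / x).
  move=> wl mx my; have [h|] := vr_tot hV (y / x); first exact: wl.
  by rewrite invf_div addrC => h; exact: wl.
move=> [->|nx] my; first by rewrite add0r.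
have [xy0|xy0] := eqVneq (x + y) 0; first by left.
right => h; apply: nx.
have [x0|x0] := eqVneq x 0; first by rewrite x0 invr0; exact: sr0.
have -> : x^-1 = (1 + y / x) * (x + y)^-1 by field; rewrite xy0 x0.
by apply: srM => //; apply: srD => //; exact: sr1.
Qed.

Lemma vr_max_sum (I : Type) (r : seq I) (P : pred I) (F : I -> K) :
  (forall i, P i -> vr_max (F i)) -> vr_max (\sum_(i <- r | P i) F i).
Proof. by move=> h; apply: (big_ind vr_max) => //; [left|exact: vr_maxD]. Qed.

Lemma vr_maxM x y : V x -> vr_max y -> vr_max (x * y).
Proof.
move=> Vx; have [->|x0] := eqVneq x 0; first by rewrite mul0r; left.
move=> [->|ny]; [by rewrite mulr0; left|right => h; apply: ny].
by have := srM sV Vx h; rewrite invfM mulrA divff // mul1r.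
Qed.

Lemma vr_unit x : V x -> ~ vr_max x -> V x^-1.
Proof. by move=> Vx nm; apply: contrapT => nV; apply: nm; right. Qed.

Lemma vr_largest (s : seq K) : s != [::] -> 0 \notin s ->
  exists2 m, m \in s & forall x, x \in s -> V (x / m).
Proof.
elim: s => // x s ih _; rewrite inE negb_or eq_sym => /andP[x0 s0].
have V1 y : y != 0 -> V (y / y) by move=> ?; rewrite divff //; exact: sr1.
have [sE|/ih] := eqVneq s [::].
  by exists x; rewrite ?mem_head // => y; rewrite sE inE => /eqP ->; exact: V1.
move=> /(_ s0)[m ms mE]; have m0 : m != 0 by apply: contraNneq s0 => <-.
have [xm|] := vr_tot hV (x / m).
  by exists m => [|y]; rewrite inE ?ms ?orbT // => /orP[/eqP ->|/mE].
rewrite invf_div => mx; exists x; rewrite ?mem_head // => y.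
rewrite inE => /orP[/eqP ->|/mE ym]; first exact: V1.
have -> : y / x = (y / m) * (m / x) by field; rewrite x0 m0.
exact: srM.
Qed.

(** The ultrametric principle: if a term of least valuation were alone, dividing by it would write
    -1 as a sum of elements of the maximal ideal. *)
Lemma zero_sum_associates n (F : 'I_n -> K) i0 :
  F i0 != 0 -> \sum_i F i = 0 ->
  exists i j, [/\ i != j, F i != 0, F j != 0, V (F i / F j) & V (F j / F i)].
Proof.
move=> F0 sum0; pose s := [seq F i | i in [pred i | F i != 0]].
have [|| m /mapP[j]] := @vr_largest s.
- apply/eqP => s0; suff : F i0 \in s by rewrite s0.
  by apply/mapP; exists i0; rewrite ?mem_enum.
- by apply/negP => /mapP[i]; rewrite mem_enum inE => /negP h h'; apply: h; rewrite -h'.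
rewrite mem_enum inE => Fj -> mE.
have FV i : V (F i / F j).
  have [->|Fi] := eqVneq (F i) 0; first by rewrite mul0r; exact: sr0.
  by apply: mE; apply/mapP; exists i; rewrite ?mem_enum.
apply: contrapT => nex; apply: vr_max1; rewrite -[1]opprK; apply: vr_maxN.
have -> : -1 = \sum_(i | i != j) F i / F j.
  rewrite -mulr_suml; move/eqP: sum0; rewrite (bigD1 j) //= addrC addr_eq0.
  by move=> /eqP ->; rewrite mulNr divff.
apply: vr_max_sum => i ij.
have [->|Fi] := eqVneq (F i) 0; first by rewrite mul0r; left.
by right; rewrite invf_div => h; apply: nex; exists i, j.
Qed.

(** The Newton polygon argument: among the terms P_i x^i, which sum to zero, two have the same
    valuation. *)
Lemma root_associates (P : {poly K}) x : P != 0 -> root P x -> x != 0 ->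
  exists i j, [/\ (i < j < size P)%N, P`_i != 0, P`_j != 0,
     V (x ^+ (j - i) / (P`_i / P`_j)) & V (P`_i / P`_j / x ^+ (j - i))].
Proof.
move=> P0 /rootP Px x0; have sP : (0 < size P)%N by rewrite lt0n size_poly_eq0.
have [i0 i0E] : exists i0 : 'I_(size P), i0 = (size P).-1 :> nat.
  by have h : ((size P).-1 < size P)%N; [rewrite prednK|exists (Ordinal h)].
rewrite horner_coef in Px.
have [|i [j []]] := @zero_sum_associates _ (fun i : 'I_(size P) => P`_i * x ^+ i) i0 _ Px.
  by rewrite mulf_neq0 ?expf_neq0 // i0E -lead_coefE lead_coef_eq0.
wlog ij : i j / (i < j)%N.
  move=> wl; have [/wl//|ji|ij] := ltngtP i j; last by rewrite -(inj_eq val_inj) /= ij eqxx.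
  by rewrite eq_sym => ? ? ? ? ?; exact: (wl j i).
move=> _ Pi Pj Vij Vji; exists i, j.
have xE : x ^+ j = x ^+ (j - i) * x ^+ i by rewrite -exprD subnK // ltnW.
have Pi0 : P`_i != 0 by apply: contraNneq Pi => ->; rewrite mul0r.
have Pj0 : P`_j != 0 by apply: contraNneq Pj => ->; rewrite mul0r.
have [xi xji] : x ^+ i != 0 /\ x ^+ (j - i) != 0 by rewrite !expf_neq0.
split=> //; first by rewrite ij ltn_ord.
- suff -> : x ^+ (j - i) / (P`_i / P`_j) = P`_j * x ^+ j / (P`_i * x ^+ i) by [].
  by rewrite xE; field; rewrite xi Pi0 Pj0.
- suff -> : P`_i / P`_j / x ^+ (j - i) = P`_i * x ^+ i / (P`_j * x ^+ j) by [].
  by rewrite xE; field; rewrite xi xji Pj0.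
Qed.

Section Discrete.
Variable p : K.
Hypotheses (Vp : V p) (Vp' : ~ V p^-1).

Lemma vr_unif_neq0 : p != 0.
Proof. by apply: contra_notN Vp' => /eqP ->; rewrite invr0; exact: sr0. Qed.
Let p0 := vr_unif_neq0.

Lemma vr_unif_exp (n : int) : V (p ^ n) <-> 0 <= n.
Proof.
split=> [h|]; last by case: n => // n _; exact: srX.
case: n h => // n; rewrite NegzE -exprnN => h; case: Vp'; apply: (@vr_root _ n.+1) => //.
by rewrite exprVn.
Qed.

(** Says v(x) = n v(p) before any valuation exists: the two elements differ by a unit of [V]. *)
Definition power_like (x : K) (n : int) := V (x / p ^ n) /\ V (p ^ n / x).

Lemma power_like_unif : power_like p 1.
Proof. by rewrite /power_like expr1z divff //; split; exact: sr1. Qed.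

Lemma power_like_unit x : V x -> V x^-1 -> power_like x 0.
Proof. by rewrite /power_like expr0z divr1 div1r. Qed.

Lemma power_likeM x y n m : power_like x n -> power_like y m -> power_like (x * y) (n + m).
Proof.
rewrite /power_like expfzDr // => -[x1 x2] [y1 y2].
by rewrite -!mulf_div; split; exact: srM.
Qed.

Lemma power_likeV x n : power_like x n -> power_like x^-1 (- n).
Proof.
by rewrite /power_like -invr_expz !invrK => -[h1 h2]; rewrite ![_^-1 * _]mulrC.
Qed.

Lemma power_likeX x n k : power_like x n -> power_like (x ^+ k) (n *+ k).
Proof.
move=> xn; elim: k => [|k ih]; last by rewrite exprS mulrS; exact: power_likeM.
by rewrite expr0 mulr0n; apply: power_like_unit; rewrite ?invr1; exact: sr1.
Qed.

Lemma power_like_ge0 x n : power_like x n -> x != 0 -> V x <-> 0 <= n.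
Proof.
move=> [h1 h2] x0; have pn : p ^ n != 0 by rewrite expfz_neq0.
rewrite -vr_unif_exp; split=> h.
  by rewrite -[p ^ n](divfK x0); exact: srM.
by rewrite -[x](divfK pn); exact: srM.
Qed.

Lemma power_like_inj x n m : x != 0 -> power_like x n -> power_like x m -> n = m.
Proof.
move=> x0.
suff wl k l : power_like x k -> power_like x l -> l <= k.
  by move=> xn xm; apply/eqP; rewrite eq_le !(wl _ _ xn xm, wl _ _ xm xn).
move=> xk xl; rewrite -subr_ge0 -(power_like_ge0 (x := x / x)); last by rewrite divff ?oner_neq0.
  by rewrite divff //; exact: sr1.
by apply: power_likeM => //; exact: power_likeV.
Qed.

Variable N : nat.
Hypothesis N0 : (0 < N)%N.
Hypothesis hN : forall x, x != 0 -> exists n, power_like (x ^+ N) n.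

Let w x : int := xget 0 [set n | power_like (x ^+ N) n].

Let wP x : x != 0 -> power_like (x ^+ N) (w x).
Proof. by move=> x0; rewrite /w; case: xgetP => // hn; have [n /hn] := hN x0. Qed.

Let wE x n : x != 0 -> power_like (x ^+ N) n -> w x = n.
Proof. by move=> x0 h; apply: (power_like_inj _ (wP x0) h); rewrite expf_neq0. Qed.

Let wM x y : x != 0 -> y != 0 -> w (x * y) = w x + w y.
Proof.
move=> x0 y0; apply: wE; rewrite ?mulf_neq0 // exprMn.
by apply: power_likeM; exact: wP.
Qed.

Let wV x : x != 0 -> w x^-1 = - w x.
Proof.
by move=> x0; apply: wE; rewrite ?invr_eq0 // exprVn; apply: power_likeV; exact: wP.
Qed.

Let w_ge0 x : x != 0 -> V x <-> 0 <= w x.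
Proof.
move=> x0; rewrite -(power_like_ge0 (wP x0)) ?expf_neq0 //.
by split; [exact: srX|exact: vr_root].
Qed.

Let w_unif : w p = N.
Proof. by apply: wE => //; have := power_likeX N power_like_unif; rewrite natz. Qed.

Let wX x n : x != 0 -> w (x ^+ n) = w x *+ n.
Proof.
move=> x0; elim: n => [|n ih]; last by rewrite exprS wM ?expf_neq0 // ih mulrS.
rewrite expr0 mulr0n; have /eqP := wM (oner_neq0 K) (oner_neq0 K).
by rewrite mulr1 -subr_eq0 opprD addNKr oppr_eq0 => /eqP.
Qed.

(** The common exponent [N] makes the map [w], sending x to the n with x^N associated to p^n, a
    homomorphism to the integers. It is nonzero since w(p) = N, and dividing by the generator [d] of
    its image normalizes it. *)
Lemma val_ring_discrete :
  exists v : K -> \bar int, discrete_valuation v /\ forall x, V x <-> (0 <= v x)%E.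
Proof.
pose pos (d : nat) := `[< (0 < d)%N /\ exists2 x, x != 0 & w x = d >].
have [|d /asboolP[d0 [u u0 uE]] dmin] := @ex_minnP pos.
  by exists N; apply/asboolP; split=> //; exists p.
(* Euclidean division by the least positive value [d] leaves a remainder that is again a value of
   [w], hence zero. *)
have wd x : x != 0 -> exists k : int, w x = k * d%:Z.
  move=> x0.
  wlog wx : x x0 / 0 <= w x.
    move=> wl; have [|] := leP 0 (w x); first exact: wl.
    move=> /ltW wx; have [||k kE] := wl x^-1; rewrite ?invr_eq0 ?wV ?oppr_ge0 //.
    by exists (- k); rewrite mulNr -kE wV // opprK.
  case E : (w x) wx => [a|//] _; exists (a %/ d)%N%:Z.
  suff a0 : (a %% d = 0)%N by rewrite {1}(divn_eq a d) a0 addn0 PoszM.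
  apply/eqP; rewrite -leqn0 leqNgt; apply/negP => a1.
  have := ltn_pmod a d0; rewrite ltnNge => /negP; apply; apply: dmin; apply/asboolP.
  split=> //; exists (x / u ^+ (a %/ d)); first by rewrite mulf_neq0 ?invr_eq0 ?expf_neq0.
  rewrite wM ?invr_eq0 ?expf_neq0 // wV ?expf_neq0 // wX // E uE.
  by rewrite {1}(divn_eq a d) -mulr_natl natz; lia.
pose k x : int := xget 0 [set k : int | w x = k * d%:Z].
have kE x : x != 0 -> w x = k x * d%:Z.
  by move=> x0; rewrite /k; case: xgetP => [l _ -> //|hn]; have [l hl] := wd _ x0; case: (hn l).
have dN0 : d%:Z != 0 by lia.
pose v x : \bar int := if x == 0 then +oo%E else (k x)%:E.
exists v; have vV x : V x <-> (0 <= v x)%E.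
  rewrite /v; have [->|x0] := eqVneq x 0; first by split=> // _; exact: sr0.
  by rewrite lee_fin w_ge0 // kE // pmulr_lge0 //; lia.
have kM x y : x != 0 -> y != 0 -> k (x * y) = k x + k y.
  by move=> x0 y0; apply: (mulIf dN0); rewrite mulrDl -!kE ?mulf_neq0 // wM.
split=> //; split=> [x|x|x y|x y|].
- by rewrite /v; case: eqP.
- by rewrite /v; case: eqP.
- rewrite /v mulf_eq0; have [->|x0] := eqVneq x 0; first by case: eqP.
  have [->|y0] := eqVneq y 0; first by [].
  by rewrite /= kM.
- wlog Vyx : x y / V (y / x).
    move=> wl; have [|] := vr_tot hV (y / x); first exact: wl.
    by rewrite invf_div minC addrC; exact: wl.
  rewrite /v; have [->|x0] := eqVneq x 0; first by rewrite add0r ge_min lexx orbT.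
  have [//|xy0] := eqVneq (x + y) 0; first by rewrite leey.
  rewrite ge_min lee_fin; apply/orP; left.
  have z0 : (x + y) / x != 0 by rewrite mulf_eq0 invr_eq0 negb_or xy0.
  have : 0 <= k ((x + y) / x).
    have := proj1 (vV ((x + y) / x)); rewrite /v (negbTE z0) lee_fin; apply.
    by rewrite mulrDl divff //; apply: srD => //; exact: sr1.
  by rewrite -[X in _ -> _ <= k X](divfK x0) [k (_ / x * x)]kM // => h; rewrite lerDr.
- exists u; rewrite /v (negbTE u0); congr (_%:E).
  by apply: (mulIf dN0); rewrite -kE // mul1r.
Qed.

End Discrete.
End ValRing.

Section MoreValRing.
Variables (K : fieldType) (V : set K).
Hypothesis hV : is_val_ring V.
Let sV := vr_sub hV.

(** If x were outside [V], then 1/x would be in the maximal ideal, and dividing the equation by x^n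
    would put -1 there too. *)
Lemma vr_integral (P : {poly K}) x :
  P \is monic -> (forall i, V P`_i) -> root P x -> V x.
Proof.
move=> monP VP /rootP Px; apply: contrapT => nx.
have x0 : x != 0 by apply: contra_notN nx => /eqP ->; exact: sr0.
have mx : vr_max V x^-1 by right; rewrite invrK.
apply: (vr_max1 hV); rewrite -[1]opprK; apply: (vr_maxN hV).
have sP : (0 < size P)%N by rewrite size_poly_gt0 monic_neq0.
set n := (size P).-1; have sPn : size P = n.+1 by rewrite prednK.
have -> : -1 = \sum_(i < n) P`_i * x^-1 ^+ (n - i).
  apply: (mulIf (expf_neq0 n x0)); rewrite mulN1r mulr_suml.
  have Pn : P`_n = 1 by have /monicP := monP; rewrite lead_coefE.
  move: Px; rewrite horner_coef sPn big_ord_recr /= Pn mul1r => /eqP.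
  rewrite addr_eq0 => /eqP <-; apply: eq_bigr => i _.
  have {1}-> : x ^+ n = x ^+ (n - i) * x ^+ i by rewrite -exprD subnK // ltnW.
  by rewrite mulrA -[_ * _ * x ^+ (n - i)]mulrA -exprMn mulVf // expr1n mulr1.
apply: vr_max_sum => // i _; apply: vr_maxM => //.
rewrite -(prednK (n := n - i)) ?subn_gt0 ?ltn_ord // exprSr.
by apply: vr_maxM => //; apply: srX => //; exact: vr_maxW.
Qed.
End MoreValRing.

(** * Valuation rings of finite field extensions *)

Lemma ext_root (F0 : fieldType) (L : fieldExtType F0) (x : L) :
  exists P : {poly F0}, [/\ P != 0, (size P <= (\dim {:L}).+1)%N
    & root (map_poly (in_alg L) P) x].
Proof.
have /polyOver1P[P PE] := minPolyOver 1%AS x.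
exists P; have := monic_minPoly 1%AS x; have := root_minPoly 1%AS x.
have := size_minPoly 1%AS x; rewrite PE => sP rP mP; split=> //.
  by apply: contraTneq mP => ->; rewrite rmorph0 monicE lead_coef0 eq_sym oner_eq0.
move: sP; rewrite size_map_poly => ->; rewrite ltnS.
by rewrite -[adjoin_degree _ _]muln1 -[X in (_ * X)%N](dimv1 L) -dim_Fadjoin dimvS ?subvf.
Qed.

Section FieldExtValuation.
Variables (F0 : fieldType) (L : fieldExtType F0) (V : set L).
Hypothesis hV : is_val_ring V.
Let sV := vr_sub hV.
Let r := \dim {:L}.

(** Every element is integral over the base field. The use is contrapositive: a proper valuation
    ring is nontrivial on the base. *)
Lemma val_ring_full : (forall c : F0, V c%:A) -> forall x, V x.
Proof.
move=> Vc x; have [P [P0 _ rP]] := ext_root x.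
apply: (vr_integral hV (P := map_poly (in_alg L) ((lead_coef P)^-1 *: P))).
- by rewrite map_monic monicE lead_coefZ mulVf ?lead_coef_eq0.
- by move=> i; rewrite coef_map /=; exact: Vc.
- rewrite /root map_polyZ /= hornerZ; have /rootP -> := rP; by rewrite mulr0.
Qed.

Variable p : L.
Hypotheses (Vp : V p) (Vp' : ~ V p^-1).
Hypothesis hp : forall c : F0, c != 0 -> exists n, power_like V p c%:A n.

(** In the Newton polygon of an equation over [F0], the exponent j - i is at most the degree of the
    equation, hence at most [L : F0]. *)
Lemma ext_power_like x : x != 0 ->
  exists m n, [/\ (0 < m <= r)%N & power_like V p (x ^+ m) n].
Proof.
move=> x0; have [P [P0 sP rP]] := ext_root x.
have [|i [j [ij]]] := root_associates hV _ rP x0.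
  by rewrite map_poly_eq0.
rewrite !coef_map /= -!in_algE !fmorph_eq0 => Pi Pj h1 h2.
have [|n hn] := hp (c := P`_i / P`_j); first by rewrite mulf_neq0 ?invr_eq0.
exists (j - i)%N, n; split; first by move: ij; rewrite size_map_poly; lia.
have [] := hn; rewrite -in_algE fmorph_div /=; set c := _ / _%:A in h1 h2 * => l1 l2.
have c0 : c != 0 by rewrite mulf_eq0 invr_eq0 -!in_algE !fmorph_eq0 negb_or Pi.
have pn0 : p ^ n != 0 by rewrite expfz_neq0 // (vr_unif_neq0 hV).
split.
  have -> : x ^+ (j - i) / p ^ n = x ^+ (j - i) / c * (c / p ^ n) by field; rewrite pn0.
  exact: srM.
have -> : p ^ n / x ^+ (j - i) = p ^ n / c * (c / x ^+ (j - i)).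
  by field; rewrite c0 expf_neq0.
exact: srM.
Qed.

Lemma ext_discrete :
  exists v : L -> \bar int, discrete_valuation v /\ forall x, V x <-> (0 <= v x)%E.
Proof.
(* The factorial of [L : F0] is a multiple of all the exponents given by [ext_power_like]. *)
apply: (@val_ring_discrete _ _ hV p Vp Vp' r`!); first exact: fact_gt0.
move=> x x0; have [m [n [/andP[m0 mr] xm]]] := ext_power_like x0.
have /dvdnP[q ->] : (m %| r`!)%N by apply: dvdn_fact; rewrite m0.
by exists (n *+ q); rewrite mulnC exprM; apply: power_likeX.
Qed.
End FieldExtValuation.

(** * Places of function fields *)

Section DiscreteValuation.
Variables (K : fieldType) (v : K -> \bar int).
Hypothesis hv : discrete_valuation v.

(** The order of 0 gets the value 0 instead of infinity. The criterion [ord_ge0] survives this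
    convention; [ordM] and [ordD] need nonzero arguments. *)
Definition ord_of (x : K) : int := if v x is n%:E then n else 0.
Local Notation o := ord_of.

Lemma ord_ofE x : x != 0 -> v x = (o x)%:E.
Proof.
move=> x0; rewrite /o; case E : (v x) => //.
- by move/(dv_eqy hv) : E x0 => ->; rewrite eqxx.
- by move: E => /(dv_neqNy hv).
Qed.

Lemma ordM x y : x != 0 -> y != 0 -> o (x * y) = o x + o y.
Proof.
move=> x0 y0; have := dv_mul hv x y.
by rewrite !ord_ofE ?mulf_neq0 // => -[].
Qed.

Lemma ord1 : o 1 = 0.
Proof. by rewrite /o (dv1 hv). Qed.

Lemma ordV x : x != 0 -> o x^-1 = - o x.
Proof.
move=> x0; have := ordM x0 (y := x^-1); rewrite invr_eq0 divff // ord1 => /(_ x0).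
by move/esym/eqP; rewrite addrC addr_eq0 => /eqP.
Qed.

Lemma ordX x n : x != 0 -> o (x ^+ n) = o x *+ n.
Proof.
move=> x0; elim: n => [|n ih]; first by rewrite expr0 ord1 mulr0n.
by rewrite exprS ordM ?expf_neq0 // ih mulrS.
Qed.

Lemma ord_ge0 x : (0 <= v x)%E <-> 0 <= o x.
Proof.
have [->|x0] := eqVneq x 0; last by rewrite ord_ofE // lee_fin.
by have -> : v 0 = +oo%E by [apply/(dv_eqy hv)]; rewrite /o (proj2 (dv_eqy hv 0) erefl).
Qed.

Lemma ordD x y : x != 0 -> y != 0 -> x + y != 0 -> Num.min (o x) (o y) <= o (x + y).
Proof.
move=> x0 y0 xy0; have := dv_add hv x y; rewrite !ord_ofE //.
by rewrite -EFin_min lee_fin.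
Qed.

Definition dv_ring : set K := [set x | (0 <= v x)%E].

Lemma dv_ring_val_ring : is_val_ring dv_ring.
Proof.
split; first split.
- by rewrite /dv_ring /= (dv1 hv).
- move=> x y /= hx hy; apply: (le_trans _ (dv_add hv x (- y))); rewrite le_min hx /=.
  by rewrite -mulN1r (dv_mul hv) (dvN1 hv) add0e.
- by move=> x y /= hx hy; rewrite /dv_ring /= (dv_mul hv) adde_ge0.
- move=> x; rewrite /dv_ring /= !ord_ge0.
  have [->|x0] := eqVneq x 0; first by left; rewrite /o (proj2 (dv_eqy hv 0) erefl).
  by rewrite ordV // oppr_ge0; apply/orP; exact: le_total.
Qed.

Lemma dv_maxP x : x != 0 -> vr_max dv_ring x <-> 0 < o x.
Proof.
move=> x0; split=> [[/eqP|]|h]; first by rewrite (negbTE x0).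
  by rewrite /dv_ring /= ord_ge0 ordV // oppr_ge0 => /negP; rewrite -ltNge.
by right; rewrite /dv_ring /= ord_ge0 ordV // oppr_ge0; apply/negP; rewrite -ltNge.
Qed.

Lemma dv_ring_proper : exists x, ~ dv_ring x.
Proof.
have [u u1] := dv_norm hv; have u0 : u != 0.
  by apply/eqP => /(dv_eqy hv); rewrite u1.
exists u^-1; rewrite /dv_ring /= ord_ge0 ordV // /o u1 oppr_ge0.
by [].
Qed.

Lemma dv_uniformizer : exists2 u, u != 0 & o u = 1.
Proof.
have [u u1] := dv_norm hv; exists u; last by rewrite /o u1.
by apply/eqP => /(dv_eqy hv); rewrite u1.
Qed.

Lemma ord_power_like (p x : K) n : p != 0 -> x != 0 -> power_like dv_ring p x n ->
  o x = n * o p.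
Proof.
move=> p0 x0; have oz m : o (p ^ m) = m * o p.
  case: m => m; first by rewrite ordX // -mulr_natl natz.
  by rewrite NegzE -invr_expz ordV ?expf_neq0 // ordX // mulNr -mulr_natl natz.
have pn := expfz_neq0 n p0.
move=> []; rewrite /dv_ring /= !ord_ge0 !ordM ?invr_eq0 // !ordV // oz.
by move=> ? ?; apply/eqP; rewrite eq_le; lia.
Qed.

End DiscreteValuation.

Section FunctionField.
Variable F : function_field.
Let k := ff_const F.
Let r := \dim {:F}.

Lemma ff_embed_zmod : zmod_morphism (@ff_embed F).
Proof. by move=> x y; rewrite /ff_embed !rmorphB /= scalerBl. Qed.
Lemma ff_embed_monoid : monoid_morphism (@ff_embed F).
Proof.
split=> [|x y]; rewrite /ff_embed -!in_algE; first by rewrite !rmorph1.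
by rewrite !rmorphM.
Qed.
HB.instance Definition _ := GRing.isZmodMorphism.Build k F (@ff_embed F) ff_embed_zmod.
HB.instance Definition _ := GRing.isMonoidMorphism.Build k F (@ff_embed F) ff_embed_monoid.

Definition ff_var : F := (tofrac 'X)%:A.
Local Notation tt := ff_var.
Local Notation emb := (@ff_embed F).

Lemma ff_poly (P : {poly k}) : (tofrac P)%:A = (map_poly emb P).[tt].
Proof.
rewrite horner_coef size_map_poly -{1}[P]coefK poly_def -!in_algE !rmorph_sum.
apply: eq_bigr => i _; rewrite coef_map /= -mul_polyC !rmorphM /=.
by rewrite -in_algE rmorphM !rmorphXn.
Qed.

Lemma ff_var_transc (c : k) : tt - emb c != 0.
Proof.
rewrite /tt /ff_embed -!in_algE -rmorphB fmorph_eq0 -rmorphB tofrac_eq0.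
by rewrite polyXsubC_eq0.
Qed.

(** [P] splits into linear factors over the constants, which are algebraically closed. *)
Lemma ff_algebraic (P : {poly k}) (x : F) :
  P != 0 -> root (map_poly emb P) x -> exists c, x = emb c.
Proof.
move=> P0; have [s ->] := closed_field_poly_normal P.
rewrite map_polyZ rmorph_prod rootE hornerZ mulf_eq0 fmorph_eq0 lead_coef_eq0 (negbTE P0) /=.
rewrite horner_prod prodf_seq_eq0 => /hasP[c _] /=.
by rewrite rmorphB /= map_polyX map_polyC !hornerE subr_eq0 => /eqP ->; exists c.
Qed.

Section ConstRing.
Variable V : set F.
Hypotheses (hV : is_val_ring V) (Vk : forall c, V (emb c)).
Let sV := vr_sub hV.

Lemma ff_const_unit c m : c != 0 -> vr_max V m -> V (emb c + m) /\ V (emb c + m)^-1.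
Proof.
move=> c0 mm; have Vc := srD sV (Vk c) (vr_maxW hV mm); split=> //.
apply: (vr_unit Vc) => cm.
have : vr_max V (emb c) by rewrite -[emb c](addrK m); apply: vr_maxD => //; exact: vr_maxN.
by move=> [/eqP|]; [rewrite fmorph_eq0 (negbTE c0)|rewrite -fmorphV; apply; exact: Vk].
Qed.

Lemma ff_power_like (p : F) : V p -> ~ V p^-1 ->
  (forall c, exists n, power_like V p (tt - emb c) n) ->
  forall f : {fraction {poly k}}, f != 0 -> exists n, power_like V p f%:A n.
Proof.
move=> Vp Vp' hc.
have hP (P : {poly k}) : P != 0 -> exists n, power_like V p (tofrac P)%:A n.
  move=> P0; have [s PE] := closed_field_poly_normal P.
  rewrite ff_poly PE map_polyZ rmorph_prod hornerZ horner_prod.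
  have [n hn] : exists n, power_like V p (\prod_(i <- s) (map_poly emb ('X - i%:P)).[tt]) n.
    elim: s {PE} => [|c s [n ih]].
      by exists 0; rewrite big_nil; apply: power_like_unit; rewrite ?invr1; exact: sr1.
    have [m hm] := hc c; exists (m + n); rewrite big_cons; apply: (power_likeM hV) => //.
    by rewrite rmorphB /= map_polyX map_polyC !hornerE.
  exists (0 + n); apply: (power_likeM hV) => //.
  by apply: power_like_unit; rewrite -?fmorphV; exact: Vk.
move=> f; have [n [d [d0 ->]]] := fractionP f => f0.
have n0 : n != 0 by apply: contraNneq f0 => ->; rewrite rmorph0 mul0r.
have [[a ha] [b hb]] := (hP n n0, hP d d0).
exists (a - b); rewrite -in_algE fmorph_div.
by apply: (power_likeM hV) => //; exact: power_likeV.
Qed.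

(** The places of k(t) are infinity, with parameter 1/t, and the constants c, with parameter t - c.
    If t is in [V] and all t - c are units, then [V] contains k(t), hence all of [F]. Because of
    ramification, [p] need not be a uniformizer of [F]. *)
Lemma ff_local_parameter : (exists x, ~ V x) ->
  exists p : F, [/\ V p, ~ V p^-1,
    p = tt^-1 \/ exists c, p = tt - emb c
  & forall f : {fraction {poly k}}, f != 0 -> exists n, power_like V p f%:A n].
Proof.
move=> [x0 nx0].
have t0 : tt != 0 by have := ff_var_transc 0; rewrite rmorph0 subr0.
have [Vt|nVt] := pselect (V tt); last first.
  have Vt' : V tt^-1 by have [] := vr_tot hV tt.
  have mt : vr_max V tt^-1 by right; rewrite invrK.
  have Vp' : ~ V tt^-1^-1 by rewrite invrK.
  exists tt^-1; split=> //; first by left.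
  apply: ff_power_like => // c; exists (- 1 + 0).
  have -> : tt - emb c = tt^-1^-1 * (emb 1 + - emb c * tt^-1).
    by rewrite rmorph1 invrK mulrDr mulr1 mulrCA mulfV // mulr1.
  apply: (power_likeM hV Vp').
    by apply: power_likeV; exact: power_like_unif.
  have mct : vr_max V (- emb c * tt^-1) by apply: (vr_maxM hV) => //; apply: srN.
  have [] := ff_const_unit (oner_neq0 k) mct.
  exact: power_like_unit.
have [[c mc]|nc] := pselect (exists c, vr_max V (tt - emb c)).
  exists (tt - emb c).
  have Vp := vr_maxW hV mc.
  have Vp' : ~ V (tt - emb c)^-1.
    by case: mc => // /eqP; rewrite (negbTE (ff_var_transc c)).
  split=> //; first by right; exists c.
  apply: ff_power_like => // c'; have [->|cc'] := eqVneq c' c.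
    by exists 1; exact: power_like_unif.
  exists 0; have -> : tt - emb c' = emb (c - c') + (tt - emb c).
    by rewrite rmorphB [RHS]addrC addrA subrK.
  have cc0 : c - c' != 0 by rewrite subr_eq0 eq_sym.
  have [] := ff_const_unit cc0 mc.
  exact: power_like_unit.
exfalso; apply: nx0; apply: val_ring_full => // f.
have Vc c : V (tt - emb c) by apply: srB.
have Vc' c : V (tt - emb c)^-1.
  by apply: vr_unit => // m; apply: nc; exists c.
have [n [d [d0 ->]]] := fractionP f; rewrite -in_algE fmorph_div /=.
have hP (P : {poly k}) : V (tofrac P)%:A.
  by rewrite ff_poly; apply: sr_horner => // i; rewrite coef_map; exact: Vk.
apply: srM => //; have [s dE] := closed_field_poly_normal d.
rewrite ff_poly dE map_polyZ rmorph_prod hornerZ horner_prod invfM -fmorphV.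
apply: srM => //; first exact: Vk.
elim: s {dE} => [|c s ih].
  by rewrite big_nil invr1; exact: sr1.
rewrite big_cons invfM; apply: srM => //.
by rewrite rmorphB /= map_polyX map_polyC !hornerE; exact: Vc'.
Qed.

End ConstRing.

(** A valuation ring containing k[1/x] but not x is wanted. It exists unless x lies in k[1/x], which
    would make 1/x algebraic over k, hence constant. *)
Lemma ff_pole_exists (x : F) : (forall c, x <> emb c) ->
  exists2 v, ff_places v & (v x < 0)%E.
Proof.
move=> nx; have x0 : x != 0 by apply/eqP => x0; apply: (nx 0); rewrite rmorph0.
pose Vk := [set z : F | exists c, z = emb c].
have sVk : is_subring Vk.
  split=> [|_ _ [c ->] [d ->]|_ _ [c ->] [d ->]].
  - by exists 1; rewrite rmorph1.
  - by exists (c - d); rewrite rmorphB.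
  - by exists (c * d); rewrite rmorphM.
have [||V [hV DV Vx']] := val_ring_exists (is_subring_poly sVk x^-1) (a := x^-1).
- exists 'X; last by rewrite hornerX.
  by move=> i; rewrite coefX; exists (i == 1%N)%:R; rewrite rmorph_nat.
- move=> [P hP]; rewrite invrK => xE.
  have [Q QE] : exists Q, P = map_poly emb Q.
    exists (\poly_(i < size P) xget 0 [set c | P`_i = emb c]).
    apply/polyP => i; rewrite coef_map coef_poly; case: ltnP => iP /=; last first.
      by rewrite rmorph0 nth_default.
    by case: xgetP => [c _ ->//|hn]; have [c hc] := hP i; case: (hn c).
  (* The relation x = Q(1/x) makes 1/x a root of XQ - 1, which is nonzero since its value at 0 is
     -1. *)
  have [||c] := @ff_algebraic ('X * Q - 1) x^-1.
  + apply/eqP => /(congr1 (fun P : {poly k} => P.[0])); rewrite !hornerE => /eqP.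
    by rewrite oppr_eq0 oner_eq0.
  + by rewrite rmorphB rmorphM /= map_polyX rmorph1 -QE rootE !hornerE -xE mulVf // subrr.
  + move=> /(congr1 GRing.inv); rewrite invrK -fmorphV; exact: nx.
rewrite invrK in Vx'.
have Vc c : V (emb c).
  apply: DV; exists (emb c)%:P; last by rewrite hornerC.
  by move=> i; rewrite coefC; exists (if i == 0%N then c else 0); case: ifP; rewrite ?rmorph0.
have [|p [Vp Vp' _ hp]] := ff_local_parameter hV Vc; first by exists x.
have [v [hv vV]] := ext_discrete hV Vp Vp' hp.
exists v; last by rewrite ltNge; apply/negP => /vV.
split=> // c c0; have ec0 : emb c != 0 by rewrite fmorph_eq0.
have /vV/(ord_ge0 hv) h1 := Vc c; have /vV/(ord_ge0 hv) := Vc c^-1.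
rewrite fmorphV ordV // oppr_ge0 ord_ofE // => h2; congr (_%:E).
by apply/eqP; rewrite eq_le h1 h2.
Qed.

Section Place.
Variable v : F -> \bar int.
Hypothesis pv : ff_places v.
Let hv := pv.1.
Local Notation o := (ord_of v).

Lemma place_const c : dv_ring v (emb c).
Proof.
have [->|c0] := eqVneq c 0; last by rewrite /dv_ring /= pv.2.
by rewrite rmorph0; exact: sr0 (vr_sub (dv_ring_val_ring hv)).
Qed.

Lemma place_ord_const c : o (emb c) = 0.
Proof.
have [->|c0] := eqVneq c 0; first by rewrite rmorph0 /ord_of (proj2 (dv_eqy hv 0) erefl).
by rewrite /ord_of pv.2.
Qed.

(** The point of the projective line below the place. *)
Lemma place_center :
  o tt < 0 \/ exists c, 0 < o (tt - emb c).
Proof.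
have hV := dv_ring_val_ring hv.
have [p [Vp Vp' [pE|[c pE]] _]] := ff_local_parameter hV place_const (dv_ring_proper hv).
  left; rewrite pE invrK in Vp'; move: Vp'; rewrite /dv_ring /= (ord_ge0 hv) => /negP.
  by rewrite -ltNge.
right; exists c; rewrite pE in Vp'; apply/(dv_maxP hv (ff_var_transc c)).
by right.
Qed.

(** The ramification index is at most the degree. A uniformizer u has u^m associated to p^n for some
    m at most [r], so m = n o(p) and o(p) is at most [r]; comparing centers shows p = t - c. *)
Lemma place_ramification (c : k) : 0 < o (tt - emb c) -> o (tt - emb c) <= r%:Z.
Proof.
move=> oc; have hV := dv_ring_val_ring hv.
have [p [Vp Vp' pE hp]] := ff_local_parameter hV place_const (dv_ring_proper hv).
have p0 := vr_unif_neq0 hV Vp'.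
have op : 0 < o p by apply/(dv_maxP hv p0); right.
have [u u0 u1] := dv_uniformizer hv.
have [m [n [/andP[m0 mr] um]]] := ext_power_like hV Vp' hp u0.
have := ord_power_like hv p0 (expf_neq0 m u0) um.
rewrite ordX // u1 natz => mE.
have n0 : 0 < n by rewrite -(pmulr_lgt0 n op) -mE ltz_nat.
have : o p <= r%:Z.
  by apply: (@le_trans _ _ (n * o p)); [rewrite ler_peMl // ltW|rewrite -mE lez_nat].
have [p1|[c' p1]] := pE.
  have t0 : tt != 0 by have := ff_var_transc 0; rewrite rmorph0 subr0.
  rewrite p1 ordV // in op; have c0 : emb c != 0 \/ emb c = 0 by case: eqVneq; auto.
  case: c0 => c0; last by rewrite c0 subr0 in oc; lia.
  have := ordD hv (x := tt - emb c) (y := emb c) (ff_var_transc c) c0.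
  by rewrite subrK place_ord_const => /(_ t0); rewrite ge_min; lia.
have [->|cc'] := eqVneq c c'; first by rewrite p1.
have e0 : emb (c - c') != 0 by rewrite fmorph_eq0 subr_eq0.
have tc0 : - (tt - emb c) != 0 by rewrite oppr_eq0 ff_var_transc.
have oN : o (- (tt - emb c)) = o (tt - emb c).
  rewrite -mulN1r ordM ?oppr_eq0 ?oner_eq0 ?ff_var_transc //.
  by rewrite /ord_of (dvN1 hv) add0r.
have eE : emb (c - c') = - (tt - emb c) + (tt - emb c') by rewrite rmorphB opprB addrA subrK.
have := ordD hv tc0 (ff_var_transc c'); rewrite -eE place_ord_const oN -p1 => /(_ e0).
by rewrite ge_min; lia.
Qed.

End Place.
End FunctionField.

(** * Heights *)

Lemma bounded_set_enum (T : eqType) (P : T -> Prop) (H : nat) :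
  (forall s : seq T, uniq s -> (forall x, x \in s -> P x) -> (size s <= H)%N) ->
  exists s : seq T, (size s <= H)%N /\ forall x, P x <-> x \in s.
Proof.
move=> bnd.
pose Q m := `[< exists s : seq T, [/\ uniq s, forall x, x \in s -> P x & size s = m] >].
have [|m /asboolP[s [us sP <-]]|m /asboolP[s [us sP sm]] mmax] := @ex_maxnP Q H.
- by exists 0%N; apply/asboolP; exists [::].
- exact: bnd.
exists s; split=> [|x]; first exact: bnd.
split=> [Px|]; last exact: sP.
apply: contraT => xs; have := mmax m.+1; rewrite ltnn => -> //.
apply/asboolP; exists (x :: s); split=> /=; rewrite ?xs ?sm //.
by move=> y; rewrite inE => /orP[/eqP ->|/sP].
Qed.

Lemma mulrn_int (a : int) n : a *+ n = a * n%:Z.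
Proof. by rewrite -mulr_natr natz. Qed.

Section Heights.
Variables (R : realType) (F : function_field).
Let k := ff_const F.
Let r := \dim {:F}.
Local Notation emb := (@ff_embed F).
Local Notation tt := (@ff_var F).

Definition lin (s : seq k) : F := \prod_(c <- s) (tt - emb c).

Lemma lin_neq0 s : lin s != 0.
Proof. by rewrite prodf_seq_neq0; apply/allP => c _ /=; exact: ff_var_transc. Qed.

Section AtPlace.
Variable v : F -> \bar int.
Hypothesis pv : ff_places v.
Let hv := pv.1.
Let hV := dv_ring_val_ring hv.
Let sV := vr_sub hV.
Local Notation o := (ord_of v).

Lemma ord_lin s : o (lin s) = \sum_(c <- s) o (tt - emb c).
Proof.
rewrite /lin; elim: s => [|c s ih]; first by rewrite !big_nil ord1.
by rewrite !big_cons ordM ?ih ?ff_var_transc ?lin_neq0.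
Qed.

Section Finite.
Variable c : k.
Hypothesis oc : 0 < o (tt - emb c).

Lemma ord_center c' : c' != c -> o (tt - emb c') = 0.
Proof.
move=> cc'; have mc : vr_max (dv_ring v) (tt - emb c).
  by apply/(dv_maxP hv) => //; exact: ff_var_transc.
have c0 : c - c' != 0 by rewrite subr_eq0 eq_sym.
have [] := ff_const_unit hV (place_const pv) c0 mc.
have -> : emb (c - c') + (tt - emb c) = tt - emb c'.
  by rewrite rmorphB [LHS]addrC addrA subrK.
rewrite /dv_ring /= !(ord_ge0 hv) ordV ?ff_var_transc // oppr_ge0 => h1 h2.
by apply/eqP; rewrite eq_le h1 h2.
Qed.

Lemma ord_lin_center s : o (lin s) = o (tt - emb c) *+ count_mem c s.
Proof.
rewrite ord_lin; elim: s => [|c' s ih]; rewrite ?big_nil // big_cons ih /=.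
by have [->|cc'] := eqVneq c' c; rewrite ?mulrS //= ord_center // !add0r.
Qed.

Lemma lin_center_ring s : dv_ring v (lin s).
Proof.
by apply/(ord_ge0 hv); rewrite ord_lin_center mulrn_wge0 // ltW.
Qed.
End Finite.

(** At infinity 1 - c/t is a unit, so t - c has the order of t. *)
Lemma ord_lin_infty s : o tt < 0 -> o (lin s) = o tt *+ size s.
Proof.
move=> ot; rewrite ord_lin; elim: s => [|c s ih]; rewrite ?big_nil // big_cons ih mulrS.
congr (_ + _); have t0 : tt != 0 by have := ff_var_transc (0 : k); rewrite rmorph0 subr0.
have c1 : o (1 - emb c / tt) = 0.
  have mt : vr_max (dv_ring v) tt^-1.
    by apply/(dv_maxP hv); rewrite ?invr_eq0 ?ordV // oppr_gt0.
  have mct : vr_max (dv_ring v) (- emb c * tt^-1).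
    by apply: (vr_maxM hV) => //; apply: srN; [exact: sV|exact: place_const].
  have [] := ff_const_unit hV (place_const pv) (oner_neq0 k) mct.
  rewrite rmorph1 mulNr; set z := 1 - _; rewrite /dv_ring /= !(ord_ge0 hv).
  have [->|z0] := eqVneq z 0; first by rewrite /ord_of (proj2 (dv_eqy hv 0) erefl).
  by rewrite ordV // oppr_ge0 => h1 h2; apply/eqP; rewrite eq_le h1 h2.
have tE : tt - emb c = tt * (1 - emb c / tt) by rewrite mulrBr mulr1 mulrCA divff // mulr1.
have z0 : 1 - emb c / tt != 0.
  by apply: contraTneq (ff_var_transc c) => z0; rewrite tE z0 mulr0 eqxx.
by rewrite tE ordM // c1 addr0.
Qed.

End AtPlace.

(* If [f] does not vanish, [(lin qs * f) ^+ r / lin us] has no poles but a zero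
   at infinity: the exponent [r] compensates for the ramification over [us]. *)
Lemma vanishing (H : nat) (f : F) (qs us : seq k) :
  uniq us -> (r * (size qs + H) < size us)%N ->
  (forall v, ff_places v -> - H%:Z <= ord_of v f) ->
  (forall v c, ff_places v -> 0 < ord_of v (tt - emb c) -> dv_ring v (lin qs * f)) ->
  (forall v c, ff_places v -> c \in us -> 0 < ord_of v (tt - emb c) -> vr_max (dv_ring v) f) ->
  f = 0.
Proof.
move=> Uus Nus fH fq fu; apply/eqP; apply: contraT => f0.
have q0 : lin qs * f != 0 by rewrite mulf_neq0 ?lin_neq0.
pose g := (lin qs * f) ^+ r / lin us.
have gE v : ff_places v ->
    ord_of v g = (ord_of v (lin qs) + ord_of v f) *+ r - ord_of v (lin us).
  move=> [hv _]; rewrite ordM ?invr_eq0 ?expf_neq0 ?lin_neq0 //.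
  by rewrite ordV ?lin_neq0 // ordX // ordM ?lin_neq0.
(* With a = o(t) < 0 and b = o(f) at least -H, the order of [g] is r(a|qs| + b) - a|us|, positive
   since |us| > r(|qs| + H). *)
have ginf v : ff_places v -> ord_of v tt < 0 -> 0 < ord_of v g.
  move=> pv ot; rewrite gE // !(ord_lin_infty pv) //.
  have := fH v pv; move: (ord_of v tt) (ord_of v f) ot => a b a0 bH.
  rewrite !mulrn_int.
  have h1 : r%:Z * (- H%:Z) <= r%:Z * b by rewrite ler_wpM2l.
  have h2 : a * (size us)%:Z < a * (r%:Z * ((size qs)%:Z + H%:Z)).
    by rewrite ltr_nM2l // -PoszD -PoszM ltz_nat.
  have h3 : a * (r%:Z * H%:Z) <= - (r%:Z * H%:Z).
    by rewrite -mulN1r ler_wpM2r ?mulr_ge0 //; lia.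
  by move: h1 h2 h3; rewrite !mulrDr !mulrDl !mulrN; lia.
have gV v : ff_places v -> 0 <= ord_of v g.
  move=> pv; have [/(ginf v pv)/ltW //|[c oc]] := place_center pv.
  have hv := pv.1; rewrite gE // subr_ge0 [ord_of v (lin us)](ord_lin_center pv oc).
  have := fq v c pv oc; rewrite /dv_ring /= (ord_ge0 hv) ordM ?lin_neq0 // => h1.
  (* Over a point of [us] the numerator of [g] has order at least [r], and [lin us] takes away at
     most the ramification index. *)
  rewrite count_uniq_mem //; case: (boolP (c \in us)) => [cus|_]; last first.
    by rewrite mulr0n mulrn_wge0.
  rewrite mulr1n; apply: le_trans (place_ramification pv oc) _.
  have := fu v c pv cus oc; rewrite (dv_maxP hv f0) => h2.
  have := lin_center_ring pv oc qs; rewrite /dv_ring /= (ord_ge0 hv) => h3.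
  by rewrite mulrn_int ler_peMl //; lia.
have g0 : g != 0 by rewrite mulf_neq0 ?invr_eq0 ?expf_neq0 ?lin_neq0.
(* Having no poles, [g] is constant, hence of order 0 everywhere; this contradicts [ginf] at a pole
   of t. *)
have [[c gc]|nc] := pselect (exists c, g = emb c); last first.
  have [c' gc|v pv] := ff_pole_exists (x := g); first by apply: nc; exists c'.
  by rewrite (ord_ofE pv.1) // lte_fin ltNge gV.
have [c' tc|v pv] := ff_pole_exists (x := tt).
  by have := ff_var_transc c'; rewrite tc subrr eqxx.
have t0 : tt != 0 by have := ff_var_transc (0 : k); rewrite rmorph0 subr0.
rewrite (ord_ofE pv.1) // lte_fin => /(ginf v pv).
by rewrite gc (place_ord_const pv) ltxx.
Qed.

Lemma er_map_int_le (x y : \bar int) :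
  (x <= y)%E -> (er_map (intr : int -> R) x <= er_map intr y)%E.
Proof.
case: y => [b||] /=; [|by rewrite !leey|by rewrite leeNy_eq => /eqP ->].
by case: x => [a||] //=; rewrite ?leNye // !lee_fin ler_int.
Qed.

Lemma er_map_int_ge (m : int) (x : \bar int) :
  (m%:E <= x)%E -> ((m%:~R : R)%:E <= er_map intr x)%E.
Proof. exact: er_map_int_le. Qed.

(** Each place where some coordinate has a pole contributes at least 1 to the height, so there are
    at most [H] of them and the orders of the poles are at most [H]. Multiplying by (t - c)^H for
    the center c of each clears the finite poles. [H] depends on [B] only, [qs] on the point. *)
Lemma aff_height_bound (B : R) : exists H : nat,
  forall n (x : 'I_n -> F), (aff_height R x <= B%:E)%E ->
  (forall v l, ff_places v -> - H%:Z <= ord_of v (x l)) /\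
  exists qs : seq k, (size qs <= H * H)%N /\
    forall v c l, ff_places v -> 0 < ord_of v (tt - emb c) -> dv_ring v (lin qs * x l).
Proof.
have [H BH] : exists H : nat, B <= H%:R.
  by exists (Num.trunc `|B|).+1; apply: le_trans (ler_norm B) _; apply: ltW; exact: truncnS_gt.
exists H => n x hx.
pose a v : \bar R := er_map intr (\big[maxe/0%E]_(i < n) (- v (x i))%E).
have ale v l : (er_map (intr : int -> R) (- v (x l)) <= a v)%E.
  by apply: er_map_int_le; exact: (le_bigmax _ (fun i => - v (x i))%E).
have a0 v : (0%E <= a v)%E.
  by rewrite -[0%E]/((0%:~R : R)%:E); apply: er_map_int_ge; exact: bigmax_ge_id.
have sumH (s : seq (F -> \bar int)) : uniq s -> (forall v, v \in s -> ff_places v) ->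
    (\sum_(v <- s) a v <= (H%:R : R)%:E)%E.
  move=> us sp; apply: (le_trans _ (y := B%:E)); last by rewrite lee_fin.
  apply: le_trans hx; apply: esum_ge; exists [set` s]; last by rewrite fsbig_seq.
  by split; [exact: finite_seq|move=> v; exact: sp].
have oH v l : ff_places v -> - H%:Z <= ord_of v (x l).
  move=> pv; have [->|x0] := eqVneq (x l) 0.
    by rewrite /ord_of (proj2 (dv_eqy pv.1 0) erefl) oppr_le0.
  have := sumH [:: v]; rewrite big_seq1 => /(_ isT) h.
  have {}h : (a v <= (H%:R : R)%:E)%E by apply: h => w; rewrite inE => /eqP ->.
  have := le_trans (ale v l) h; rewrite (ord_ofE pv.1) //= lee_fin.
  by rewrite -[H%:R]/((H%:Z)%:~R) ler_int; lia.
split=> //.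
pose P v := ff_places v /\ exists l, (v (x l) < 0)%E.
have [s us sP|s [sH sP]] := @bounded_set_enum _ P H.
  have h : (\sum_(v <- s) (1 : R)%:E <= (H%:R : R)%:E)%E.
    apply: le_trans (sumH s us _); last by move=> v /sP[].
    rewrite big_seq [leRHS]big_seq; apply: lee_sum => v /sP[pv [l vl]].
    apply: le_trans (ale v l); rewrite -[1]/((1%:~R : R)); apply: er_map_int_ge.
    move: vl; case: (v (x l)) => [b|//|_]; last exact: leey.
    by rewrite lte_fin -EFinN lee_fin; lia.
  move: h; rewrite sumEFin lee_fin big_const_seq count_predT iter_addr_0.
  by rewrite ler_nat.
pose ctr (v : F -> \bar int) : k := xget 0 [set c | 0 < ord_of v (tt - emb c)].
pose qs := flatten [seq nseq H (ctr v) | v <- s].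
exists qs; split.
  rewrite size_flatten /shape -map_comp (eq_map (g := fun=> H)); last first.
    by move=> v /=; rewrite size_nseq.
  by rewrite sumnE big_map big_const_seq count_predT iter_addn_0 mulnC leq_mul2r sH orbT.
move=> v c l pv oc; have hv := pv.1.
have hV := dv_ring_val_ring hv; have sV := vr_sub hV.
have [vs|vs] := boolP (v \in s); last first.
  apply: srM => //; first exact: (lin_center_ring pv oc).
  rewrite /dv_ring /= leNgt; apply/negP => vl; case/negP: vs; apply/sP.
  by split=> //; exists l.
have cE : ctr v = c.
  rewrite /ctr; case: xgetP => [c' _ oc'|/(_ c)//].
  by apply: contraPP oc' => /eqP cc' /=; rewrite (ord_center pv oc cc') ltxx.
have [->|x0] := eqVneq (x l) 0; first by rewrite mulr0; exact: sr0.
apply/(ord_ge0 hv); rewrite ordM ?lin_neq0 // (ord_lin_center pv oc).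
have cnt : (H <= count_mem c qs)%N.
  have vi := vs; rewrite /qs; case/splitPr: vi => s1 s2.
  rewrite map_cat flatten_cat count_cat /= count_cat count_nseq cE /= eqxx; lia.
have := oH v l pv; rewrite mulrn_int.
have : 1 * H%:Z <= ord_of v (tt - emb c) * (count_mem c qs)%:Z.
  by apply: ler_pM => //; rewrite ?lez_nat //; lia.
by rewrite mul1r => h1 h2; rewrite -(subrr H%:Z); exact: lerD.
Qed.

End Heights.

(** * Residues *)

(** [X] injects into the finite product of its images; the induction cuts it into the fibres of one
    map. *)
Lemma finite_by_fibers (T W : Type) (X : set T) (fs : seq (T -> W)) :
  (forall f, List.In f fs -> finite_set (f @` X)) ->
  (forall x y, X x -> X y -> (forall f, List.In f fs -> f x = f y) -> x = y) ->
  finite_set X.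
Proof.
elim: fs X => [|f fs ih] X fin inj.
  have [->|/set0P[x Xx]] := eqVneq X set0; first exact: finite_set0.
  by apply: (sub_finite_set (B := [set x])) (finite_set1 x) => y Xy; exact: inj.
have -> : X = \bigcup_(w in f @` X) (X `&` f @^-1` [set w]).
  apply/seteqP; split=> [x Xx|x [w _ []//]].
  by exists (f x) => //; exists x.
apply: bigcup_finite; first by apply: fin; left.
move=> w _; apply: ih => [g gfs|x y [Xx fx] [Xy fy] h].
  apply: (sub_finite_set (B := g @` X)); last by apply: fin; right.
  by move=> _ [x [Xx _] <-]; exists x.
by apply: inj => // g [<-|/h//]; rewrite fx fy.
Qed.

Section ZerosIn.
Variables (O : comNzRingType) (n : nat) (J : set {mpoly O[n]}).

Definition zeros_in (T : comNzRingType) (g : O -> T) (G : {pred T}) :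
    set ('I_n -> T) :=
  [set x | (forall l, x l \in G) /\ forall p, J p -> mmap g x p = 0].

(** The condition Fin for the zeros of [J], stated with generators in place of rings so that it
    passes easily along embeddings of fields. *)
Definition finite_fg_zeros (T : comNzRingType) (g : O -> T) :=
  forall m (a : 'I_m -> T), finite_set (zeros_in g (gen_ring a)).
End ZerosIn.

Lemma map_mpoly_meval (O L : comNzRingType) n (f : {rmorphism O -> L})
    (x : 'I_n -> L) (p : {mpoly O[n]}) :
  meval x (map_mpoly f p) = mmap f x p.
Proof.
rewrite /map_mpoly.
rewrite [LHS](rmorph_mmap (@mpolyC n L \o f : {rmorphism _ -> _}) (meval x)).
by apply: eq_mmap => [c|i] /=; rewrite ?mevalC ?mevalXU.
Qed.

(** * Zariski closures of finite sets of rational points *)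

Section Closure.
Variables (L : fieldType) (n : nat).

Lemma separating_poly (x : 'I_n -> L) (s : seq ('I_n -> L)) : x \notin s ->
  exists e : {mpoly L[n]}, meval x e != 0 /\ forall y, y \in s -> meval y e = 0.
Proof.
elim: s => [|y s ih]; first by exists 1; rewrite meval1 oner_neq0.
rewrite inE negb_or => /andP[xy /ih[e [ex es]]].
have [l xyl] : exists l, x l != y l.
  apply: contrapT => h; case/eqP: xy; apply: funext => l.
  by apply: contrapT => /eqP hl; apply: h; exists l.
exists ((mpolyX _ (mnm1 l) - mpolyC n (y l)) * e); split.
  by rewrite mevalM mevalB mevalC mevalXU mulf_neq0 // subr_eq0.
move=> z; rewrite inE mevalM mevalB mevalC mevalXU => /orP[/eqP ->|/es ->].
  by rewrite subrr mul0r.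
by rewrite mulr0.
Qed.

(** The polynomials vanishing at a point x of [U] form a prime ideal in the closure of [U], hence in
    that of [T]. A polynomial vanishing on [T] but not at x would contradict this. *)
Lemma closure_finite (JL : set {mpoly L[n]}) (T U : set ('I_n -> L)) :
  (forall x, U x -> forall p, JL p -> meval x p = 0) ->
  finite_set T -> zariski_closure JL T = zariski_closure JL U -> U `<=` T.
Proof.
move=> UJ /finite_seqP[s ->] cl x Ux; apply: contrapT => /negP xs.
pose q : {mpoly L[n]} -> bool := fun p => meval x p == 0.
have : zariski_closure JL U q.
  split=> [| |p /UJ|E EU p /(EU _ Ux)].
  - split=> [||a u w]; rewrite !unfold_in /q ?meval0 ?meval1 ?oner_eq0 //.
    by move=> /eqP u0 /eqP w0; rewrite mevalD mevalM u0 w0 mulr0 addr0.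
  - by move=> u w; rewrite !unfold_in /q mevalM mulf_eq0.
  - by move=> /(_ x Ux) h; apply/eqP.
  - by move=> h; apply/eqP.
rewrite -cl => -[_ _ _ h]; have [e [ex es]] := separating_poly xs.
by case/negP: ex; apply: (h [set e]) => // y ys _ ->; exact: es.
Qed.
End Closure.

Section Residue.
Variable F : function_field.
Let k := ff_const F.
Local Notation emb := (@ff_embed F).
Local Notation tt := (@ff_var F).

Lemma common_denominator (A : idomainType) (s : seq {fraction A}) :
  exists2 d : A, d != 0 & forall x, x \in s -> exists q, tofrac d * x = tofrac q.
Proof.
elim: s => [|x s [d d0 ih]]; first by exists 1; rewrite ?oner_neq0.
have [a [b [b0 xE]]] := fractionP x.
exists (b * d); first by rewrite mulf_neq0.
move=> y; rewrite inE rmorphM => /orP[/eqP ->|/ih[q qE]].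
  exists (d * a); rewrite xE rmorphM [tofrac b * _]mulrC -mulrA; congr (_ * _).
  by rewrite mulrC divfK // tofrac_eq0.
by exists (b * q); rewrite -mulrA qE rmorphM.
Qed.

(** Denominators are cleared so that the equation can be specialized at t = u. *)
Lemma poly_relation (x : F) : exists2 Q : {poly {poly k}}, Q != 0
  & root (map_poly (fun q => (map_poly emb q).[tt]) Q) x.
Proof.
have [P [P0 _ rP]] := ext_root x.
have [d d0 dP] := common_denominator P.
pose f i : {poly k} := xget 0 [set q | tofrac d * P`_i = tofrac q].
have fE i : tofrac d * P`_i = tofrac (f i).
  rewrite /f; case: xgetP => [q _ //|hn].
  have [iP|iP] := ltnP i (size P); last first.
    by case: (hn 0); rewrite /= nth_default // mulr0 rmorph0.
  by have [q hq] := dP _ (mem_nth 0 iP); case: (hn q).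
pose Q := \poly_(i < size P) f i.
have QE : map_poly (fun q => (map_poly emb q).[tt]) Q = map_poly (in_alg F) (tofrac d *: P).
  apply/polyP => i; rewrite [RHS]coef_map /= coefZ fE ff_poly coef_map_id0; last first.
    by rewrite rmorph0 horner0.
  rewrite coef_poly; case: ltnP => // iP.
  suff -> : f i = 0 by [].
  by apply/eqP; rewrite -tofrac_eq0 -fE nth_default // mulr0.
exists Q; last first.
  by rewrite QE map_polyZ /root hornerZ; have /rootP -> := rP; rewrite mulr0.
apply: contraNneq P0 => Q0; have := QE; rewrite Q0 map_poly0 => /esym/eqP.
by rewrite map_poly_eq0 scaler_eq0 tofrac_eq0 (negbTE d0).
Qed.

Section AtPlace.
Variables (v : F -> \bar int) (u : k).
Hypotheses (pv : ff_places v) (ou : 0 < ord_of v (tt - emb u)).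
Let V := dv_ring v.
Let hV : is_val_ring V := dv_ring_val_ring pv.1.
Let sV := vr_sub hV.
Let Vk c : V (emb c) := place_const pv c.

(** The residue of x at the place is a. As a relation it applies to every x, integral or not, and
    needs no residue field. *)
Definition congr_res (x : F) (a : k) := vr_max V (x - emb a).

Lemma congr_res_emb a : congr_res (emb a) a.
Proof. by rewrite /congr_res subrr; left. Qed.

Lemma congr_resD x y a b : congr_res x a -> congr_res y b -> congr_res (x + y) (a + b).
Proof.
rewrite /congr_res => h1 h2.
by rewrite rmorphD opprD addrACA; apply: vr_maxD.
Qed.

Lemma congr_res_ring x a : congr_res x a -> V x.
Proof. by move=> /(vr_maxW hV) h; rewrite -[x](subrK (emb a)); apply: srD. Qed.

Lemma congr_resM x y a b : congr_res x a -> congr_res y b -> congr_res (x * y) (a * b).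
Proof.
move=> h1 h2; have Vx := congr_res_ring h1; rewrite /congr_res.
have -> : x * y - emb (a * b) = x * (y - emb b) + emb b * (x - emb a).
  rewrite rmorphM !mulrBr [emb b * x]mulrC [emb b * emb a]mulrC.
  by rewrite addrA subrK.
by apply: vr_maxD => //; apply: vr_maxM.
Qed.

Lemma congr_resX x a m : congr_res x a -> congr_res (x ^+ m) (a ^+ m).
Proof.
move=> h; elim: m => [|m ih]; last by rewrite !exprS; exact: congr_resM.
by rewrite !expr0 -(rmorph1 emb); exact: congr_res_emb.
Qed.

Lemma congr_res_inj a b : congr_res (emb a) b -> a = b.
Proof.
rewrite /congr_res -rmorphB => h; apply/eqP; rewrite -subr_eq0; apply: contraT => ab.
case: h => [/eqP|]; first by rewrite fmorph_eq0 (negbTE ab).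
by rewrite -fmorphV; case; exact: Vk.
Qed.

Lemma congr_res_mmap (O : nzRingType) m (g : O -> F) (h : O -> k) (x : 'I_m -> F) (a : 'I_m -> k)
    (p : {mpoly O[m]}) :
  (forall c, congr_res (g c) (h c)) -> (forall i, congr_res (x i) (a i)) ->
  congr_res (mmap g x p) (mmap h a p).
Proof.
move=> gh xa; have [c0 c1] : congr_res 0 0 /\ congr_res 1 1.
  by have [] := (congr_res_emb 0, congr_res_emb 1); rewrite rmorph0 rmorph1.
rewrite /mmap; apply: (big_ind2 congr_res) => // [*|i _]; first exact: congr_resD.
apply: congr_resM => //; rewrite /mmap1; apply: (big_ind2 congr_res) => // [*|j _].
  exact: congr_resM.
exact: congr_resX.
Qed.


(** The leading coefficient is a unit at the place, so x is integral there. The specialized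
    polynomial splits over k and its value at x is in the maximal ideal, so some factor x - a is
    too. That a is a root leaves only finitely many residues over u. *)
Lemma residue_exists (Q : {poly {poly k}}) (x : F) :
  (lead_coef Q).[u] != 0 -> root (map_poly (fun q => (map_poly emb q).[tt]) Q) x ->
  exists2 a, congr_res x a & root (map_poly (horner_eval u) Q) a.
Proof.
move=> Qu rQ; pose g (q : {poly k}) := (map_poly emb q).[tt].
have gC q : congr_res (g q) q.[u].
  rewrite /g horner_coef [q.[u]]horner_coef size_map_poly.
  have c0 : congr_res 0 0 by have := congr_res_emb 0; rewrite rmorph0.
  apply: (big_ind2 congr_res) => // [*|i _]; first exact: congr_resD.
  rewrite coef_map /=; apply: congr_resM; first exact: congr_res_emb.
  apply: congr_resX; rewrite /congr_res; apply/(dv_maxP pv.1) => //.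
  exact: ff_var_transc.
have g0 : g 0 = 0 by rewrite /g rmorph0 horner0.
pose d := g (lead_coef Q).
have Vd' : V d^-1.
  apply: vr_unit => //; first exact: congr_res_ring (gC _).
  move=> md; case/eqP: Qu; apply/esym/congr_res_inj; rewrite /congr_res.
  rewrite rmorph0 sub0r; apply: vr_maxN => //.
  have -> : emb (lead_coef Q).[u] = d - (d - emb (lead_coef Q).[u]).
    by rewrite opprB addrC subrK.
  by apply: vr_maxD => //; apply: vr_maxN => //; exact: gC.
have d0 : d != 0.
  apply/eqP => d0; case/eqP: Qu; apply/esym/congr_res_inj; rewrite rmorph0 -d0.
  exact: gC.
have sQ : size (map_poly g Q) = size Q by rewrite size_poly_eq //; exact: d0.
have Vx : V x.
  apply: (@vr_integral _ _ hV (d^-1 *: map_poly g Q)).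
  - by rewrite monicE lead_coefZ lead_coefE sQ coef_map_id0 // -lead_coefE mulVf.
  - move=> i; rewrite coefZ coef_map_id0 //; apply: srM => //.
    exact: congr_res_ring (gC _).
  - by rewrite /root hornerZ; have /rootP -> := rQ; rewrite mulr0.
pose P : {poly k} := map_poly (horner_eval u) Q.
have sP : size P = size Q by rewrite size_poly_eq // /horner_eval.
have mP : vr_max V (map_poly emb P).[x].
  have -> : (map_poly emb P).[x] = (map_poly emb P).[x] - (map_poly g Q).[x].
    by have /rootP -> := rQ; rewrite subr0.
  rewrite !horner_coef sQ size_map_poly sP -sumrB; apply: vr_max_sum => // i _.
  rewrite -mulrBl mulrC coef_map /= coef_map_id0 ?coef_map_id0 // /horner_eval ?horner0 //.
  apply: vr_maxM => //; first exact: srX.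
  rewrite -opprB; apply: vr_maxN => //; exact: gC.
have P0 : P != 0 by rewrite -size_poly_eq0 sP size_poly_eq0; apply: contraNneq Qu => ->; rewrite lead_coef0 horner0.
have [s PE] := closed_field_poly_normal P.
have [[a ra ca]|nh] := pselect (exists2 a, a \in s & congr_res x a).
  exists a => //; rewrite -/P PE rootZ ?lead_coef_eq0 // root_prod_XsubC //.
exfalso; move: mP; rewrite PE map_polyZ hornerZ => mP.
have {mP} mP : vr_max V (\prod_(a <- s) (x - emb a)).
  have -> : \prod_(a <- s) (x - emb a) =
     emb (lead_coef P)^-1 * (emb (lead_coef P) * (map_poly emb (\prod_(z <- s) ('X - z%:P))).[x]).
    rewrite fmorphV mulKf ?fmorph_eq0 ?lead_coef_eq0 // rmorph_prod horner_prod.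
    by apply: eq_bigr => a _; rewrite rmorphB /= map_polyX map_polyC !hornerE.
  exact: vr_maxM.
elim: s nh mP {PE} => [|a s ih] nh; rewrite ?big_nil ?big_cons; first exact: vr_max1.
move=> mP; apply: ih => [[b bs]|].
  by move=> cb; apply: nh; exists b; rewrite ?inE ?bs ?orbT.
have nm : ~ vr_max V (x - emb a) by move=> ca; apply: nh; exists a; rewrite ?mem_head.
have Vxa : V (x - emb a) by apply: srB.
have := vr_maxM hV (vr_unit Vxa nm) mP; rewrite mulKf //.
by apply: contra_notN nm => /eqP ->; left.
Qed.

End AtPlace.
End Residue.

(** * Points over finitely generated subrings of a function field *)

Lemma closed_field_avoid (k : closedFieldType) (D : {poly k}) N : D != 0 ->
  exists us : seq k, [/\ uniq us, size us = N & forall u, u \in us -> D.[u] != 0].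
Proof.
move=> D0; elim: N => [|N [us [Uus sus usD]]]; first by exists [::].
pose D' := D * \prod_(u <- us) ('X - u%:P).
have D'0 : D' != 0.
  rewrite mulf_neq0 // prodf_seq_neq0; apply/allP => u _ /=.
  by rewrite polyXsubC_eq0.
(* As in Euclid's proof, a root of D'X + 1 is not a root of D'. *)
have [|z /rootP] := closed_rootP (D' * 'X + 1) _.
  by rewrite size_polyDl ?size_mulX ?size_poly1 ?ltnS ?size_poly_gt0 //; rewrite eqSS size_poly_eq0.
rewrite hornerD hornerMX hornerC => zE; have : D'.[z] != 0.
  by apply/eqP => Dz; move/eqP: zE; rewrite Dz mul0r add0r oner_eq0.
rewrite /D' hornerM mulf_eq0 negb_or => /andP[Dz].
rewrite -rootE root_prod_XsubC => zus.
exists (z :: us); rewrite /= zus sus; split=> // u.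
by rewrite inE => /orP[/eqP ->|/usD].
Qed.

Section FunctionFieldFinite.
Variables (R : realType) (n : nat) (O : comNzRingType) (J : set {mpoly O[n]}).

(** The height hypothesis of the theorem, with any ring [O] in place of the S-integers. *)
Definition bounded_height_dense :=
  forall (A : idomainType) (j : {rmorphism O -> A}),
     injective j -> fg_ring A ->
   forall (t : nat) (F : 'I_t -> function_field)
          (e : forall i, {rmorphism {fraction A} -> F i}),
   let XX := closed_subscheme J in
   let pt (x : XX (Algebra j)) (l : 'I_n) : {fraction A} := tofrac (sval x l) in
   let JL := [set map_mpoly (fun a => tofrac (j a)) p | p in J] in
   exists R' : set (XX (Algebra j)),
     zariski_closure JL (pt @` R') = zariski_closure JL (range pt) /\
     forall i, exists B : R, forall x, R' x ->
       (aff_height R (e i \o pt x) <= B%:E)%E.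

Hypothesis bnd : bounded_height_dense.

Variables (F : function_field).
Let k := ff_const F.
Local Notation emb := (@ff_embed F).
Local Notation tt := (@ff_var F).
Variable h : {rmorphism O -> k}.
Hypothesis h_inj : injective h.
Hypothesis h_fin : finite_fg_zeros J h.

Section Generators.
Variables (m : nat) (c : 'I_m -> F).
Hypothesis hc : forall o, emb (h o) \in gen_ring c.

(* Points of bounded height are separated by their residues at the places over
   finitely many points of the line; each residue map sends the points to the
   finitely many points over a finitely generated subring of the constants. *)
Lemma bounded_height_finite (B : R) (X : set ('I_n -> F)) :
  X `<=` zeros_in J (emb \o h) (gen_ring c) ->
  (forall x, X x -> (aff_height R x <= B%:E)%E) -> finite_set X.
Proof.
move=> XZ XB; have [H HP] := aff_height_bound F B.
have [Q Q0 Qc] : exists2 Q : 'I_m -> {poly {poly k}}, (forall i, Q i != 0)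
    & forall i, root (map_poly (fun q => (map_poly emb q).[tt]) (Q i)) (c i).
  have /boolp.choice[Q hQ] : forall i, exists Q : {poly {poly k}}, Q != 0 /\
      root (map_poly (fun q => (map_poly emb q).[tt]) Q) (c i).
    by move=> i; have [Q] := poly_relation (c i); exists Q.
  by exists Q => i; have [] := hQ i.
(* Where [D] does not vanish, all generators [c i] have residues. *)
pose D := \prod_i lead_coef (Q i).
have D0 : D != 0 by apply/prodf_neq0 => i _; rewrite lead_coef_eq0.
(* The count fits [vanishing] for x_l - y_l: poles of order at most [H], and two lists of at most
   H^2 factors to clear the finite ones. *)
have [us [Uus sus usD]] := closed_field_avoid (\dim {:F} * (2 * (H * H) + H)).+1 D0.
have Qu u i : u \in us -> (lead_coef (Q i)).[u] != 0.
  by move=> /usD; rewrite /D horner_prod => /prodf_neq0; apply.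
(* Residue vectors of the generators at the places over [us]. There are finitely many, their entries
   being roots of the specialized equations. *)
pose Sig : set ('I_m -> k) := [set rho | exists u v, [/\ u \in us, ff_places v,
   0 < ord_of v (tt - emb u), forall i, congr_res v (c i) (rho i)
   & forall i, root (map_poly (horner_eval u) (Q i)) (rho i)]].
have SigP u v : u \in us -> ff_places v -> 0 < ord_of v (tt - emb u) ->
    exists2 rho, Sig rho & forall i, congr_res v (c i) (rho i).
  move=> uus pv ou.
  have /boolp.choice[rho hrho] : forall i, exists a, congr_res v (c i) a /\
      root (map_poly (horner_eval u) (Q i)) a.
    by move=> i; have [a] := residue_exists pv ou (Qu u i uus) (Qc i); exists a.
  by exists rho => [|i]; [exists u, v; split=> // i; have [] := hrho i|have [] := hrho i].
have Sig_fin : finite_set Sig.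
  apply: (@finite_by_fibers _ _ _ [seq (fun rho => rho i) | i <- enum 'I_m]).
    move=> f /List.in_map_iff[i [<- _]].
    pose rts := flatten [seq xget [::] [set s : seq k | forall a,
       root (map_poly (horner_eval u) (Q i)) a -> a \in s] | u <- us].
    apply: (sub_finite_set (B := [set` rts])); last exact: finite_seq.
    move=> _ [rho [u [v [uus _ _ _ /(_ i) ri]]] <-] /=; apply/flattenP.
    eexists; first by apply/mapP; exists u.
    case: xgetP => [s _ /(_ _ ri)//|hn].
    have P0 : map_poly (horner_eval u) (Q i) != 0.
      by rewrite -size_poly_eq0 size_poly_eq ?size_poly_eq0 // /horner_eval Qu.
    have [s sE] := closed_field_poly_normal (map_poly (horner_eval u) (Q i)).
    case: (hn s) => a; rewrite sE rootZ ?lead_coef_eq0 //.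
    by rewrite root_prod_XsubC.
  move=> x y _ _ hxy; apply: funext => i; apply: (hxy (fun rho => rho i)).
  apply/List.in_map_iff; exists i; split=> //.
  have : i \in enum 'I_m by rewrite mem_enum.
  elim: (enum _) => // a s ih; rewrite inE => /orP[/eqP ->|/ih]; by [left|right].
(* A polynomial expression in the generators is fixed for each element; evaluating it at [rho] gives
   the residue map on the subring. *)
pose q (y : F) : {mpoly int[m]} := xget 0 [set p | y = mmap intr c p].
have qE y : y \in gen_ring c -> y = mmap intr c (q y).
  by move=> /asboolP[p yp]; rewrite /q; case: xgetP => // /(_ p).
pose phi (rho : 'I_m -> k) (x : 'I_n -> F) (l : 'I_n) : k := mmap intr rho (q (x l)).
have phiP rho v x l : ff_places v -> (forall i, congr_res v (c i) (rho i)) ->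
    X x -> congr_res v (x l) (phi rho x l).
  move=> pv crho /XZ[xG _]; rewrite {1}(qE _ (xG l)).
  apply: (congr_res_mmap pv) => // z.
  by have := congr_res_emb v z%:~R; rewrite rmorph_int.
have /finite_seqP[sig sigE] := Sig_fin.
apply: (@finite_by_fibers _ _ X [seq phi rho | rho <- sig]).
  move=> f /List.in_map_iff[rho [<- rs]].
  have {rs} : Sig rho.
    rewrite sigE /=; elim: sig rs {sigE} => //= a s ih [->|/ih]; rewrite inE ?eqxx //.
    by move=> ->; rewrite orbT.
  move=> [u [v [_ pv _ crho _]]].
  (* Reducing the equations shows that the residues form a zero of [J] over the ring generated by
     [rho]. *)
  apply: sub_finite_set (h_fin rho) => _ [x Xx <-]; split=> [l|p Jp].
    by apply/asboolP; eexists.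
  apply/esym/(congr_res_inj pv); rewrite rmorph0.
  have [_ /(_ p Jp) <-] := XZ x Xx.
  apply: congr_res_mmap => // [o|l]; first exact: congr_res_emb.
  exact: phiP.
move=> x y Xx Xy phixy; apply: funext => l; apply/eqP; rewrite -subr_eq0; apply/eqP.
have [xH [qx [sqx qxV]]] := HP _ x (XB x Xx).
have [yH [qy [sqy qyV]]] := HP _ y (XB y Xy).
apply: (@vanishing F H (x l - y l) (qx ++ qy) us) => //.
- rewrite sus ltnS leq_mul2l size_cat; apply/orP; right; lia.
- move=> v pv; have hv := pv.1.
  have [xy0|xy0] := eqVneq (x l - y l) 0.
    by rewrite xy0 /ord_of (proj2 (dv_eqy hv 0) erefl) oppr_le0.
  have oN z : ord_of v (- z) = ord_of v z.
    have [->|z0] := eqVneq z 0; first by rewrite oppr0.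
    rewrite -mulN1r ordM ?oppr_eq0 ?oner_eq0 //.
    by rewrite {1}/ord_of (dvN1 hv) add0r.
  have [x0|x0] := eqVneq (x l) 0; first by rewrite x0 sub0r oN yH.
  have [y0|y0] := eqVneq (y l) 0; first by rewrite y0 subr0 xH.
  have := ordD hv x0 (y := - y l); rewrite oppr_eq0 oN => /(_ y0 xy0).
  by apply: le_trans; rewrite le_min xH // yH.
- move=> v u pv ou; have hV := dv_ring_val_ring pv.1; have sV := vr_sub hV.
  have -> : @lin F (qx ++ qy) * (x l - y l) =
      @lin F qy * (@lin F qx * x l) - @lin F qx * (@lin F qy * y l).
    by rewrite /lin big_cat /= mulrBr -!mulrA mulrCA; congr (_ - _).
  apply: srB => //; apply: srM => //; try exact: (lin_center_ring pv ou).
    exact: (qxV v u).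
  exact: (qyV v u).
- move=> v u pv uus ou; have hV := dv_ring_val_ring pv.1.
  have [rho rS crho] := SigP u v uus pv ou.
  have phiE : phi rho x = phi rho y.
    apply: (phixy (phi rho)); apply/List.in_map_iff; exists rho; split=> //.
    have {rS} : rho \in sig by move: rS; rewrite sigE.
    elim: (sig) => // a s ih; rewrite inE => /orP[/eqP ->|/ih]; by [left|right].
  have -> : x l - y l = (x l - emb (phi rho x l)) - (y l - emb (phi rho y l)).
    by rewrite phiE opprB addrA subrK.
  by apply: vr_maxD => //; [exact: phiP|apply: vr_maxN => //; exact: phiP].
Qed.

(** The hypothesis is applied to A = [gen_ring c], which contains the image of [O] by [hc] and whose
    fraction field embeds in [F]. *)
Lemma function_field_finite_gen : finite_set (zeros_in J (emb \o h) (gen_ring c)).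
Proof.
pose G := gen_ring c : subringClosed F.
pose j : {rmorphism O -> subring G} := to_subring (G := G) (f := emb \o h : {rmorphism O -> F}) hc.
have j_inj : injective j.
  move=> a b /(congr1 val) ab; apply/h_inj/(fmorph_inj (@ff_embed F : {rmorphism k -> F})).
  exact: ab.
pose vl : {rmorphism subring G -> F} := (val : subring G -> F).
have vl_inj : injective vl := val_inj.
pose pt (x : closed_subscheme J (Algebra j)) l : {fraction subring G} := tofrac (sval x l).
pose JL := [set map_mpoly (fun a => tofrac (j a)) p | p in J].
have [R' [cl /(_ ord0)[B hB]]] := bnd j_inj (fg_gen_ring c) (t := 1) (F := fun _ => F)
  (fun _ => frac_lift vl_inj).
rewrite -/pt -/JL in cl hB.
have ptE x l : frac_lift vl_inj (pt x l) = val (sval x l) by rewrite frac_lift_tofrac.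
have solE (x : closed_subscheme J (Algebra j)) :
    zeros_in J (emb \o h) (gen_ring c) (fun l => val (sval x l)).
  split=> [l|p Jp]; first exact: valP.
  have := svalP x p Jp; rewrite -[aeval _ _]/(mmap j (sval x) p) => /(congr1 vl).
  by rewrite (rmorph_mmap j vl) rmorph0.
pose lam (x : closed_subscheme J (Algebra j)) l : F := val (sval x l).
have ptlam x : (fun l => frac_lift vl_inj (pt x l)) = lam x by apply: funext => l; exact: ptE.
have lamfin : finite_set (lam @` R').
  apply: (@bounded_height_finite B) => [_ [x _ <-]|_ [x R'x <-]]; first exact: solE.
  by have := hB x R'x; rewrite -ptlam.
have R'fin : finite_set (pt @` R').
  apply: (@finite_by_fibers _ _ _ [:: fun y l => frac_lift vl_inj (y l)]).
    move=> f [<-|//]; apply: sub_finite_set lamfin => _ [_ [x R'x <-] <-].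
    by exists x => //; rewrite -ptlam.
  move=> x y _ _ /(_ _ (or_introl erefl)) fxy; apply: funext => l.
  apply: (fmorph_inj (frac_lift vl_inj : {rmorphism _ -> _})).
  exact: (congr1 (fun f : 'I_n -> F => f l) fxy).
have JL0 x : range pt x -> forall p, JL p -> meval x p = 0.
  move=> [y _ <-] _ [p Jp <-].
  rewrite (@map_mpoly_meval _ _ _ (@tofrac _ \o j : {rmorphism O -> {fraction subring G}})).
  have yp : mmap j (sval y) p = 0 := svalP y p Jp.
  rewrite -(rmorph_mmap j (@tofrac (subring G))) yp.
  exact: rmorph0.
have sub := closure_finite JL0 R'fin cl.
apply: sub_finite_set lamfin => x [xG xJ].
pose y l : Algebra j := Subring (xG l).
have yJ p : J p -> aeval (R := Algebra j) y p = 0.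
  move=> Jp; apply: val_inj; rewrite -[aeval _ _]/(mmap j y p).
  by rewrite [LHS](rmorph_mmap j vl) rmorph0 -(xJ p Jp); apply: eq_mmap.
have [|w R'w wE] := sub (pt (exist _ y yJ)); first by exists (exist _ y yJ).
exists w => //; rewrite -ptlam wE ptlam.
by [].
Qed.
End Generators.

(** A finitely generated subring need not contain the image of [O]; adjoining the generators [b0] of
    the constants repairs this and only adds points. *)
Lemma function_field_finite m0 (b0 : 'I_m0 -> k) :
  (forall o, h o \in gen_ring b0) -> finite_fg_zeros J (emb \o h).
Proof.
move=> hb0 m b.
pose c (i : 'I_(m0 + m)) : F := match fintype.split i with inl i => emb (b0 i) | inr i => b i end.
have hc o : emb (h o) \in gen_ring c.
  have /asboolP[p ->] := hb0 o; rewrite rmorph_mmap.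
  apply: mmap_in => [z|i]; first by rewrite /= rmorph_int; exact: rpred_int.
  have := gen_ringX c (unsplit (inl i)); by rewrite /c unsplitK.
apply: sub_finite_set (function_field_finite_gen hc) => x [xb xJ]; split=> // l.
apply: gen_ring_min (xb l) => i.
by have := gen_ringX c (unsplit (inr i)); rewrite /c unsplitK.
Qed.

End FunctionFieldFinite.

(** * Extending the constant field *)

Section AlgebraicClosureIn.
Variables (F0 : fieldType) (M : closedFieldType) (f : {rmorphism F0 -> M}).

Definition alg_in : {pred M} := fun x => `[< algebraicOver f x >].

Lemma alg_in_divring : divring_closed alg_in.
Proof.
split=> [|x y /asboolP hx /asboolP hy|x y /asboolP hx /asboolP hy]; apply/asboolP.
- exact: algebraic1.
- exact: algebraic_sub.
- exact: algebraic_div.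
Qed.
HB.instance Definition _ := GRing.isDivringClosed.Build M alg_in alg_in_divring.

Record alg_closure : Type := AlgClosure { alg_val :> M; _ : alg_val \in alg_in }.
HB.instance Definition _ := [isSub for alg_val].
HB.instance Definition _ := [Choice of alg_closure by <:].
HB.instance Definition _ := [SubChoice_isSubComUnitRing of alg_closure by <:].
HB.instance Definition _ := [SubComUnitRing_isSubIntegralDomain of alg_closure by <:].
HB.instance Definition _ := [SubIntegralDomain_isSubField of alg_closure by <:].

(** [M] supplies a root, and it is algebraic over [F0] because algebraicity is transitive. *)
Lemma alg_closure_axiom : GRing.closed_field_axiom alg_closure.
Proof.
move=> n P n0; pose Q i := val (P i).
have [x xE] := @solve_monicpoly M n Q n0.
suff xP : x \in alg_in.
  exists (AlgClosure xP); apply: val_inj.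
  pose vl : {rmorphism alg_closure -> M} := (val : alg_closure -> M).
  rewrite [LHS](rmorphXn vl) [RHS](rmorph_sum vl) [LHS]xE.
  by apply: eq_bigr => i _; rewrite (rmorphM vl) (rmorphXn vl).
apply/asboolP/integral_algebraic.
pose q := 'X^n - \poly_(i < n) Q i.
have sq : (size (\poly_(i < n) Q i) < size ('X^n : {poly M}))%N.
  by rewrite size_polyXn ltnS size_poly.
apply: (@integral_root_monic _ _ _ _ q).
- by rewrite monicE lead_coefDl ?size_polyN // lead_coefXn.
- by rewrite /root !hornerE horner_poly xE subrr.
- apply/integral_poly => i; rewrite coefB coefXn coef_poly.
  apply: integral_sub; first exact: integral_nat.
  case: ifP => _; last exact: integral0.
  by have /asboolP/integral_algebraic := valP (P i).
Qed.
HB.instance Definition _ := Field_isAlgClosed.Build alg_closure alg_closure_axiom.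

(** Function fields are abstract finite extensions; this realizes finitely many algebraic elements
    of [M] in one of them. *)
Lemma ext_containing (s : seq M) : (forall x, x \in s -> algebraicOver f x) ->
  exists (L : fieldExtType F0) (theta : {rmorphism L -> M}),
    (forall c, theta c%:A = f c) /\ forall x, x \in s -> exists y, theta y = x.
Proof.
elim: s => [|z s ih] alg.
  exists F0^o, f; split=> // c; exact: (congr1 f (mulr1 c)).
have [|L [theta [thetaE thetas]]] := ih.
  by move=> x xs; apply: alg; rewrite inE xs orbT.
have [P0 P00 P0z] := alg z (mem_head _ _).
(* A nonzero polynomial of least size vanishing at z is irreducible, so it defines L(z). *)
pose Q m := `[< exists P : {poly L}, [/\ P != 0, root (map_poly theta P) z & size P = m] >].
have [|d /asboolP[p [p0 pz ps]] dmin] := @ex_minnP Q.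
  exists (size (map_poly (in_alg L) P0)); apply/asboolP.
  exists (map_poly (in_alg L) P0); split=> //; first by rewrite map_poly_eq0.
  by rewrite -map_poly_comp (eq_map_poly (g := f)).
have irr : irreducible_poly p.
  apply/(subfx_irreducibleP pz p0) => q qz q0.
  by rewrite ps; apply: dmin; apply/asboolP; exists q.
pose L1 := SubFieldExtType pz irr.
pose th1 : {rmorphism L1 -> M} := @subfx_inj _ _ theta z p.
exists (baseFieldType L1), th1; split=> [c|x].
  rewrite baseField_scaleE -thetaE; exact: (subfx_inj_base pz p0).
rewrite inE => /orP[/eqP ->|/thetas[y yE]].
  by exists (subfx_root theta z p); exact: (subfx_inj_root pz p0).
exists (y%:A : L1); rewrite -yE; exact: (subfx_inj_base pz p0).
Qed.

End AlgebraicClosureIn.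

(** * Induction on the generators of a subring of M *)

Section Induction.
Variables (R : realType) (n : nat) (O : comNzRingType) (J : set {mpoly O[n]}).
Hypothesis bnd : bounded_height_dense R J.
Variable M : closedFieldType.
Hypothesis M0 : [pchar M] =i pred0.

Record finite_subfield (hM : {rmorphism O -> M}) := FiniteSubfield {
  fs_field : closedFieldType;
  fs_val : {rmorphism fs_field -> M};
  fs_const : {rmorphism O -> fs_field};
  fs_compat : fs_val \o fs_const =1 hM;
  fs_finite : finite_fg_zeros J fs_const }.

Variable hM : {rmorphism O -> M}.
Hypothesis hM_inj : injective hM.

Definition fg_consts (T : comNzRingType) (h : O -> T) :=
  exists (m0 : nat) (b0 : 'I_m0 -> T), forall o, h o \in gen_ring b0.

(** If b is not in k, it is transcendental over the algebraically closed k, so k(b) is a copy of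
    k(t). The new field is the algebraic closure of k(b) in [M]; finitely many of its elements lie
    in a finite extension of k(b), that is, in a function field over k. *)
Lemma finite_subfield_adjoin (K : finite_subfield hM) (b : M) :
  fg_consts (fs_const K) ->
  exists K' : finite_subfield hM, [/\ fg_consts (fs_const K'),
    exists y, fs_val K' y = b
  & forall y, exists y', fs_val K' y' = fs_val K y].
Proof.
case: K => k sg h hE hfin /= [m0 [b0 hb0]].
have [[y yb]|nb] := pselect (exists y, sg y = b).
  exists (FiniteSubfield hE hfin); split=> //=; [by exists m0, b0|by exists y|by move=> z; exists z].
pose ev : {rmorphism {poly k} -> M} := horner_eval b \o map_poly sg.
have ev_inj : injective ev.
  move=> p q /eqP; rewrite -subr_eq0 -rmorphB => /eqP pq.
  apply/eqP; rewrite -subr_eq0; apply: contraT => pq0; case: nb.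
  have [s sE] := closed_field_poly_normal (p - q).
  move: pq; rewrite /ev /= /horner_eval sE map_polyZ rmorph_prod hornerZ horner_prod => /eqP.
  rewrite mulf_eq0 fmorph_eq0 lead_coef_eq0 (negbTE pq0) /= prodf_seq_eq0 => /hasP[c _] /=.
  by rewrite rmorphB /= map_polyX map_polyC !hornerE subr_eq0 => /eqP ->; exists c.
pose f : {rmorphism {fraction {poly k}} -> M} := frac_lift ev_inj.
pose k' := alg_closure f.
have fC (c : k) : f (tofrac c%:P) = sg c.
  by rewrite /f /= frac_lift_tofrac /ev /= map_polyC /horner_eval hornerC.
have sgP c : sg c \in alg_in f.
  by apply/asboolP; rewrite -fC; exact: algebraic_id.
have bP : b \in alg_in f.
  apply/asboolP; have -> : b = f (tofrac 'X).
    by rewrite /f /= frac_lift_tofrac /ev /= map_polyX /horner_eval hornerX.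
  exact: algebraic_id.
pose tau0 (c : k) : k' := AlgClosure (sgP c).
have tau_zmod : zmod_morphism tau0 by move=> x y; apply: val_inj; rewrite /= rmorphB.
have tau_monoid : monoid_morphism tau0.
  by split=> [|x y]; apply: val_inj; rewrite /= ?rmorph1 ?rmorphM.
pose tauZ := GRing.isZmodMorphism.Build k k' tau0 tau_zmod.
pose tauM := GRing.isMonoidMorphism.Build k k' tau0 tau_monoid.
pose tau : {rmorphism k -> k'} := HB.pack tau0 tauZ tauM.
have vtau c : alg_val (tau c) = sg c by [].
pose vl : {rmorphism k' -> M} := (val : k' -> M).
have k0 : [pchar k] =i pred0.
  by move=> q; rewrite -(M0 q) !inE -(fmorph_eq0 sg) rmorph_nat.
have h_inj : injective h.
  by move=> x y xy; apply: hM_inj; rewrite -!hE /= xy.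
have fin' : finite_fg_zeros J (tau \o h).
  move=> m a.
  have [|L [theta [thetaE thetas]]] := @ext_containing _ _ f [seq alg_val (a i) | i <- enum 'I_m].
    by move=> x /mapP[i _ ->]; have /asboolP := valP (a i).
  have /boolp.choice[y yE] : forall i, exists y, theta y = alg_val (a i).
    by move=> i; apply: thetas; apply/mapP; exists i; rewrite ?mem_enum.
  pose F := FunctionField k0 L.
  have := function_field_finite (F := F) bnd h_inj hfin hb0 y.
  set Z := zeros_in _ _ _ => Zfin.
  have thE c : theta (ff_embed (F := F) c) = alg_val (tau c) by rewrite /ff_embed thetaE fC.
  apply: (@finite_by_fibers _ _ _ [:: fun x l => alg_val (x l)]).
    move=> _ [<-|//]; apply: sub_finite_set (finite_image (fun x l => theta (x l)) Zfin).
    move=> _ [x [xG xJ] <-].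
    have /boolp.choice[p pE] : forall l, exists p, x l = mmap intr a p.
      by move=> l; have /asboolP := xG l.
    have xE l : theta (mmap intr y (p l)) = alg_val (x l).
      rewrite pE [RHS](rmorph_mmap _ vl) (rmorph_mmap _ theta).
      apply: eq_mmap => [z|i]; last exact: yE.
      by rewrite [LHS](rmorph_int theta) [RHS](rmorph_int vl).
    exists (fun l => mmap intr y (p l)); last by apply: funext => l; rewrite xE.
    split=> [l|q Jq]; first by apply/asboolP; exists (p l).
    apply: (fmorph_inj theta); rewrite rmorph0 -(rmorph0 vl) -(xJ q Jq).
    rewrite (rmorph_mmap _ vl) (rmorph_mmap (@ff_embed F \o h : {rmorphism O -> F}) theta).
    by apply: eq_mmap => [o|l] /=; rewrite ?xE // thE.
  move=> x x' _ _ /(_ _ (or_introl erefl)) xx'; apply: funext => l; apply: val_inj.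
  exact: (congr1 (fun g : 'I_n -> M => g l) xx').
have comp' : vl \o (tau \o h) =1 hM by move=> o; rewrite -hE.
exists (@FiniteSubfield hM k' vl (tau \o h) comp' fin'); split=> /=.
- exists m0, (tau \o b0) => o; have /asboolP[p pE] := hb0 o.
  have -> : (tau \o h) o = tau (mmap intr b0 p) by rewrite /= pE.
  rewrite (rmorph_mmap _ tau); apply: mmap_in => [z|i]; last exact: (gen_ringX (tau \o b0)).
  by rewrite [X in X \in _](rmorph_int tau) rpred_int.
- by exists (AlgClosure bP).
- by move=> y; exists (tau y).
Qed.

Lemma finite_subfield_total (K : finite_subfield hM) :
  fg_consts (fs_const K) -> finite_fg_zeros J hM.
Proof.
move=> hK m a.
have [K' Ka] : exists K' : finite_subfield hM, forall i, exists y, fs_val K' y = a i.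
  suff [K' [_ h]] : exists K' : finite_subfield hM, fg_consts (fs_const K') /\
      forall i, i \in enum 'I_m -> exists y, fs_val K' y = a i.
    by exists K' => i; apply: h; rewrite mem_enum.
  elim: (enum _) => [|i s [K1 [hK1 h1]]]; first by exists K.
  have [K2 [hK2 hi h12]] := finite_subfield_adjoin (a i) hK1.
  exists K2; split=> // j; rewrite inE => /orP[/eqP -> //|/h1[y <-]].
  by have [y' <-] := h12 y; exists y'.
have /boolp.choice[y yE] := Ka.
have Zfin := @fs_finite _ K' _ y.
apply: sub_finite_set (finite_image (fun x l => fs_val K' (x l)) Zfin) => x [xG xJ].
have /boolp.choice[p pE] : forall l, exists p, x l = mmap intr a p.
  by move=> l; have /asboolP := xG l.
have xE l : fs_val K' (mmap intr y (p l)) = x l.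
  by rewrite pE rmorph_mmap; apply: eq_mmap => [z|i] /=; rewrite ?rmorph_int ?yE.
exists (fun l => mmap intr y (p l)); last by apply: funext.
split=> [l|q Jq]; first by apply/asboolP; exists (p l).
apply: (fmorph_inj (fs_val K')); rewrite rmorph0 -(xJ q Jq) rmorph_mmap.
by apply: eq_mmap => [o|l] /=; [rewrite -(fs_compat K')|rewrite xE].
Qed.

End Induction.

(** * S-integers *)

Lemma integralOver_int_Aint (z : algC) (P : {poly int}) :
  P \is monic -> root (map_poly intr P) z -> z \in Aint.
Proof.
move=> mP rP; apply: (root_monic_Aint rP); first by rewrite monic_map.
by apply/polyOverP => i; rewrite coef_map /= rpred_int.
Qed.

(** [N] clears the denominators of the minimal polynomial p of degree n; Nz is a root of N^n p(X/N),
    monic with integral coefficients. *)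
Lemma Aint_multiple (z : algC) : exists2 N : nat, (0 < N)%N & N%:R * z \in Aint.
Proof.
have [p [pE mp] _] := minCpolyP z.
have rz : root (map_poly ratr p) z by rewrite -pE root_minCpoly.
pose N := (\prod_(i < size p) `|denq p`_i|)%N.
have N0 : (0 < N)%N.
  by rewrite /N; apply: prodn_gt0 => i; rewrite absz_gt0 denq_neq0.
exists N => //; have nz : (N%:R : algC) != 0 by rewrite pnatr_eq0 -lt0n.
have sp : size p != 0%N by rewrite size_poly_eq0 monic_neq0.
set n := (size p).-1; have spn : size p = n.+1 by rewrite prednK // lt0n.
have pn1 : p`_n = 1 by have /monicP := mp; rewrite lead_coefE.
pose Q : {poly algC} := \poly_(i < n.+1) (ratr p`_i * N%:R ^+ (n - i)).
have sQ : size Q = n.+1.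
  by rewrite size_poly_eq // pn1 rmorph1 subnn expr0 mulr1 oner_neq0.
apply: (@root_monic_Aint Q).
- rewrite /root horner_poly; apply/eqP.
  transitivity (N%:R ^+ n * (map_poly ratr p).[z]); last by have /rootP -> := rz; rewrite mulr0.
  rewrite horner_coef size_map_poly spn mulr_sumr; apply: eq_bigr => i _.
  have e : (N%:R : algC) ^+ n = N%:R ^+ (n - i) * N%:R ^+ i by rewrite -exprD subnK // -ltnS.
  rewrite coef_map /= exprMn e; move: (_ ^+ (n - i)) (N%:R ^+ i) (z ^+ i) (ratr _) => u v w t.
  by ring.
- by rewrite monicE lead_coefE sQ coef_poly ltnSn pn1 rmorph1 subnn expr0 mulr1.
- apply/polyOverP => i; rewrite coef_poly; case: ltnP => [ilt|_]; last exact: rpred0.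
  have [ni|ni] := eqVneq i n.
    by rewrite ni pn1 rmorph1 subnn expr0 mulr1 rpred1.
  have ilt' : (i < size p)%N by rewrite spn.
  rewrite -(prednK (n := n - i)); last by lia.
  rewrite exprS mulrA; apply: rpredM; last by rewrite rpredX ?rpred_nat.
  have dN : (`|denq p`_i| %| N)%N by rewrite /N (bigD1 (Ordinal ilt')) //= dvdn_mulr.
  have /dvdnP[q ->] := dN.
  rewrite -{1}[p`_i]divq_num_den fmorph_div !rmorph_int natrM.
  have dE : ((`|denq p`_i|%N)%:R : algC) = (denq p`_i)%:~R.
    by rewrite -[in RHS](gez0_abs (ltW (denq_gt0 p`_i))).
  rewrite dE mulrCA divfK; last by rewrite intr_eq0 denq_neq0.
  by apply: rpredM; [exact: rpred_nat|exact: rpred_int].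
Qed.

Section NumberField.
Variable K : fieldExtType rat.

Lemma in_alg_rat (c : rat) : c%:A = (numq c)%:~R / (denq c)%:~R :> K.
Proof. by rewrite -in_algE -{1}[c]divq_num_den fmorph_div !rmorph_int. Qed.

Definition integral_elt (y : K) :=
  exists2 P : {poly int}, P \is monic & root (map_poly intr P) y.

(* The coefficients of an integral element in a power basis are recovered from
   its conjugates, which are algebraic integers, by inverting a Vandermonde
   matrix; this bounds their denominators. *)
Lemma integral_fg : exists m (b : 'I_m -> K), forall y, integral_elt y -> y \in gen_ring b.
Proof.
have K0 : [pchar K] =i pred0.
  move=> p; rewrite !inE -(rmorph_nat (in_alg K)) fmorph_eq0 pnatr_eq0.
  by case: p => //= p; rewrite andbF.
pose th := separable_generator 1%AS {:K}%AS.
have sepK : separable 1 {:K}.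
  by apply/separableP => y _; exact: pcharf0_separable.
have genK : fullv = <<1; th>>%VS :> {vspace K}.
  by apply: eq_adjoin_separable_generator => //; exact: subvf.
have /polyOver1P[q qE] := minPolyOver 1%AS th.
have mq : q \is monic by rewrite -(map_monic (in_alg K)) -qE monic_minPoly.
have sq : separable_poly q by rewrite -(separable_map (in_alg K)) -qE; exact: separable_generatorP.
pose toC : {rmorphism rat -> algC} := ratr.
have [rs rsE] := closed_field_poly_normal (map_poly toC q).
rewrite (monicP _) ?map_monic // scale1r in rsE.
have Urs : uniq rs by rewrite -separable_prod_XsubC -rsE separable_map.
pose d := size rs.
have sqd : size q = d.+1.
  by rewrite -(size_map_poly toC) rsE size_prod_XsubC.
pose zs : 'rV[algC]_d := \row_(j < d) rs`_j.
pose V := Vandermonde d zs.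
have Vu : V \in unitmx.
  rewrite unitmxE det_Vandermonde unitfE; apply/prodf_neq0 => i _.
  apply/prodf_neq0 => j ij; rewrite !mxE subr_eq0 nth_uniq //.
  by rewrite gtn_eqF.
have /boolp.choice[N1 hN1] : forall ij : 'I_d * 'I_d, exists N : nat,
    (0 < N)%N /\ N%:R * invmx V ij.1 ij.2 \in Aint.
  by move=> ij; have [N] := Aint_multiple (invmx V ij.1 ij.2); exists N.
pose N := (\prod_ij N1 ij)%N.
have N0 : (0 < N)%N by apply: prodn_gt0 => ij; have [] := hN1 ij.
have NV i j : N%:R * invmx V i j \in Aint.
  rewrite /N (bigD1 (i, j)) //= natrM mulrAC rpredM ?rpred_nat //.
  by have [] := hN1 (i, j).
pose b (i : 'I_2) : K := if i == ord0 then th else N%:R^-1.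
exists 2, b => y [P mP rP].
have thb : th \in gen_ring b by have := gen_ringX b ord0.
have Nb : N%:R^-1 \in gen_ring b by have := gen_ringX b ord_max.
have [p sp yE] : exists2 p : {poly rat}, (size p <= d)%N & y = (map_poly (in_alg K) p).[th].
  have /polyOver1P[p pE] := Fadjoin_polyOver 1%AS th y.
  exists p; last by rewrite -pE Fadjoin_poly_eq // -genK memvf.
  rewrite -(size_map_poly (in_alg K)) -pE; apply: leq_trans (size_Fadjoin_poly _ _ _) _.
  by rewrite -ltnS -size_minPoly qE size_map_poly sqd.
(* z is a conjugate of [th]. As q divides the composite of P with p, the value p(z) satisfies the
   same monic integral equation as y. *)
have conj z : z \in rs -> (map_poly toC p).[z] \in Aint.
  move=> zrs; apply: (integralOver_int_Aint mP).
  pose H := (map_poly intr P : {poly rat}) \Po p.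
  have qH : q %| H.
    rewrite -(dvdp_map (in_alg K)) -qE minPoly_dvdp //.
      by apply/polyOver1P; exists H.
    rewrite /H map_comp_poly /root horner_comp -yE -map_poly_comp.
    by rewrite (eq_map_poly (g := intr)) // => c; exact: rmorph_int.
  have : root (map_poly toC H) z.
    have /dvdpP[w ->] : map_poly toC q %| map_poly toC H by rewrite dvdp_map.
    by rewrite rootM rsE root_prod_XsubC zrs orbT.
  rewrite /H map_comp_poly /root horner_comp -map_poly_comp.
  by rewrite (eq_map_poly (g := intr)) // => c; exact: rmorph_int.
have coefN i : (i < d)%N -> exists a : int, p`_i = a%:~R / N%:R.
  move=> id; pose cv : 'rV[algC]_d := \row_(i < d) toC p`_i.
  pose yv : 'rV[algC]_d := \row_(j < d) (map_poly toC p).[rs`_j].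
  have cvE : cv *m V = yv.
    apply/rowP => j; rewrite !mxE (horner_coef_wide _ (n := d)) ?size_map_poly //.
    by apply: eq_bigr => l _; rewrite !mxE coef_map.
  have cE : N%:R * toC p`_i \in Aint.
    have -> : toC p`_i = (yv *m invmx V) 0 (Ordinal id).
      by rewrite -cvE mulmxK // !mxE.
    rewrite mxE mulr_sumr rpred_sum // => j _; rewrite mulrCA rpredM //.
    by rewrite mxE conj // mem_nth.
  (* A rational algebraic integer is an integer. *)
  have cQ : N%:R * toC p`_i \in Crat by rewrite rpredM ?rpred_nat // Crat_rat.
  have /intrP[a aE] := Cint_rat_Aint cQ cE; exists a.
  have nz : (N%:R : rat) != 0 by rewrite pnatr_eq0 -lt0n.
  apply: (mulfI nz); rewrite mulrCA divff // mulr1; apply: (fmorph_inj toC).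
  by rewrite rmorphM rmorph_nat rmorph_int aE.
rewrite yE (horner_coef_wide _ (n := d)) ?size_map_poly // rpred_sum // => i _.
rewrite coef_map /=; have [a ->] := coefN i (ltn_ord i).
rewrite rpredM ?rpredX // -in_algE fmorph_div rmorph_int rmorph_nat.
by rewrite rpredM ?rpred_int.
Qed.

(** [p] is the least positive integer not invertible in [V]. An integer not divisible by [p] is a
    unit: otherwise its remainder modulo [p], a unit by minimality, would be in the maximal
    ideal. *)
Lemma nat_power_like (V : set K) : is_val_ring V -> (exists x, ~ V x) ->
  exists p : K, [/\ V p, ~ V p^-1 &
    forall c : rat, c != 0 -> exists n, power_like V p c%:A n].
Proof.
move=> hV [x0 nx0]; have sV := vr_sub hV.
have nat0 (m : nat) : (0 < m)%N -> (m%:R : K) != 0 by rewrite lt0n => m0; rewrite -(rmorph_nat (in_alg K)) fmorph_eq0 pnatr_eq0.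
pose Q m := (0 < m)%N && `[< ~ V (m%:R)^-1 >].
have [|p /andP[p0 /asboolP Vp'] pmin] := @ex_minnP Q.
  apply: contrapT => hQ; apply: nx0; apply: val_ring_full => // c.
  have inv m : (0 < m)%N -> V (m%:R)^-1.
    by move=> m0; apply: contrapT => nV; apply: hQ; exists m; rewrite /Q m0; apply/asboolP.
  rewrite in_alg_rat; apply: srM => //; first exact: sr_int.
  have := denq_gt0 c; case: (denq c) => // m m0; exact: inv.
exists p%:R; split=> //; first exact: sr_nat.
have unit m : (0 < m < p)%N -> V (m%:R)^-1.
  move=> /andP[m0 mp]; apply: contrapT => nV.
  by have := pmin m; rewrite /Q m0 leqNgt mp => /(_ _)/negP; apply => //; apply/asboolP.
have Vp : V p%:R by exact: sr_nat.
have hnat m : (0 < m)%N -> exists n, power_like V (p%:R : K) m%:R n.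
  elim/ltn_ind: m => m ih m0.
  have p1 : (1 < p)%N.
    rewrite ltn_neqAle p0 andbT; apply/eqP => p1; apply: Vp'.
    by rewrite -p1 invr1; exact: sr1.
  have [r0|r0] := posnP (m %% p)%N.
    have mE : m = ((m %/ p) * p)%N by rewrite {1}(divn_eq m p) r0 addn0.
    have q0 : (0 < m %/ p)%N by rewrite lt0n; apply: contraTneq m0 => q0; rewrite mE q0.
    have [n hn] := ih _ (ltn_Pdiv p1 m0) q0; exists (n + 1).
    by rewrite {1}mE natrM; apply: power_likeM => //; exact: power_like_unif.
  exists 0; apply: power_like_unit; first exact: sr_nat.
  apply: contrapT => nV; have mm : vr_max V (m%:R : K) by right.
  have mp : vr_max V (p%:R : K) by right.
  have ru : V ((m %% p)%:R)^-1 by apply: unit; rewrite r0 ltn_pmod.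
  have : vr_max V ((m %% p)%:R : K).
    have -> : (m %% p)%:R = m%:R - (m %/ p)%:R * p%:R :> K.
      by rewrite [in m%:R](divn_eq m p) natrD natrM addrC addKr.
    apply: vr_maxD => //; apply: vr_maxN => //; apply: vr_maxM => //; exact: sr_nat.
  by move=> [/eqP|//]; apply/negP; exact: nat0.
have hint (z : int) : z != 0 -> exists n, power_like V (p%:R : K) z%:~R n.
  have N1 : power_like V (p%:R : K) (-1) 0.
    by apply: power_like_unit; rewrite ?invrN ?invr1; apply: srN => //; exact: sr1.
  case: z => [m|m] z0; first by apply: hnat; case: m z0.
  have [n hn] := hnat m.+1 isT; exists (0 + n).
  by rewrite NegzE mulrNz -mulN1r; apply: power_likeM.
move=> c c0; have nc0 : numq c != 0 by rewrite numq_eq0.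
have [n hn] := hint (numq c) nc0.
have [m hm] := hint (denq c) (denq_neq0 c).
by exists (n - m); rewrite in_alg_rat; apply: power_likeM => //; exact: power_likeV.
Qed.

(** As for poles, with Z in place of the constants: if y is not integral, then y is outside Z[1/y],
    and a valuation ring containing Z[1/y] avoids y. *)
Lemma integral_of_valuations (y : K) :
  (forall v : K -> \bar int, discrete_valuation v -> (0 <= v y)%E) -> integral_elt y.
Proof.
move=> hy; apply: contrapT => nint.
have y0 : y != 0.
  apply: contra_notN nint => /eqP ->; exists 'X; first exact: monicX.
  by rewrite map_polyX rootX.
pose Z := [set z : K | exists c : int, z = c%:~R].
have sZ : is_subring Z.
  split=> [|_ _ [c ->] [d ->]|_ _ [c ->] [d ->]]; first by exists 1.
  - by exists (c - d); rewrite rmorphB.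
  - by exists (c * d); rewrite rmorphM.
have [||V [hV DV Vx']] := val_ring_exists (is_subring_poly sZ y^-1) (a := y^-1).
- exists 'X; last by rewrite hornerX.
  by move=> i; rewrite coefX; exists (i == 1%N)%:Z; case: (_ == _).
- move=> [P hP]; rewrite invrK => yE; apply: nint.
  have /boolp.choice[f fE] := hP; pose s := size P.
  (* Multiplying y = P(1/y) by y^s gives y^(s+1) as the sum of the f_i y^(s-i). *)
  pose q : {poly int} := 'X^(s.+1) - \sum_(i < s) f i *: 'X^(s - i).
  have sz : (size (\sum_(i < s) f i *: 'X^(s - i) : {poly int})%R < s.+2)%N.
    rewrite ltnS; apply: leq_trans (size_sum _ _ _) _; apply/bigmax_leqP => i _.
    apply: leq_trans (size_scale_leq _ _) _; rewrite size_polyXn ltnS; exact: leq_subr.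
  exists q.
    by rewrite monicE lead_coefDl ?size_polyN ?size_polyXn // lead_coefXn.
  rewrite rmorphB rmorph_sum /= map_polyXn /root !hornerE horner_sum subr_eq0; apply/eqP.
  rewrite exprS {1}yE horner_coef mulr_suml; apply: eq_bigr => i _.
  rewrite map_polyZ map_polyXn !hornerE fE -mulrA; congr (_ * _).
  have {1}-> : y ^+ s = y ^+ i * y ^+ (s - i) by rewrite -exprD subnKC // ltnW.
  by rewrite mulrA -exprMn mulVf // expr1n mul1r.
rewrite invrK in Vx'.
have [|p [Vp Vp' hp]] := nat_power_like hV; first by exists y.
have [v [hv vV]] := ext_discrete hV Vp Vp' hp.
by apply: Vx'; apply/vV; exact: hy.
Qed.

(** Some positive integer [N] has positive valuation at all finite places in [S], so N^M x is
    integral for large M. Adjoining 1/N to a finitely generated ring containing the integral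
    elements is then enough. *)
Lemma S_integers_fg (S : set (place K)) : finite_set S ->
  exists m (b : 'I_m -> K), forall x : S_integers S, S_val x \in gen_ring b.
Proof.
move=> finS; have [m [b hb]] := integral_fg.
pose f (w : place K) : option (K -> \bar int) :=
  if w is NonarchimedeanPlace v _ then Some v else None.
have /finite_seqP[s sE] := finite_image f finS.
have outS v (hv : discrete_valuation v) : Some v \notin s -> ~ S (NonarchimedeanPlace hv).
  move=> vs Sv; case/negP: vs.
  have : (f @` S) (Some v) by exists (NonarchimedeanPlace hv).
  by rewrite sE.
(* Otherwise all positive integers would be units and the valuation ring would contain Q, hence all
   of [K]. *)
have nn (v : K -> \bar int) (hv : discrete_valuation v) : exists n : nat, (0 < n)%N /\ 0 < ord_of v (n%:R).
  have hV := dv_ring_val_ring hv; have sV := vr_sub hV.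
  apply: contrapT => nex; have [x nx] := dv_ring_proper hv.
  suff full : forall c : rat, dv_ring v (c%:A : K) by case: nx; exact: (val_ring_full hV full x).
  move=> c; rewrite in_alg_rat; apply: srM => //; first exact: sr_int.
  have := denq_gt0 c; case: (denq c) => // n n0; apply: vr_unit; first exact: sr_nat.
  have nz : (n%:R : K) != 0 by rewrite -(rmorph_nat (in_alg K)) fmorph_eq0 pnatr_eq0 -lt0n.
  by move=> /(dv_maxP hv nz) h; apply: nex; exists n.
have natge v n : discrete_valuation v -> 0 <= ord_of v (n%:R : K).
  move=> hv; apply/(ord_ge0 hv); exact: sr_nat (vr_sub (dv_ring_val_ring hv)) n.
have nz n : (0 < n)%N -> (n%:R : K) != 0.
  by move=> n0; rewrite -(rmorph_nat (in_alg K)) fmorph_eq0 pnatr_eq0 -lt0n.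
have [N N0 NS] : exists2 N : nat, (0 < N)%N & forall v, discrete_valuation v ->
    Some v \in s -> 0 < ord_of v (N%:R : K).
  elim: {sE outS} s => [|w s [N N0 NS]]; first by exists 1%N.

  case: w => [v|]; last by exists N => // v hv; rewrite inE /= => /NS; exact.
  have [hv|nhv] := pselect (discrete_valuation v); last first.
    by exists N => // v' hv'; rewrite inE => /orP[/eqP[vv]|/NS]; [case: nhv; rewrite -vv|exact].
  have [n [n0 vn]] := nn v hv; exists (n * N)%N; first by rewrite muln_gt0 n0.
  move=> v' hv'; rewrite natrM (ordM hv') ?nz // inE => /orP[/eqP[->]|v's].
    by apply: ltr_wpDr => //; exact: natge.
  by apply: ltr_wpDl; [exact: natge|exact: NS].
pose c (i : 'I_(m + 1)) : K := match fintype.split i with inl i => b i | inr _ => N%:R^-1 end.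
have cb i : b i \in gen_ring c.
  by have := gen_ringX c (unsplit (inl i)); rewrite /c unsplitK.
have cN : N%:R^-1 \in gen_ring c.
  by have := gen_ringX c (unsplit (inr ord0)); rewrite /c unsplitK.
exists (m + 1)%N, c => -[x /= /asboolP hx].
have [x0|x0] := eqVneq x 0; first by rewrite x0 rpred0.
pose M := (\sum_(w <- s) if w is Some v then `|ord_of v x|%N else 0)%N.
suff : integral_elt (N%:R ^+ M * x).
  move=> /hb /(gen_ring_min cb) h.
  by rewrite -[x](mulKf (expf_neq0 M (nz _ N0))) rpredM // -exprVn rpredX.
apply: integral_of_valuations => v hv.
apply/(ord_ge0 hv); rewrite (ordM hv) ?expf_neq0 ?nz // (ordX hv) ?nz //.
have [vs|vs] := boolP (Some v \in s); last first.
  apply: addr_ge0; first by rewrite mulrn_wge0 // natge.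
  by apply/(ord_ge0 hv); exact: hx (outS v hv vs).
have Mv : (`|ord_of v x| <= M)%N.
  by rewrite /M; case/splitPr: vs => s1 s2; rewrite big_cat big_cons /=; lia.
have Nv := NS v hv vs.
have : 1 * M%:Z <= ord_of v (N%:R : K) * M%:Z by rewrite ler_wpM2r //; lia.
rewrite mulrn_int mul1r => h1.
have h2 : - M%:Z <= ord_of v x by lia.
by rewrite -(subrr M%:Z); exact: lerD.
Qed.

End NumberField.

(** * Affine schemes as functors of points *)

Section NonzeroPack.
Variables (A : comNzRingType) (R : algebra A).

(** The map [u] is the identity: the ring is repacked as a nonzero ring, where evaluation is [mmap].
    One [T] serves all base rings [B], so evaluations over different bases can be compared. *)
Lemma algebra_nonzero : (exists z : R, z <> 0) ->
  exists (T : comNzRingType) (u : R -> T), [/\ injective u, zmod_morphism u,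
    monoid_morphism u &
    forall (B : comNzRingType) (f : {rmorphism B -> A}), exists g : {rmorphism B -> T},
      (forall b, g b = u (alg_map R (f b))) /\
      forall n (x : 'I_n -> R) p,
        u (aeval (R := restrict_scalars f R) x p) = mmap g (u \o x) p].
Proof.
case: R => T h /= [z z0].
have T10 : (1 : T) != 0.
  by apply: contra_notN z0 => /eqP e; rewrite -[z]mul1r e mul0r.
pose T' : comNzRingType := HB.pack (T : Type) (GRing.ComPzRing.class T)
  (GRing.PzSemiRing_isNonZero.Build T T10).
exists T', (fun z => z); split=> // B f.
pose hf : B -> T' := fun b => h (f b).
have hf_zmod : zmod_morphism hf by move=> a b; rewrite /hf !rmorphB.
have hf_monoid : monoid_morphism hf by split=> [|a b]; rewrite /hf ?rmorph1 ?rmorphM.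
pose g : {rmorphism B -> T'} := HB.pack hf
  (GRing.isZmodMorphism.Build _ _ hf hf_zmod)
  (GRing.isMonoidMorphism.Build _ _ hf hf_monoid).
by exists g.
Qed.
End NonzeroPack.

Lemma mmap_map_mpoly (A B T : comNzRingType) n (f : {rmorphism B -> A})
    (g : {rmorphism A -> T}) (x : 'I_n -> T) (p : {mpoly B[n]}) :
  mmap g x (map_mpoly f p) = mmap (g \o f) x p.
Proof.
rewrite /map_mpoly [LHS](rmorph_mmap (@mpolyC n A \o f : {rmorphism _ -> _}) (mmap g x)).
by apply: eq_mmap => [c|i] /=; rewrite ?mmapC ?mmapX ?mmap1U.
Qed.

Section Aeval.
Variables (A : comNzRingType) (R : algebra A) (n : nat) (x : 'I_n -> R).

Lemma aeval_morphism :
  [/\ aeval x 0 = 0, forall p q, aeval x (p + q) = aeval x p + aeval x q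
    & forall p q, aeval x (p * q) = aeval x p * aeval x q].
Proof.
have [h|h] := pselect (exists z : R, z <> 0); last first.
  have z0 (z : R) : z = 0 by apply: contrapT => nz; apply: h; exists z.
  by split=> [|p q|p q]; rewrite [LHS]z0 ?[RHS]z0.
have [T [u [u_inj uZ uM hT]]] := algebra_nonzero h.
have [g [_ gE]] := hT A idfun; have {}gE p : u (aeval x p) = mmap g (u \o x) p := gE _ x p.
pose u' : {rmorphism R -> T} := HB.pack u (GRing.isZmodMorphism.Build _ _ u uZ)
  (GRing.isMonoidMorphism.Build _ _ u uM).
have uD a b : u (a + b) = u a + u b := rmorphD u' a b.
have uMu a b : u (a * b) = u a * u b := rmorphM u' a b.
have u0 : u 0 = 0 := rmorph0 u'.
by split=> *; apply: u_inj; rewrite ?uD ?uMu ?gE ?u0 ?rmorph0 ?rmorphD ?rmorphM.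
Qed.

Lemma aeval_map_mpoly (B : comNzRingType) (f : {rmorphism B -> A}) (p : {mpoly B[n]}) :
  aeval x (map_mpoly f p) = aeval (R := restrict_scalars f R) x p.
Proof.
have [h|h] := pselect (exists z : R, z <> 0); last first.
  have z0 (z : R) : z = 0 by apply: contrapT => nz; apply: h; exists z.
  by rewrite [LHS]z0 [RHS]z0.
have [T [u [u_inj uZ uM hT]]] := algebra_nonzero h.
have [g [gb gE]] := hT A idfun; have [g' [gb' gE']] := hT B f.
apply: u_inj; rewrite [LHS](gE n x (map_mpoly f p)) [RHS](gE' n x p).
rewrite mmap_map_mpoly; apply: eq_mmap => // c.
by rewrite gb' /= gb.
Qed.

Lemma aeval_ideal (B : set {mpoly A[n]}) : (forall p, B p -> aeval x p = 0) ->
  forall p, ideal_gen B p -> aeval x p = 0.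
Proof.
move=> hB _ [m [c [g [Bg ->]]]]; have [a0 aD aM] := aeval_morphism.
elim/big_ind: _ => // [p q p0 q0|i _]; first by rewrite aD p0 q0 addr0.
by rewrite aM (hB _ (Bg i)) mulr0.
Qed.

End Aeval.

(** * Gluing elements along localizations *)

Section Gluing.
Variables (A : comPzRingType) (R : algebra A) (m : nat) (f : 'I_m -> R).
Hypothesis f1 : ideal_gen (range f) 1.

(** The terms of 1 = a + sum of the d_i g_i are absorbed into [I] one at a time: with z = d_i g_i
    and w = 1 + z + ... + z^(q-1), one has 1 = (1 - z)w + z^q, where z^q is in [I] and 1 - z
    contains only the other terms. *)
Lemma unit_ideal_powers (I : set R) : (forall x y, I x -> I y -> I (x + y)) ->
  (forall x y, I y -> I (x * y)) -> I 0 ->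
  (forall i, exists k, I (f i ^+ k)) -> I 1.
Proof.
move=> ID IM I0 If; have [k [c [g [gf one]]]] := f1.
have {If} Ig i : exists k, I (g i ^+ k) by have [j _ <-] := gf i; exact: If.
suff main (s : seq 'I_k) (d : 'I_k -> R) a : I a -> 1 = a + \sum_(i <- s) d i * g i -> I 1.
  by apply: (main (index_enum _) c 0) => //; rewrite add0r.
elim: s d a => [|i s ih] d a Ia; first by rewrite big_nil addr0 => ->.
rewrite big_cons => e; have [q Iq] := Ig i.
pose z := d i * g i; pose w := \sum_(j < q) z ^+ j.
have zw : (1 - z) * w = 1 - z ^+ q by rewrite -[1 - z]opprB mulNr -subrX1 opprB.
apply: (ih (fun j => w * d j) (w * a + z ^+ q)).
  by apply: ID; [exact: IM|rewrite /z exprMn; exact: IM].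
transitivity ((1 - z) * w + z ^+ q); first by rewrite zw subrK.
have -> : 1 - z = a + \sum_(j <- s) d j * g j.
  apply/eqP; rewrite subr_eq; apply/eqP; rewrite [LHS]e -[RHS]addrA.
  by congr (_ + _); exact: addrC.
rewrite mulrC mulrDr [LHS]addrAC; congr (_ + _).
by rewrite mulr_sumr; apply: eq_bigr => j _; rewrite mulrA.
Qed.

Variables (S : 'I_m -> algebra A) (phi : forall i, alg_hom R (S i)).
Hypothesis loc : forall i, is_localization (f i) (phi i).

Lemma gluing_uniq (y : R) : (forall i, phi i y = 0) -> y = 0.
Proof.
move=> y0; rewrite -[y]mul1r.
apply: (@unit_ideal_powers [set a | a * y = 0]) => /= [a b aE bE|a b bE||i].
- by rewrite mulrDl aE bE addr0.
- by rewrite -mulrA bE mulr0.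
- exact: mul0r.
- by have [_ _ /(_ _ (y0 i))] := loc i.
Qed.

Variables (T : 'I_m -> 'I_m -> algebra A)
  (l : forall i j, alg_hom (S i) (T i j)) (r : forall i j, alg_hom (S j) (T i j)).
Hypothesis loc2 : forall i j, is_localization (f i * f j) (l i j \o phi i).
Hypothesis lr : forall i j, l i j \o phi i =1 r i j \o phi j.

(** The elements a such that the family a s_i comes from [R] form an ideal. It contains a power of
    each f_j: s_j has a denominator f_j^k, and a further power, uniform in i, makes the numerator
    fit the other s_i. *)
Lemma gluing (s : forall i, S i) : (forall i j, l i j (s i) = r i j (s j)) ->
  exists y : R, forall i, phi i y = s i.
Proof.
move=> agree.
suff [y hy] : [set a | exists y, forall i, phi i a * s i = phi i y] 1.
  by exists y => i; rewrite -hy rmorph1 mul1r.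
apply: unit_ideal_powers => /= [a b [y ya] [z zb]|a b [z zb]||j].
- by exists (y + z) => i; rewrite !rmorphD mulrDl ya zb.
- by exists (a * z) => i; rewrite !rmorphM -mulrA zb.
- by exists 0 => i; rewrite !rmorph0 mul0r.
have [_ /(_ (s j))[a [k ak]] _] := loc j.
(* The difference [d] dies on the overlap, so up to a power of f_i it is killed by a power of f_i
   f_j; f_i is invertible in [S i]. *)
have kill i : exists M, phi i (f j) ^+ M * (phi i (f j ^+ k) * s i - phi i a) = 0.
  set d := _ - _; have [[t ft] den _] := loc i; have [b [q dE]] := den d.
  have [_ _ ker] := loc2 i j.
  have ld : l i j d = 0.
    rewrite /d rmorphB rmorphM agree.
    have -> : l i j (phi i (f j ^+ k)) = r i j (phi j (f j ^+ k)) by exact: lr.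
    have -> : l i j (phi i a) = r i j (phi j a) by exact: lr.
    by rewrite -rmorphM rmorphXn mulrC ak subrr.
  have [|M hM] := ker b; first by rewrite /= -dE rmorphM ld mul0r.
  exists M; have := congr1 (phi i) hM; rewrite rmorphM rmorphXn rmorphM rmorph0 -dE exprMn => e.
  transitivity ((phi i (f i) ^+ M * phi i (f j) ^+ M * (d * phi i (f i) ^+ q)) * t ^+ (M + q)).
    have tq N : phi i (f i) ^+ N * t ^+ N = 1 by rewrite -exprMn ft expr1n.
    transitivity ((phi i (f j) ^+ M * d) * (phi i (f i) ^+ M * t ^+ M) * (phi i (f i) ^+ q * t ^+ q)).
      by rewrite !tq !mulr1.
    by rewrite exprD; ring.
  by rewrite e mul0r.
have /boolp.choice[M hM] := kill.
pose N := (\sum_i M i)%N; exists (N + k)%N, (f j ^+ N * a) => i.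
have NE : N = (N - M i + M i)%N by rewrite subnK // /N (bigD1 i) //= leq_addr.
apply/eqP; rewrite -subr_eq0; apply/eqP.
transitivity (phi i (f j) ^+ N * (phi i (f j ^+ k) * s i - phi i a)).
  by rewrite mulrBr mulrA -!rmorphXn -!rmorphM -exprD.
by rewrite NE exprD -mulrA hM mulr0.
Qed.

End Gluing.

Lemma eq_zeros (A : comNzRingType) n (J : set {mpoly A[n]}) (R : algebra A) (x y : zeros J R) :
  sval x =1 sval y -> x = y.
Proof. by case: x y => [x xJ] [y yJ] /= xy; apply: eq_exist; apply: funext. Qed.

Section ClosedSubscheme.
Variables (A : comNzRingType) (n : nat) (J : set {mpoly A[n]}).

Lemma closed_subscheme_sheaf : zariski_sheaf (closed_subscheme J).
Proof.
move=> R m f f1 S phi T l r loc loc2 lr x agree.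
have agr k i j : l i j (sval (x i) k) = r i j (sval (x j) k).
  by have /(congr1 sval)/(congr1 (fun g => g k)) := agree i j.
have /boolp.choice[y yE] : forall k, exists y : R, forall i, phi i y = sval (x i) k.
  by move=> k; exact: (gluing f1 loc loc2 lr (agr k)).
have yJ p : J p -> aeval y p = 0.
  move=> Jp; apply: (gluing_uniq f1 loc) => i; rewrite aeval_hom.
  rewrite -[RHS](svalP (x i) p Jp); congr (aeval _ _).
  by apply: funext => k; exact: yE.
exists (exist _ y yJ); split=> [i|z zE]; first by apply: eq_zeros => k; exact: yE.
apply: eq_zeros => k /=; apply/eqP; rewrite -subr_eq0; apply/eqP.
apply: (gluing_uniq f1 loc) => i; rewrite rmorphB yE -(zE i) subrr //.
Qed.

Lemma closed_subscheme_scheme : finite_type_separated_scheme (closed_subscheme J).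
Proof.
split; first exact: closed_subscheme_sheaf.
- exists 1%N, (fun _ => n), (fun _ => J), (fun _ R x => x); split=> [_|K s x]; last first.
    by exists ord0, x.
  split=> [//|R x y //|R x]; exists [set: R] => S phi; split=> [_|_]; last by exists (zeros_map phi x).
  exists 1%N, (fun _ => 1), (fun _ => 1); split=> [_|].
    by exists 1; rewrite ?rmorph1.
  by rewrite big_ord1 mulr1.
- move=> R x y; exists [set sval x k - sval y k | k in setT] => S phi; split.
    move=> /(congr1 sval) xy _ [k _ <-].
    by rewrite rmorphB -[phi (sval x k)]/((phi \o sval x) k) [_ \o _]xy subrr.
  move=> h; apply: eq_zeros => k /=; apply/eqP; rewrite -subr_eq0 -rmorphB.
  by apply/eqP/h; exists k.
Qed.

Lemma closed_subscheme_model (k M : closedFieldType) (I : set {mpoly k[n]}) (s : {rmorphism k -> M})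
    (iota : {rmorphism A -> M}) (O : comNzRingType) (J0 : set {mpoly O[n]})
    (h : {rmorphism O -> k}) (g : {rmorphism O -> A}) :
  iota \o g =1 s \o h ->
  I = ideal_gen [set map_mpoly h p | p in J0] ->
  J = [set map_mpoly g p | p in J0] ->
  is_model iota (closed_subscheme J) (base_change s (closed_subscheme I)).
Proof.
move=> gh IE JE; split; first exact: closed_subscheme_scheme.
have eqv (R : algebra M) (x : 'I_n -> R) :
    (forall p, J p -> aeval (R := restrict_scalars iota R) x p = 0) <->
    (forall p, I p -> aeval (R := restrict_scalars s R) x p = 0).
  have mapE p : aeval (R := restrict_scalars iota R) x (map_mpoly g p) =
       aeval (R := restrict_scalars s R) x (map_mpoly h p).
    rewrite !aeval_map_mpoly /aeval /=; apply: eq_bigr => q _; congr (alg_map R _ * _).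
    exact: gh.
  split=> [hJ p|hI p]; last first.
    rewrite JE => -[q Jq <-]; rewrite mapE; apply: hI; rewrite IE.
    exists 1%N, (fun=> 1), (fun=> map_mpoly h q); split=> [_|]; first by exists q.
    by rewrite big_ord1 mul1r.
  rewrite IE; apply: aeval_ideal => _ [q Jq <-]; rewrite -mapE; apply: hJ.
  by rewrite JE; exists q.
exists (fun R (x : zeros J (restrict_scalars iota R)) =>
  exist _ (sval x) ((eqv R (sval x)).1 (svalP x))); split.
  by move=> R S f x; apply: eq_exist.
move=> R; exists (fun y : zeros I (restrict_scalars s R) =>
  exist _ (sval y) ((eqv R (sval y)).2 (svalP y))) => z; by apply: eq_zeros.
Qed.
End ClosedSubscheme.

(** * Quotient rings *)

Section Quotients.
Variable P : comNzRingType.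

Record is_ideal (C : set P) : Prop := IsIdeal {
  ideal0 : C 0;
  idealD : forall x y, C x -> C y -> C (x + y);
  idealM : forall a x, C x -> C (a * x) }.

Lemma ideal_gen_ideal (B : set P) : is_ideal (ideal_gen B).
Proof.
split=> [|x y [m [c [g [Bg ->]]]] [m' [c' [g' [Bg' ->]]]]|a x [m [c [g [Bg ->]]]]].
- by exists 0%N, (fun _ => 0), (fun _ => 0); rewrite big_ord0; split=> // -[].
- pose d (i : 'I_(m + m')) := match fintype.split i with inl i => c i | inr i => c' i end.
  pose h (i : 'I_(m + m')) := match fintype.split i with inl i => g i | inr i => g' i end.
  exists (m + m')%N, d, h; split=> [i|]; first by rewrite /h; case: fintype.split.
  rewrite big_split_ord; congr (_ + _); apply: eq_bigr => i _.
    by rewrite /d /h -[lshift _ i]/(unsplit (inl i)) unsplitK.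
  by rewrite /d /h -[rshift _ i]/(unsplit (inr i)) unsplitK.
- exists m, (fun i => a * c i), g; split=> //.
  by rewrite mulr_sumr; apply: eq_bigr => i _; rewrite mulrA.
Qed.

Lemma ideal_gen_sub (B : set P) b : B b -> ideal_gen B b.
Proof.
by move=> Bb; exists 1%N, (fun=> 1), (fun=> b); split=> //; rewrite big_ord1 mul1r.
Qed.

Lemma ideal_gen_min (B C : set P) : is_ideal C -> B `<=` C -> ideal_gen B `<=` C.
Proof.
move=> hC BC _ [m [c [g [Bg ->]]]]; apply: (big_ind C) => [||i _].
- exact: ideal0.
- exact: idealD.
- by apply: idealM => //; exact: BC.
Qed.

Lemma quotient_exists (C : set P) : is_ideal C -> ~ C 1 ->
  exists (Q : comNzRingType) (pi : {rmorphism P -> Q}),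
    (forall q, exists p, pi p = q) /\ forall p, pi p = 0 <-> C p.
Proof.
move=> hC C1; pose S : P -> bool := fun x => `[< C x >].
have Scl : idealr_closed S.
  split=> [||a u w /asboolP hu /asboolP hw]; rewrite ?unfold_in; first by apply/asboolP; exact: ideal0.
    by apply/asboolP.
  by apply/asboolP; apply: idealD => //; exact: idealM.
pose I : idealr P := HB.pack S (isIdealr.Build P S Scl).
exists {ideal_quot I}, (\pi_{ideal_quot I})%qT; split=> [q|p]; first by exists (repr q); exact: reprK.
have -> : ((\pi_{ideal_quot I})%qT p = 0) <-> (p \in I).
  rewrite -[p in p \in I]subr0 Quotient.idealrBE -(rmorph0 (\pi_{ideal_quot I})%qT).
  by split=> [->|/eqP].
by split=> /asboolP.
Qed.

Lemma quotient_lift (Q : comNzRingType) (pi : {rmorphism P -> Q}) (T : pzRingType)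
    (g : {rmorphism P -> T}) :
  (forall q, exists p, pi p = q) -> (forall p, pi p = 0 -> g p = 0) ->
  exists h : {rmorphism Q -> T}, forall p, h (pi p) = g p.
Proof.
move=> /boolp.choice[sec secK] ker.
have wd p p' : pi p = pi p' -> g p = g p'.
  by move=> e; apply/eqP; rewrite -subr_eq0 -rmorphB ker // rmorphB e subrr.
pose h q := g (sec q).
have hE p : h (pi p) = g p by apply: wd; rewrite secK.
have hz : zmod_morphism h.
  by move=> x y; rewrite /h -rmorphB; apply: wd; rewrite rmorphB !secK.
have hm : monoid_morphism h.
  split=> [|x y]; first by rewrite /h -(rmorph1 g); apply: wd; rewrite secK rmorph1.
  by rewrite /h -rmorphM; apply: wd; rewrite rmorphM !secK.
pose h' : {rmorphism Q -> T} := HB.pack h (GRing.isZmodMorphism.Build _ _ h hz)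
  (GRing.isMonoidMorphism.Build _ _ h hm).
by exists h'.
Qed.

Lemma maximal_ideal_exists (C : set P) : is_ideal C -> ~ C 1 ->
  exists D : set P, [/\ is_ideal D, C `<=` D, ~ D 1 &
    forall E, is_ideal E -> D `<=` E -> ~ E 1 -> E `<=` D].
Proof.
move=> hC C1.
(* As for subrings, the union with [C] takes care of the empty chain. *)
pose Z (D : set P) := is_ideal (D `|` C) /\ ~ (D `|` C) 1.
have [F FZ Ftot|A [[A1 A2] Amax]] := @Zorn_bigcup P Z.
  split; last by move=> [[X FX X1]|//]; have [_ []] := FZ _ FX; left.
  split=> [|x y hx hy|a x [[X FX Xx]|Cx]].
  - by right; exact: ideal0.
  - have lift X w : F X -> (X `|` C) w -> (\bigcup_(X in F) X `|` C) w.
      by move=> FX [Xw|Cw]; [left; exists X|right].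
    case: hx hy => [[X FX Xx]|Cx] [[Y FY Yy]|Cy].
    + have [[hX _] [hY _]] := (FZ _ FX, FZ _ FY).
      have [XY|YX] := Ftot _ _ FX FY.
        by apply: (lift Y) => //; apply: (idealD hY); left => //; exact: XY.
      by apply: (lift X) => //; apply: (idealD hX); left => //; exact: YX.
    + by have [hX _] := FZ _ FX; apply: (lift X) => //; apply: (idealD hX); [left|right].
    + by have [hY _] := FZ _ FY; apply: (lift Y) => //; apply: (idealD hY); [right|left].
    + by right; exact: idealD.
  - have [hX _] := FZ _ FX.
    by have [|] := idealM hX a (x := x) (or_introl Xx); [left; exists X|right].
  - by right; exact: idealM.
exists (A `|` C); split=> // E hE DE E1 z Ez.
apply: contrapT => nz; have CE : E `|` C = E.
  by apply/seteqP; split=> [w [//|Cw]|w]; [apply: DE; right|left].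
apply: (Amax E); last by rewrite /Z CE.
by split=> [w Aw|h]; [apply: DE; left|apply: nz; left; exact: h].
Qed.

(** An atlas is required to cover only points in fields; a proper ideal gives such a point. *)
Lemma residue_field_exists (C : set P) : is_ideal C -> ~ C 1 ->
  exists (K : fieldType) (pi : {rmorphism P -> K}), forall p, C p -> pi p = 0.
Proof.
move=> hC C1; have [D [hD CD D1 Dmax]] := maximal_ideal_exists hC C1.
have [Q [pi [surj ker]]] := quotient_exists hD D1.
have inv (q : Q) : exists q', (q != 0 -> q' * q = 1) /\ (q = 0 -> q' = 0).
  have [->|q0] := eqVneq q 0; first by exists 0.
  have [p pE] := surj q.
  have np : ~ D p by move=> /ker p0; case/eqP: q0; rewrite -pE p0.
  pose E := [set x | exists a d, D d /\ x = a * p + d].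
  have hE : is_ideal E.
    split=> [|x y [a [d [Dd ->]]] [b [d' [Dd' ->]]]|c x [a [d [Dd ->]]]].
    - by exists 0, 0; split; [exact: ideal0|rewrite mul0r addr0].
    - by exists (a + b), (d + d'); split; [exact: idealD|rewrite mulrDl addrACA].
    - by exists (c * a), (c * d); split; [exact: idealM|rewrite mulrDr mulrA].
  have E1 : E 1.
    apply: contrapT => nE1; apply: np; apply: (Dmax E) => // [w Dw|].
      by exists 0, w; rewrite mul0r add0r.
    by exists 1, 0; split; [exact: ideal0|rewrite mul1r addr0].
  have [a [d [Dd e]]] := E1; exists (pi a); split=> [_|/eqP]; last by rewrite (negbTE q0).
  by rewrite -pE -rmorphM -[LHS]addr0 -(proj2 (ker d) Dd) -rmorphD -e rmorph1.
have /boolp.choice[iv ivE] := inv.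
have mulVf x : x != 0 -> iv x * x = 1 by have [] := ivE x.
have iv0 : iv 0 = 0 by have [_ ->] := ivE 0.
pose K : fieldType := HB.pack (Q : Type) (GRing.ComNzRing.class Q)
  (GRing.ComNzRing_isField.Build Q mulVf iv0).
exists K, (pi : {rmorphism P -> K}) => p Cp.
by apply/ker; exact: CD.
Qed.

End Quotients.

(** * Spreading out *)

Lemma meval_in (k : comNzRingType) n (H : subringClosed k) (x : 'I_n -> k) (p : {mpoly k[n]}) :
  (forall m, m \in msupp p -> mcoeff m p \in H) -> (forall i, x i \in H) -> meval x p \in H.
Proof.
move=> pH xH; rewrite mevalE big_seq; apply: rpred_sum => m mp.
by apply: rpredM; [exact: pH|apply: rpred_prod => i _; exact: rpredX].
Qed.

Definition gen_ring_seq (k : comNzRingType) (s : seq k) : subringClosed k :=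
  gen_ring (fun i : 'I_(size s) => s`_i).

Lemma gen_ring_seq_mem (k : comNzRingType) (s : seq k) z : z \in s -> z \in gen_ring_seq s.
Proof.
move=> zs; have iz : (index z s < size s)%N by rewrite index_mem.
by have := gen_ringX (fun i : 'I_(size s) => s`_i) (Ordinal iz); rewrite /= nth_index.
Qed.

Lemma mmap_mpolyX (k : comNzRingType) n (p : {mpoly k[n]}) :
  mmap (@mpolyC n k) (fun i => mpolyX _ (mnm1 i)) p = p.
Proof.
rewrite {2}(mpolyE p) /mmap; apply: eq_bigr => m _.
by rewrite mmap1_id mul_mpolyC.
Qed.

Section SubringAlgebra.
Variables (k : fieldType) (B : comNzRingType) (iotaB : {rmorphism B -> k}).

Definition self_alg : algebra k := @Algebra k k idfun.
Definition base_alg : algebra B := restrict_scalars iotaB self_alg.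

Variable H : subringClosed k.
Hypothesis hB : forall b, iotaB b \in H.

Definition sub_alg : algebra B := @Algebra B (subring H) (to_subring hB).
Definition sub_val : alg_hom sub_alg base_alg :=
  @AlgHom B sub_alg base_alg (val : subring H -> k) (fun b => erefl).
End SubringAlgebra.

Section SubAlgIncl.
Variables (k : fieldType) (B : comNzRingType) (iotaB : {rmorphism B -> k}).
Variables (G H : subringClosed k) (GH : {subset G <= H}).
Variables (gB : forall b, iotaB b \in G) (hB : forall b, iotaB b \in H).

Lemma sub_alg_incl_struct b :
  subring_incl GH (alg_map (sub_alg gB) b) = alg_map (sub_alg hB) b.
Proof. exact: val_inj. Qed.

Definition sub_alg_incl : alg_hom (sub_alg gB) (sub_alg hB) :=
  @AlgHom B (sub_alg gB) (sub_alg hB) (subring_incl GH) sub_alg_incl_struct.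
End SubAlgIncl.

Section Localization.
Variables (k : fieldType) (H : subringClosed k) (f : k) (fH : f \in H).

(** The localization H[1/f], realized inside k. *)
Definition loc_ring of f \in H : {pred k} := fun z => `[< exists m : nat, z * f ^+ m \in H >].

Lemma loc_ring_subring : subring_closed (loc_ring fH).
Proof.
split=> [|z w /asboolP[m zm] /asboolP[q wq]|z w /asboolP[m zm] /asboolP[q wq]].
- by apply/asboolP; exists 0%N; rewrite mulr1 rpred1.
- apply/asboolP; exists (m + q)%N.
  have -> : (z - w) * f ^+ (m + q) = (z * f ^+ m) * f ^+ q - (w * f ^+ q) * f ^+ m.
    by rewrite exprD mulrBl mulrA [w * _]mulrCA [f ^+ m * _]mulrC.
  by apply: rpredB; apply: rpredM => //; exact: rpredX.
- by apply/asboolP; exists (m + q)%N; rewrite exprD mulrACA rpredM.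
Qed.
HB.instance Definition _ := GRing.isSubringClosed.Build k (loc_ring fH) loc_ring_subring.

Lemma sub_loc_ring : {subset H <= loc_ring fH}.
Proof. by move=> z zH; apply/asboolP; exists 0%N; rewrite mulr1. Qed.

Lemma loc_ring_inv : f != 0 -> f^-1 \in loc_ring fH.
Proof. by move=> f0; apply/asboolP; exists 1%N; rewrite mulVf // rpred1. Qed.

Lemma loc_ring_localization (L : subringClosed k) (phi : subring H -> subring L)
    (f' : subring H) :
  (forall z, subring_val (phi z) = subring_val z) -> L =i loc_ring fH ->
  subring_val f' = f -> f != 0 -> is_localization f' phi.
Proof.
move=> phiE LE f'E f0; split.
- have fL : f^-1 \in L by rewrite LE loc_ring_inv.
  by exists (Subring fL); apply: val_inj; rewrite /= phiE f'E mulfV.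
- case=> z zL; have := zL; rewrite LE => /asboolP[m zm].
  exists (Subring zm), m; apply: val_inj.
  by rewrite [LHS]rmorphM (rmorphXn (val : subring L -> k)) /= !phiE f'E.
- move=> a a0; exists 0%N; rewrite expr0 mul1r; apply: val_inj.
  by rewrite /= -phiE a0.
Qed.
End Localization.

Section Spreading.
Variables (k : closedFieldType) (n : nat) (I : set {mpoly k[n]}).
Variables (B : comNzRingType) (iotaB : {rmorphism B -> k}) (XB : alg_functor B).
Hypotheses (XB_sheaf : zariski_sheaf XB) (XB_atlas : finite_type_atlas XB)
  (XB_sep : separated_functor XB).
Variable e : forall R : algebra k, base_change iotaB XB R -> closed_subscheme I R.
Hypotheses (e_nat : natural e) (e_bij : forall R, bijective (e (R := R))).
Local Notation P := {mpoly k[n]}.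

Local Notation Ck := (self_alg k).

Definition point_of (H : subringClosed k) (hB : forall b, iotaB b \in H)
    (z : XB (sub_alg hB)) : 'I_n -> k :=
  sval (e (R := Ck) (Defs.fmap XB (sub_val hB : alg_hom _ (restrict_scalars iotaB Ck)) z)).

Definition zero_of (x : 'I_n -> k) := forall p, I p -> meval x p = 0.

(** The constants [cs] depend on [G] only, and must serve all subrings and all points at which [G]
    becomes invertible. *)
Definition section_ok (G : P) := exists cs : seq k,
  forall (H : subringClosed k) (hB : forall b, iotaB b \in H) (x : 'I_n -> k),
    {subset cs <= H} -> (forall i, x i \in H) -> zero_of x ->
    meval x G != 0 -> (meval x G)^-1 \in H ->
    exists z : XB (sub_alg hB), point_of z = x.

Section Universal.
Variables (Q : comNzRingType) (pi : {rmorphism P -> Q}).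
Hypotheses (pi_surj : forall q, exists p, pi p = q)
  (pi_ker : forall p, pi p = 0 <-> ideal_gen I p).

Definition cQ : {rmorphism k -> Q} := pi \o @mpolyC n k.
Definition Qa : algebra k := @Algebra k Q cQ.

Lemma univ_zeros p : I p ->
  aeval (R := Qa) (fun i => pi (mpolyX _ (mnm1 i))) p = 0.
Proof.
move=> Ip.
transitivity (pi (mmap (@mpolyC n k) (fun i => mpolyX _ (mnm1 i)) p)).
  by rewrite rmorph_mmap.
by rewrite mmap_mpolyX; apply/pi_ker; exact: ideal_gen_sub.
Qed.

(** The tautological point of the affine scheme over its own coordinate ring. Every k-point is its
    image under an evaluation, so what is computed for its preimage [w] holds for all points. *)
Definition univ : closed_subscheme I Qa := exist _ _ univ_zeros.

Lemma eval_exists (x : 'I_n -> k) : zero_of x ->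
  exists ev : alg_hom Qa Ck, forall p, ev (pi p) = meval x p.
Proof.
move=> hx; have [h hE] : exists h : {rmorphism Q -> k}, forall p, h (pi p) = meval x p.
  apply: quotient_lift => // p /pi_ker.
  apply: (@ideal_gen_min _ I [set p | meval x p = 0]); last exact: hx.
  split=> [|p1 p2 /= e1 e2|a p1 /= e1]; rewrite /= ?meval0 ?mevalD ?mevalM ?e1 ?e2 ?addr0 //.
  by rewrite mulr0.
have hs a : h (alg_map Qa a) = alg_map Ck a by rewrite /= hE mevalC.
by exists (@AlgHom k Qa Ck h hs).
Qed.

Variable w : base_change iotaB XB Qa.
Hypothesis wE : e w = univ.

Lemma point_of_univ (x : 'I_n -> k) (ev : alg_hom Qa Ck) :
  (forall p, ev (pi p) = meval x p) ->
  sval (e (R := Ck) (Defs.fmap XB (restrict_hom iotaB ev) w)) = x.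
Proof.
move=> evE; have -> := e_nat ev w; rewrite wE; apply: funext => i.
by rewrite /= evE mevalXU.
Qed.

(** Over Q[1/G] the point [w] lies in the chart, and its chart coordinates are polynomials in the
    variables and 1/G. Their coefficients are the constants: at a point over [H] with 1/G(x) in [H],
    these coordinates are in [H]. *)
Lemma chart_section_ok (N : nat) (Jc : set {mpoly B[N]})
    (ec : forall R, closed_subscheme Jc R -> XB R) (a : set Q) (G : P) :
  natural ec ->
  (forall (S : algebra B) (phi : alg_hom (restrict_scalars iotaB Qa) S),
     range (ec S) (Defs.fmap XB phi w) <-> ideal_gen (phi @` a) 1) ->
  a (pi G) -> section_ok G.
Proof.
move=> ec_nat ec_open aG.
(* If [G] vanishes at all points there is nothing to lift; otherwise Q[1/G] is nonzero. *)
have [[x0 [hx0 Gx0]]|nx0] := pselect (exists x0, zero_of x0 /\ meval x0 G != 0); last first.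
  by exists [::] => H hB x _ _ hx Gx; case: nx0; exists x.
(* Q[1/G] is presented as Q[Y]/(GY - 1). *)
pose B2 : set {poly Q} := [set (pi G)%:P * 'X - 1].
have kill (x : 'I_n -> k) (ev : alg_hom Qa Ck) : (forall p, ev (pi p) = meval x p) ->
    meval x G != 0 -> forall p, ideal_gen B2 p ->
    (map_poly (ev : {rmorphism Q -> k}) p).[(meval x G)^-1] = 0.
  move=> evE Gx.
  apply: (@ideal_gen_min _ B2 [set p |
    (map_poly (ev : {rmorphism Q -> k}) p).[(meval x G)^-1] = 0]); last first.
    move=> _ ->; rewrite /= rmorphB rmorphM /= map_polyC map_polyX rmorph1 !hornerE.
    by rewrite /= evE mulfV // subrr.
  split=> [|p1 p2 /= e1 e2|p p1 /= e1].
  - by rewrite /= rmorph0 horner0.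
  - by rewrite rmorphD hornerD e1 e2 addr0.
  - by rewrite rmorphM hornerM e1 mulr0.
have [ev0 ev0E] := eval_exists hx0.
have B21 : ~ ideal_gen B2 1.
  move=> /(kill x0 ev0 ev0E Gx0) /eqP; rewrite rmorph1 hornerC.
  by rewrite oner_eq0.
have [Q2 [pi2 [pi2_surj pi2_ker]]] := quotient_exists (ideal_gen_ideal B2) B21.
pose Q2a : algebra k := @Algebra k Q2 (pi2 \o (@polyC Q \o cQ)).
pose phi : alg_hom Qa Q2a := @AlgHom k Qa Q2a (pi2 \o @polyC Q) (fun a => erefl).
have [|y2 _ y2E] := proj2 (ec_open _ (restrict_hom iotaB phi)).
  exists 1%N, (fun=> pi2 'X), (fun=> phi (pi G)); split=> [_|]; first by exists (pi G).
  rewrite big_ord1 /= -rmorphM mulrC; apply/esym/eqP; rewrite -subr_eq0 -(rmorph1 pi2) -rmorphB.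
  by apply/eqP/pi2_ker; exact: ideal_gen_sub.
have /boolp.choice[Z ZE] : forall l, exists Z : {poly P}, pi2 (map_poly pi Z) = sval y2 l.
  move=> l; have [q qE] := pi2_surj (sval y2 l).
  have /boolp.choice[sec secK] := pi_surj.
  exists (\poly_(i < size q) sec q`_i); rewrite -qE; congr (pi2 _).
  apply/polyP => i; rewrite coef_map coef_poly; case: ltnP => iq /=; first exact: secK.
  by rewrite rmorph0 nth_default.
pose cs := flatten [seq flatten [seq [seq mcoeff m p | m <- msupp p] | p <- Z l : seq P] | l <- enum 'I_N].
exists cs => H hB x csH xH hx Gx GxH.
have [ev evE] := eval_exists hx.
have [psi psiE] : exists psi : {rmorphism Q2 -> k}, forall p,
    psi (pi2 p) = (map_poly (ev : {rmorphism Q -> k}) p).[(meval x G)^-1].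
  apply: (quotient_lift (g := horner_eval (meval x G)^-1 \o map_poly (ev : {rmorphism Q -> k})
    : {rmorphism {poly Q} -> k})) => // p /pi2_ker; exact: kill.
have psis c : psi (alg_map Q2a c) = alg_map Ck c.
  rewrite /= psiE map_polyC hornerC /=; exact: (hom_struct ev c).
pose psia : alg_hom Q2a Ck := @AlgHom k Q2a Ck psi psis.
pose y : zeros Jc (restrict_scalars iotaB Ck) := zeros_map (restrict_hom iotaB psia) y2.
have yH l : sval y l \in H.
  have -> : sval y l = (map_poly (meval x) (Z l)).[(meval x G)^-1].
    rewrite /= -ZE psiE -map_poly_comp; congr (_.[_]); apply: eq_map_poly => p; exact: evE.
  apply: rpred_horner => //; apply/polyOverP => i; rewrite coef_map /=.
  apply: meval_in => // m mZ; apply: csH; apply/flattenP.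
  eexists; first by apply/mapP; exists l; [rewrite mem_enum|reflexivity].
  apply/flattenP; exists [seq mcoeff m' (Z l)`_i | m' <- msupp (Z l)`_i]; last first.
    by apply/mapP; exists m.
  apply/mapP; exists (Z l)`_i => //; apply: mem_nth.
  by rewrite ltnNge; apply/negP => iZ; move: mZ; rewrite nth_default // msupp0.
pose z0 l : sub_alg hB := Subring (yH l).
have z0J p : Jc p -> aeval z0 p = 0.
  move=> Jp; apply: val_inj; rewrite [LHS](aeval_hom (sub_val hB)).
  exact: (svalP y p Jp).
pose z1 : closed_subscheme Jc (sub_alg hB) := exist _ z0 z0J.
exists (ec _ z1); rewrite -(point_of_univ evE) /point_of.
suff -> : Defs.fmap XB (sub_val hB : alg_hom _ (restrict_scalars iotaB Ck)) (ec _ z1) =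
    Defs.fmap XB (restrict_hom iotaB ev) w by [].
rewrite -ec_nat.
have -> : Defs.fmap (closed_subscheme Jc) (sub_val hB : alg_hom _ (restrict_scalars iotaB Ck)) z1
    = Defs.fmap (closed_subscheme Jc) (restrict_hom iotaB psia) y2 by apply: eq_zeros.
rewrite ec_nat y2E -(@Defs.fmap_comp _ XB _ _ _ _ _ (restrict_hom iotaB ev)) //.
move=> q /=; have [p <-] := pi_surj q.
by rewrite psiE map_polyC hornerC.
Qed.

(** If the admissible [G] generated a proper ideal, a point in a field would kill them all. It lies
    in some chart, whose open condition says that the elements cutting it out generate the unit
    ideal; but those are admissible. *)
Lemma section_partition : exists (N : nat) (C G : 'I_N -> P),
  (forall j, section_ok (G j)) /\
  forall x, zero_of x -> \sum_j meval x (C j) * meval x (G j) = 1.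
Proof.
pose B0 : set Q := [set g | exists G, pi G = g /\ section_ok G].
have [m [nn [JJ [ee [ee_open ee_cover]]]]] := XB_atlas.
have : ideal_gen B0 1.
  apply: contrapT => nB0.
  have [K [piK killK]] := residue_field_exists (ideal_gen_ideal B0) nB0.
  pose s : {rmorphism B -> K} := piK \o (cQ \o iotaB).
  pose phi : alg_hom (restrict_scalars iotaB Qa) (@Algebra B K s) :=
    @AlgHom B (restrict_scalars iotaB Qa) (@Algebra B K s) piK (fun _ => erefl).
  have [i ri] := ee_cover K s (Defs.fmap XB phi w).
  have [inat _ /(_ _ w)[a aP]] := ee_open i.
  move/(aP _ phi): ri => [q [c [g [ga one]]]].
  have /eqP := oner_neq0 K; apply; rewrite [LHS]one big1 // => l _.
  have [b ab <-] := ga l; have [G GE] := pi_surj b.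
  rewrite (killK b) ?mulr0 //; apply: ideal_gen_sub; exists G; split=> //.
  by apply: (chart_section_ok inat aP); rewrite GE.
move=> [N [c [g [gB one]]]].
have /boolp.choice[C CE] : forall j, exists p, pi p = c j by move=> j; exact: pi_surj.
have /boolp.choice[G GE] := gB.
exists N, C, G; split=> [j|x hx]; first by have [] := GE j.
have [ev evE] := eval_exists hx; rewrite -(rmorph1 ev) one rmorph_sum.
apply: eq_bigr => j _; have [<- _] := GE j.
by rewrite rmorphM -CE !evE.
Qed.

End Universal.

Lemma point_of_incl (G H : subringClosed k) (gB : forall b, iotaB b \in G)
    (hB : forall b, iotaB b \in H) (GH : {subset G <= H}) (z : XB (sub_alg gB)) :
  point_of (Defs.fmap XB (sub_alg_incl GH gB hB) z) = point_of z.
Proof. by rewrite /point_of -(@Defs.fmap_comp _ XB _ _ _ _ _ (sub_val gB)). Qed.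

(** By separatedness the equality of two points is a family of equations in [H]; they hold in k,
    hence in [H]. *)
Lemma point_of_inj (H : subringClosed k) (hB : forall b, iotaB b \in H)
    (z z' : XB (sub_alg hB)) : point_of z = point_of z' -> z = z'.
Proof.
move=> zz'; have [a aP] := XB_sep z z'.
have a0 r : a r -> r = 0.
  have /aP h : Defs.fmap XB (sub_val hB) z = Defs.fmap XB (sub_val hB) z'.
    by apply: (bij_inj (e_bij Ck)); apply: eq_zeros => i; exact: (congr1 (fun g => g i) zz').
  by move=> /h r0; apply: val_inj.
pose id' : alg_hom (sub_alg hB) (sub_alg hB) :=
  @AlgHom B (sub_alg hB) (sub_alg hB) idfun (fun _ => erefl).
have := proj2 (aP _ id') a0; by rewrite !fmap_id.
Qed.

(** The values G_j(x) generate the unit ideal of [H]. The point lifts over the localizations at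
    these values, the lifts agree on overlaps by [point_of_inj], and the sheaf property glues
    them. *)
Lemma spreading : ~ ideal_gen I 1 -> exists cs : seq k,
  forall (H : subringClosed k) (hB : forall b, iotaB b \in H) (x : 'I_n -> k),
    {subset cs <= H} -> (forall i, x i \in H) -> zero_of x ->
    exists z : XB (sub_alg hB), point_of z = x.
Proof.
move=> I1; have [Q [pi [pi_surj pi_ker]]] := quotient_exists (ideal_gen_ideal I) I1.
have [ei eiK eKi] := e_bij (Qa pi).
have [N [C [G [ok sum1]]]] := section_partition pi_surj (eKi (univ pi_ker)).
have /boolp.choice[csj csP] := ok.
pose coefs (p : P) := [seq mcoeff m p | m <- msupp p].
exists (flatten [seq csj j ++ coefs (C j) ++ coefs (G j) | j <- enum 'I_N]).
move=> H hB x csH xH hx.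
have sub j z : z \in csj j ++ coefs (C j) ++ coefs (G j) -> z \in H.
  by move=> zj; apply: csH; apply/flatten_mapP; exists j; rewrite ?mem_enum.
have CH j : meval x (C j) \in H.
  apply: meval_in => // m mp; apply: (sub j); rewrite !mem_cat.
  by apply/orP; right; apply/orP; left; apply/mapP; exists m.
have GH j : meval x (G j) \in H.
  apply: meval_in => // m mp; apply: (sub j); rewrite !mem_cat.
  by apply/orP; right; apply/orP; right; apply/mapP; exists m.
have [j0 Gj0] : exists j, meval x (G j) != 0.
  apply: contrapT => nj; have /eqP := oner_neq0 k; apply.
  rewrite -(sum1 x hx) big1 // => j _; have [->|Gj] := eqVneq (meval x (G j)) 0.
    by rewrite mulr0.
  by case: nj; exists j.
(* Indices where [G j] vanishes at [x] contribute nothing to the cover. *)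
pose sg j := if meval x (G j) != 0 then j else j0.
pose f j := meval x (G (sg j)).
have f0 j : f j != 0 by rewrite /f /sg; case: ifP.
have fH j : f j \in H by exact: GH.
pose L j : subringClosed k := loc_ring (fH j).
pose L2 i j : subringClosed k := loc_ring (rpredM (fH i) (fH j)).
have HL j : {subset H <= L j} := @sub_loc_ring k H (f j) (fH j).
have LL2l i j : {subset L i <= L2 i j}.
  move=> z /asboolP[m zm]; apply/asboolP; exists m.
  by rewrite exprMn mulrA rpredM // rpredX.
have LL2r i j : {subset L j <= L2 i j}.
  move=> z /asboolP[m zm]; apply/asboolP; exists m.
  by rewrite exprMn mulrCA rpredM // rpredX.
have LB j b : iotaB b \in L j by exact: HL.
have L2B i j b : iotaB b \in L2 i j by apply: (LL2l i j); exact: LB.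
have zex j : exists z : XB (sub_alg (LB j)), point_of z = x.
   apply: (csP (sg j)) => //.
  - by move=> c cj; apply/HL/(sub (sg j)); rewrite mem_cat cj.
  - by move=> i; exact: HL.
  - exact: f0.
  - exact: loc_ring_inv (f0 j).
pose z j := sval (cid (zex j)); have zE j : point_of (z j) = x := svalP (cid (zex j)).
pose F j : sub_alg hB := Subring (fH j).
have F1 : ideal_gen (range F) 1.
  pose c j : subring H := if meval x (G j) != 0 then Subring (CH j) else 0.
  exists N, c, F; split=> [j|]; first by exists j.
  apply: val_inj; rewrite [RHS](rmorph_sum (val : subring H -> k)) /= -(sum1 x hx).
  apply: eq_bigr => j _; rewrite /c /f /sg.
  by have [->|_] := eqVneq (meval x (G j)) 0; rewrite /= ?mul0r ?mulr0.
pose phi j : alg_hom (sub_alg hB) (sub_alg (LB j)) := sub_alg_incl (HL j) hB (LB j).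
pose l i j := sub_alg_incl (LL2l i j) (LB i) (L2B i j).
pose r i j := sub_alg_incl (LL2r i j) (LB j) (L2B i j).
have loc j : is_localization (F j) (phi j).
  by apply: (loc_ring_localization (fH := fH j)).
have loc2 i j : is_localization (F i * F j) (l i j \o phi i).
  apply: (loc_ring_localization (fH := rpredM (fH i) (fH j))) => //.
  by rewrite mulf_neq0.
have lr i j : l i j \o phi i =1 r i j \o phi j by move=> a; apply: val_inj.
have agree i j : Defs.fmap XB (l i j) (z i) = Defs.fmap XB (r i j) (z j).
  by apply: point_of_inj; rewrite !point_of_incl !zE.
have [y [yE _]] := XB_sheaf F1 loc loc2 lr agree.
by exists y; rewrite -(zE j0) -(yE j0) point_of_incl.
Qed.

End Spreading.

(** The ring [H] is generated by [a], the generators of the base of the model and the constants of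
    [spreading]; the points in question all come from the finitely many [H]-points of the model. *)
Lemma hyperbolic_finite (k : closedFieldType) n (I : set {mpoly k[n]}) :
  arithmetically_hyperbolic (closed_subscheme I) ->
  forall m (a : 'I_m -> k),
    finite_set [set x : 'I_n -> k | (forall i, x i \in gen_ring a) /\ zero_of I x].
Proof.
move=> [B [iotaB [XB [iota_inj [mB [bB bBP]] [[XBsh XBat XBsep] [e [enat ebij]]] fin]]]] m a.
have [I1|I1] := pselect (ideal_gen I 1).
  have -> : [set x : 'I_n -> k | (forall i, x i \in gen_ring a) /\ zero_of I x] = set0.
    apply/seteqP; split=> // x [_ hx].
    have /eqP := oner_neq0 k; case.
    have /eqP := aeval_ideal (R := self_alg k) (x := x) hx I1.
    by rewrite -[aeval _ _]/(meval x 1) meval1 => /eqP.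
  exact: finite_set0.
have [cs csP] := spreading XBsh XBat XBsep enat ebij I1.
pose s := [seq a i | i <- enum 'I_m] ++ [seq iotaB (bB i) | i <- enum 'I_mB] ++ cs.
pose H := gen_ring_seq s.
have sH z : z \in s -> z \in H by exact: gen_ring_seq_mem.
have hB b : iotaB b \in H.
  have [p ->] := bBP b; rewrite rmorph_mmap; apply: mmap_in => [z|i].
    by rewrite /= rmorph_int rpred_int.
  apply: sH; rewrite !mem_cat; apply/orP; right; apply/orP; left.
  by apply/mapP; exists i; rewrite ?mem_enum.
have Hfin : finite_set [set: XB (sub_alg hB)].
  apply: (fin (subring H) (val : subring H -> k) (to_subring hB)) => //.
  exact: fg_gen_ring.
apply: sub_finite_set (finite_image (fun z : XB (sub_alg hB) => point_of e z) Hfin).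
move=> x [xa hx]; have [||z zE] := csP H hB x _ _ hx.
- by move=> c cc; apply: sH; rewrite !mem_cat cc !orbT.
- move=> i; apply: gen_ring_min (xa i) => l; apply: sH; rewrite mem_cat.
  by apply/orP; left; apply/mapP; exists l; rewrite ?mem_enum.
- by exists z.
Qed.

(** * The theorem *)

Lemma pchar0_ext (k M : fieldType) (s : {rmorphism k -> M}) :
  [pchar k] =i pred0 -> [pchar M] =i pred0.
Proof. by move=> k0 q; rewrite -(k0 q) !inE -(fmorph_eq0 s) rmorph_nat. Qed.

(** The base of a model must be finitely generated: it is the subring generated by [b0], to which
    [g] transports the equations. *)
Lemma closed_subscheme_hyperbolic (k : closedFieldType) n (O : comNzRingType)
    (J : set {mpoly O[n]}) (h : {rmorphism O -> k}) (M : closedFieldType)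
    (s : {rmorphism k -> M}) :
  fg_consts h -> finite_fg_zeros J (s \o h) ->
  arithmetically_hyperbolic
    (base_change s (closed_subscheme (ideal_gen [set map_mpoly h p | p in J]))).
Proof.
move=> [m0 [b0 hb0]] fin.
pose G : subringClosed k := gen_ring b0.
pose g : {rmorphism O -> subring G} := to_subring (G := G) hb0.
pose iota : {rmorphism subring G -> M} := s \o (val : subring G -> k).
exists (subring G), iota, (closed_subscheme [set map_mpoly g p | p in J]); split.
- by move=> a b /fmorph_inj ab; apply: val_inj.
- exact: fg_gen_ring.
- exact: (@closed_subscheme_model _ _ _ k M _ s iota O J h g).
move=> A' iota' j iota'_inj [m [a aP]] ij.
apply: (@finite_by_fibers _ _ _ [:: fun (x : zeros _ (Algebra j)) l => iota' (sval x l)]).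
  move=> _ [<-|//]; apply: sub_finite_set (fin m (iota' \o a)) => _ [x _ <-]; split=> [l|p Jp].
    have [p ->] := aP (sval x l); rewrite rmorph_mmap; apply/asboolP; exists p.
    by apply: eq_mmap => [z|//]; rewrite /= rmorph_int.
  have xp : mmap j (sval x) (map_mpoly g p) = 0.
    by apply: (svalP x (map_mpoly g p)); exists p.
  transitivity (iota' (mmap j (sval x) (map_mpoly g p))); last by rewrite xp rmorph0.
  by rewrite mmap_map_mpoly rmorph_mmap; apply: eq_mmap => // o; have /= := ij (g o).
move=> x y _ _ /(_ _ (or_introl erefl)) xy; apply: eq_zeros => l.
by apply: iota'_inj; exact: (congr1 (fun f : 'I_n -> M => f l) xy).
Qed.

Unset Implicit Arguments.

(** The equality of ideals expresses that the model and X have compatible embeddings in affine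
    space. The field [R] carries the heights. *)
Theorem corollary1p6 (R : realType) (n : nat)
    (I : prime_idealr {mpoly algC[n]})
    (K : fieldExtType rat) (iota : {rmorphism K -> algC})
    (S : set (place K)) (J : idealr {mpoly (S_integers S)[n]}) :
  let X := closed_subscheme [set p | p \in I] in
  let XX := closed_subscheme [set p | p \in J] in
  finite_set S ->
  arithmetically_hyperbolic X ->
  [set p | p \in I] =
    ideal_gen [set map_mpoly (iota \o @S_val K S) p | p in [set p | p \in J]] ->
  (forall (A : idomainType) (j : {rmorphism S_integers S -> A}),
     injective j -> fg_ring A ->
   forall (t : nat) (F : 'I_t -> function_field)
          (e : forall i, {rmorphism {fraction A} -> F i}),
   let pt (x : XX (Algebra j)) (l : 'I_n) : {fraction A} := tofrac (sval x l) in
   let JL := [set map_mpoly (fun a => tofrac (j a)) p | p in [set p | p \in J]] in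
   exists R' : set (XX (Algebra j)),
     zariski_closure JL (pt @` R') = zariski_closure JL (range pt) /\
     forall i, exists B : R, forall x, R' x ->
       (aff_height R (e i \o pt x) <= B%:E)%E) ->
  absolutely_arithmetically_hyperbolic X.
Proof.
move=> X XX finS hypX IE bnd M s; rewrite /X IE.
pose Js := [set p | p \in J].
pose h : {rmorphism S_integers S -> algC} := iota \o (val : S_integers S -> K).
have h_inj : injective h by move=> a b /fmorph_inj ab; apply: val_inj.
have h_fg : fg_consts h.
  have [m [b bP]] := S_integers_fg finS; exists m, (iota \o b) => o.
  have /asboolP[p pE] := bP o.
  have -> : h o = mmap intr (iota \o b) p.
    rewrite /= [X in iota X]pE rmorph_mmap.
    by apply: eq_mmap => [z|//]; rewrite /= rmorph_int.
  by apply/asboolP; exists p.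
have h_fin : finite_fg_zeros Js h.
  move=> m a; apply: sub_finite_set (hyperbolic_finite hypX a) => x [xa xJ].
  split=> // p Ip; have : ideal_gen [set map_mpoly h p | p in Js] p.
    by move: Ip; rewrite /Js -IE.
  apply: (aeval_ideal (R := self_alg algC)) => _ [q Jq <-].
  by have := xJ q Jq; rewrite -(@map_mpoly_meval _ _ _ h).
have M0 : [pchar M] =i pred0 by apply: (pchar0_ext s); exact: pchar_num.
have sh_inj : injective (s \o h) by move=> a b /fmorph_inj /h_inj.
(* The induction starts from the algebraic numbers, embedded in [M] by [s]. *)
pose K0 := @FiniteSubfield _ _ Js M (s \o h) algC s h (fun _ => erefl) h_fin.
apply: (@closed_subscheme_hyperbolic algC n _ Js h M s h_fg).
exact: (finite_subfield_total bnd M0 sh_inj (K := K0) h_fg).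
Qed.
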